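(* Let $k \geq 4$ be an integer, and let $G$ be a $1$-tough and $(k-1)$-connected $(P_2 \cup kP_1)$-free graph. If $|V(G)| \ge k^2+k+1$ and $\delta(G) \ge k$, then $G$ is hamiltonian.
   Context: All graphs are finite and simple. A graph is hamiltonian if it has a cycle passing through all its vertices. For a graph $G$ and $S \subset V(G)$, $\omega(G-S)$ denotes the number of components of $G-S$. A graph $G$ is $1$-tough if $|S| \ge \omega(G-S)$ for every $S \subset V(G)$ with $\omega(G-S) \ge 2$ (complete graphs are $1$-tough). $P_2 \cup kP_1$ denotes the disjoint union of a single edge and $k$ isolated vertices; $G$ is $(P_2 \cup kP_1)$-free if it has no induced subgraph isomorphic to $P_2 \cup kP_1$. $\delta(G)$ is the minimum degree of $G$. *)

(* Defs.v *)
From HB Require Import structures.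
From mathcomp Require Import all_boot.

Set Implicit Arguments.
Unset Strict Implicit.
Unset Printing Implicit Defensive.

Record sgraph := SGraph {
  vertex :> finType;
  adj : rel vertex;
  adj_sym : symmetric adj;
  adj_irr : irreflexive adj }.

Definition deg (G : sgraph) (x : G) : nat := #|[set y | adj x y]|.

(* Every degree is smaller than #|G|, so the default value #|G| is never
   attained when G has a vertex. *)
Definition min_deg (G : sgraph) : nat := \big[minn/#|G|]_(x : G) deg x.

Definition adj_del (G : sgraph) (S : {set G}) : rel G :=
  [rel x y | [&& x \notin S, y \notin S & adj x y]].

(* Number of components of G - S: the vertices of S are isolated for adj_del S
   and are not counted. *)
Definition omega (G : sgraph) (S : {set G}) : nat := n_comp (adj_del S) (~: S).

Definition one_tough (G : sgraph) : Prop :=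
  forall S : {set G}, 2 <= omega S -> omega S <= #|S|.

Definition k_connected (k : nat) (G : sgraph) : Prop :=
  k < #|G| /\ forall S : {set G}, #|S| < k -> omega S = 1.

Definition hamiltonian (G : sgraph) : Prop :=
  exists c : seq G, [/\ 3 <= size c, ucycle (@adj G) c & forall x : G, x \in c].

Definition induced_embedding (H G : sgraph) (f : H -> G) : Prop :=
  injective f /\ forall x y : H, adj (f x) (f y) = adj x y.

Definition free_of (H G : sgraph) : Prop :=
  ~ exists f : H -> G, induced_embedding f.

Definition path_adj (n : nat) : rel 'I_n :=
  [rel i j : 'I_n | (i.+1 == j) || (j.+1 == i)].

Lemma path_adj_sym n : symmetric (@path_adj n).
Proof. by move=> i j; rewrite /path_adj /= orbC. Qed.

Lemma path_adj_irr n : irreflexive (@path_adj n).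
Proof. by move=> i; rewrite /path_adj /= orbb eqn_leq ltnn. Qed.

Definition path_graph (n : nat) : sgraph :=
  SGraph (@path_adj_sym n) (@path_adj_irr n).

Definition union_adj (G H : sgraph) : rel (G + H)%type :=
  fun u v => match u, v with
             | inl x, inl y => adj x y
             | inr x, inr y => adj x y
             | _, _ => false
             end.

Lemma union_adj_sym G H : symmetric (@union_adj G H).
Proof. by move=> [x|x] [y|y] //=; rewrite adj_sym. Qed.

Lemma union_adj_irr G H : irreflexive (@union_adj G H).
Proof. by move=> [x|x] /=; rewrite adj_irr. Qed.

Definition disjoint_union (G H : sgraph) : sgraph :=
  SGraph (@union_adj_sym G H) (@union_adj_irr G H).

Definition copies_adj (k : nat) (G : sgraph) : rel ('I_k * G)%type :=
  [rel u v | (u.1 == v.1) && adj u.2 v.2].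

Lemma copies_adj_sym k G : symmetric (@copies_adj k G).
Proof. by move=> u v; rewrite /copies_adj /= eq_sym adj_sym. Qed.

Lemma copies_adj_irr k G : irreflexive (@copies_adj k G).
Proof. by move=> u; rewrite /copies_adj /= adj_irr andbF. Qed.

Definition copies (k : nat) (G : sgraph) : sgraph :=
  SGraph (@copies_adj_sym k G) (@copies_adj_irr k G).

Definition P2_kP1 (k : nat) : sgraph :=
  disjoint_union (path_graph 2) (copies k (path_graph 1)).

(* Main.v *)
(** Let [c] be a longest cycle and suppose that some vertex lies off [c].

    If an off-cycle vertex [h] has no neighbour off [c], then [h] and the successors [D] of its
    neighbours are independent; extend them to a maximal independent set [I]. Freeness makes
    every vertex outside [I] miss fewer than [k] vertices of [I]. Toughness yields an edge of
    [c] outside [I], and rerouting the cycle there limits how many vertices outside [I] a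
    vertex of [I] can see. Double counting the edges between [I] and its complement then
    contradicts [k ^ 2 + k + 1 <= #|G|].

    Otherwise let [H] be a component of [G - c] and [A] its set of neighbours. Freeness and
    connectivity give [#|A| = k - 1], make [H] a clique and [c] together with [H] spanning, and
    sort most vertices of [c] into cliques of vertices private to one successor of [A]. These
    cliques cut [c] into [k - 1] chains. Connectivity shows that the anchor of each chain or its
    predecessor sees the clique of the following chain, toughness provides an edge jumping
    between chains, and the two together produce a cycle longer than [c] through [H]. *)

Require Import Defs.
From HB Require Import structures.
From mathcomp Require Import all_boot zify.

Set Implicit Arguments.
Unset Strict Implicit.
Unset Printing Implicit Defensive.

(** * Walks, cycles and separators *)

Section Walks.

Variable G : sgraph.
Implicit Types (x y z u v w : G) (s t : seq G) (S F J : {set G}).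

(** The obstacle in the first case is that a rerouting through [h] may lose a vertex of [c] and so
    be no longer than [c]. Reroutings therefore also record which neighbouring pairs survive: apart
    from the lost vertex, only pairs meeting [D] are cut. The lost vertex can then be put back into
    a surviving edge outside [I], possibly after replacing other vertices of [I] one by one; [W] is
    the set of vertices that can be recovered in this way. The rest of [I] on the cycle forms [K].
    It has at most [2 * k - 3] vertices, while a vertex outside [I] sees all but at most [k - 1]
    vertices of [h |: K]; toughness puts at least half of [G] outside [I], and this is where a bound
    quadratic in [k] enters. In the second case [#|A| = k - 1] is one less than freeness forbids, so
    adding one suitable vertex to [D], or exchanging one of its vertices for two, is already a
    contradiction. Since [H] is a clique with at least two vertices, a rerouting gains all of [H]
    and may lose one vertex of [c]. *)

Definition walk x y s : bool :=
  if s is a :: s' then [&& a == x, path (@adj G) a s' & last a s' == y] else false.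

Lemma walk1 x : walk x x [:: x].
Proof. by rewrite /walk /= !eqxx. Qed.

(** Both ends belong to the list, so gluing two walks along an edge is plain concatenation, and the
    vertex count of a rerouting becomes a [perm_eq] between lists. *)
Lemma walk_cat x y z w s t :
  walk x y s -> adj y z -> walk z w t -> walk x w (s ++ t).
Proof.
case: s => //= a s /and3P[/eqP-> ps /eqP ls] yz.
case: t => //= b t /and3P[/eqP-> pt /eqP lt].
by rewrite eqxx cat_path last_cat ps ls /= yz pt lt eqxx.
Qed.

Lemma walk_catE x w s a t :
  walk x w (s ++ a :: t) -> s != [::] ->
  exists y, [/\ walk x y s, adj y a & walk a w (a :: t)].
Proof.
case: s => //= b s; rewrite cat_path last_cat /=.
case/and3P=> /eqP-> /and3P[ps ya pt] /eqP lt _.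
by exists (last x s); rewrite /walk ps ya pt lt !eqxx.
Qed.

Lemma walk_rev x y s : walk x y s -> walk y x (rev s).
Proof.
case: s => //= a s /and3P[/eqP-> ps /eqP ls].
rewrite rev_cons -ls; case: (lastP s) ps ls => [|s' b] /=; first by rewrite eqxx.
rewrite last_rcons rev_rcons => ps lb /=.
have := rev_path (@adj G) x (rcons s' b); rewrite belast_rcons last_rcons.
rewrite rev_cons => E.
rewrite eqxx last_rcons eqxx andbT /=.
rewrite E; move: ps; congr (is_true _).
by apply: eq_path => u v; rewrite adj_sym.
Qed.

Lemma walk_last x y z s : walk x y s -> last z s = y.
Proof. by case: s => //= a s /and3P[_ _ /eqP]. Qed.

Lemma walk_head x y z s : walk x y s -> head z s = x.
Proof. by case: s => //= a s /and3P[/eqP]. Qed.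

Lemma walk_cycle x y s : walk x y s -> adj y x -> cycle (@adj G) s.
Proof.
by case: s => //= a s /and3P[/eqP-> ps /eqP ls] yx; rewrite rcons_path ps ls.
Qed.

Lemma cycle_walk x s : cycle (@adj G) (x :: s) ->
  walk x (last x s) (x :: s) /\ adj (last x s) x.
Proof. by rewrite /= rcons_path => /andP[-> ->]; rewrite !eqxx. Qed.

Lemma adj_neq x y : adj x y -> x != y.
Proof. by apply: contraTneq => ->; rewrite adj_irr. Qed.

Lemma next_cat2 s a d t : uniq (s ++ a :: d :: t) -> next (s ++ a :: d :: t) a = d.
Proof.
move=> U.
have E : rot (size s) (s ++ a :: d :: t) = a :: d :: t ++ s by rewrite rot_size_cat.
by rewrite -(next_rot (size s)) // E /= eqxx.
Qed.

Lemma prev_cat2 s a d t : uniq (s ++ a :: d :: t) -> prev (s ++ a :: d :: t) d = a.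
Proof. by move=> U; rewrite -{2}(next_cat2 U) prev_next. Qed.

Lemma walk_cut x y s a d t : walk x y (s ++ a :: d :: t) ->
  [/\ walk x a (s ++ [:: a]), adj a d & walk d y (d :: t)].
Proof.
rewrite -(cat1s a) catA => W.
have nz : s ++ [:: a] != [::] by case: s {W}.
have [z [W1 zd W2]] := walk_catE W nz.
have za : z = a by move: (walk_last a W1); rewrite last_cat.
by rewrite za in W1 zd; split.
Qed.

Lemma rot_next s x : uniq s -> 1 < size s -> x \in s ->
  exists n t, rot n s = x :: next s x :: t.
Proof.
move=> U s1 /rot_to[n t E]; exists n.
have : 1 < size (rot n s) by rewrite size_rot.
case: t E => [|d t] E; first by rewrite E.
by move=> _; exists t; rewrite E -(next_rot n U) E /= eqxx.
Qed.

Lemma next_next_neq s x : uniq s -> 2 < size s -> x \in s -> next s (next s x) != x.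
Proof.
move=> U s2 xs; have [n [[|e t] E]] := rot_next U (ltnW s2) xs.
  by move: s2; rewrite -(size_rot n) E.
move: (U); rewrite -(rot_uniq n) E => U'.
have -> : next s (next s x) = e.
  by rewrite -(next_rot n U) E; apply: (@next_cat2 [:: x]).
move: U' => /= /and3P[+ _ _].
by rewrite !inE !negb_or (eq_sym x e) => /and3P[].
Qed.

Lemma rot_catC (c M N : seq G) n : rot n c = M ++ N -> exists m, rot m c = N ++ M.
Proof.
move=> E; have [le|gt] := leqP n (size c).
  have lM : size M <= size c by rewrite -(size_rot n c) E size_cat leq_addr.
  exists (if size M + n <= size c then size M + n else size M + n - size c).
  by rewrite -rot_add_mod // E rot_size_cat.
by exists (size M); rewrite rot_oversize ?(ltnW gt) // in E; rewrite E rot_size_cat.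
Qed.

(** Consecutive positions without wrapping around; [consec_nb] turns this into cyclic neighbours in
    either direction. *)
Fixpoint consec x y s : bool :=
  if s is a :: s' then
    (if s' is b :: _ then (a == x) && (b == y) else false) || consec x y s'
  else false.

Lemma consecP x y s : reflect (exists s1 s2, s = s1 ++ x :: y :: s2) (consec x y s).
Proof.
elim: s => [|a s IH] /=; first by right=> -[[|? ?]] [?].
apply: (iffP orP) => [[]|].
- by case: s {IH} => // b s /andP[/eqP-> /eqP->]; exists [::], s.
- by case/IH=> s1 [s2 ->]; exists (a :: s1), s2.
case=> [[|b s1]] [s2] /=.
  by case=> -> ->; rewrite !eqxx; left.
by case=> _ E; right; apply/IH; exists s1, s2.
Qed.

Lemma consec_rev x y s : consec x y (rev s) = consec y x s.
Proof.
apply/consecP/consecP => -[s1 [s2 E]]; exists (rev s2), (rev s1).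
  by rewrite -(revK s) E rev_cat !rev_cons -!cats1 -!catA.
by rewrite E rev_cat !rev_cons -!cats1 -!catA.
Qed.

Lemma consec_catl x y s t : consec x y s -> consec x y (s ++ t).
Proof. by case/consecP=> s1 [s2 ->]; apply/consecP; exists s1, (s2 ++ t); rewrite -catA. Qed.

Lemma consec_catr x y s t : consec x y t -> consec x y (s ++ t).
Proof. by case/consecP=> s1 [s2 ->]; apply/consecP; exists (s ++ s1), s2; rewrite catA. Qed.

Lemma consec_revI x y s : consec y x s -> consec x y (rev s).
Proof. by rewrite consec_rev. Qed.

Lemma consec_catE x y s t : consec x y (s ++ t) ->
  [\/ consec x y s, consec x y t | exists s1 t1, s = rcons s1 x /\ t = y :: t1].
Proof.
elim: s => [|a s IH] /=; first by constructor 2.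
case/orP; last first.
  case/IH=> [H|H|[s1 [t1 [-> ->]]]]; last by constructor 3; exists (a :: s1), t1.
    by constructor 1; rewrite H orbT.
  by constructor 2.
case: s {IH} => [|b s] /=.
  by case: t => // b t /andP[/eqP-> /eqP->]; constructor 3; exists [::], t.
by move=> ->; constructor 1.
Qed.

Lemma consec_next x y s : uniq s -> consec x y s -> next s x = y.
Proof. by move=> U /consecP[s1 [s2 E]]; move: U; rewrite E => /next_cat2. Qed.

Definition nb s x y := (next s x == y) || (next s y == x).

Lemma consec_nb x y s : uniq s -> consec x y s || consec y x s -> nb s x y.
Proof. by move=> U /orP[] /(consec_next U) E; rewrite /nb E eqxx ?orbT. Qed.

(** The list orients the cycle in a way that the caller does not control; when [y] precedes [x], the
    reversed walk is inserted. *)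
Lemma cycle_insert c q x y x' y' : uniq c -> 1 < size c -> cycle (@adj G) c ->
  x \in c -> y \in c -> nb c x y -> walk x' y' q -> adj x x' -> adj y' y ->
  exists2 s, cycle (@adj G) s & perm_eq s (q ++ c).
Proof.
move=> U c1 cc xc yc N Wq xx yy.
have key a b r a' b' : a \in c -> next c a = b -> walk a' b' r -> adj a a' -> adj b' b ->
    exists2 s, cycle (@adj G) s & perm_eq s (r ++ c).
  move=> ac ab Wr aa bb; have [n [t E]] := rot_next U c1 ac.
  rewrite ab in E; have cE : perm_eq c (a :: b :: t) by rewrite -E perm_sym perm_rot.
  have: cycle (@adj G) (rot 1 (a :: b :: t)) by rewrite rot_cycle -E rot_cycle.
  rewrite rot1_cons => /= cy; have [W la] := cycle_walk cy.
  rewrite last_rcons in W la.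
  exists ((b :: rcons t a) ++ r); first exact: (walk_cycle (walk_cat W aa Wr)).
  rewrite perm_catC perm_cat2l perm_sym (perm_trans cE) // -rcons_cons perm_sym.
  by rewrite perm_rcons.
case/orP: N => /eqP E; first exact: (key x y q x' y').
have [] := key y x (rev q) y' x' yc E (walk_rev Wq).
- by rewrite adj_sym.
- by rewrite adj_sym.
move=> s cs ps; exists s => //; apply: (perm_trans ps).
by rewrite perm_cat2r perm_rev.
Qed.

Definition clique (s : seq G) := {in s &, forall x y, x != y -> adj x y}.

Lemma clique_path x s : clique (x :: s) -> uniq (x :: s) -> path (@adj G) x s.
Proof.
elim: s x => //= y s IH x cl /and3P[]; rewrite inE negb_or => /andP[xy xs] ys U.
rewrite cl ?inE ?eqxx ?orbT //=; apply: IH; last by rewrite /= ys.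
by move=> u v us vs; apply: cl; rewrite inE ?us ?vs orbT.
Qed.

Lemma clique_walk s x y : clique s -> uniq s -> x \in s -> y \in s -> x != y ->
  exists2 s', perm_eq s' s & walk x y s'.
Proof.
move=> cl U xs ys xy; pose r := rem y (rem x s).
have y1 : y \in rem x s by rewrite mem_rem_uniq // inE eq_sym xy.
have E : perm_eq (x :: rcons r y) s.
  rewrite perm_sym; apply: (perm_trans (perm_to_rem xs)); rewrite perm_cons.
  by apply: (perm_trans (perm_to_rem y1)); rewrite perm_sym perm_rcons.
exists (x :: rcons r y) => //; rewrite /walk eqxx last_rcons eqxx andbT /=.
apply: clique_path; last by rewrite (perm_uniq E).
by move=> u v; rewrite !(perm_mem E); apply: cl.
Qed.

End Walks.

Arguments walk : simpl never.

Ltac perm_count :=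
  apply/permP => ?; rewrite -?cats1; repeat progress rewrite ?(count_cat, count_rev) /=; clear; lia.

Ltac consec_auto :=
  apply/orP;
  first [ left; solve [auto 9 using consec_catl, consec_catr, consec_revI]
        | right; solve [auto 9 using consec_catl, consec_catr, consec_revI] ].

(** * Separators, the forbidden subgraph and longest cycles *)

Section Graph.

Variable G : sgraph.
Implicit Types (x y z u v w : G) (s t : seq G) (S F J : {set G}).

Lemma adj_del_sym S : symmetric (adj_del S).
Proof. by move=> x y; rewrite /adj_del /= adj_sym andbCA. Qed.

Lemma connect_del_sym S : connect_sym (adj_del S).
Proof. exact/sym_connect_sym/adj_del_sym. Qed.

Lemma closed_del S F : (forall u v, u \in F -> adj u v -> v \in F :|: S) ->
  closed (adj_del S) (mem F).
Proof.
move=> cF; apply: (intro_closed (connect_del_sym S)) => x y /and3P[_ yS xy] xF.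
by have := cF _ _ xF xy; rewrite inE (negPf yS) orbF.
Qed.

Lemma root_del S z : z \notin S ->
  root (adj_del S) z \in [predI roots (adj_del S) & ~: S].
Proof.
move=> zS; apply/andP; split; first exact: (roots_root (connect_del_sym S)).
have cS : closed (adj_del S) (mem (~: S)).
  apply: (intro_closed (connect_del_sym S)) => u v /and3P[uS vS _].
  by rewrite !inE vS.
have := closed_connect cS (connect_root (adj_del S) z).
by rewrite !inE zS => <-.
Qed.

(** All neighbours of [F] lie in [F] or [S], so [x] and [y] have different roots in [G - S], which
    therefore has more than one component. *)
Lemma separator_card m S F x y : k_connected m G ->
  (forall u v, u \in F -> adj u v -> v \in F :|: S) ->
  x \in F -> x \notin S -> y \notin F -> y \notin S -> m <= #|S|.
Proof.
move=> [_ conn] cF xF xS yF yS; rewrite leqNgt; apply/negP=> /conn.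
have rS := @root_del S.
rewrite /omega /n_comp_mem => /eqP/card1P[r Er].
have : root (adj_del S) x = root (adj_del S) y.
  by move: (rS _ xS) (rS _ yS); rewrite !Er !inE => /eqP-> /eqP->.
move/eqP; rewrite (root_connect (connect_del_sym S)).
by move/(closed_connect (closed_del cF)); rewrite xF (negPf yF).
Qed.

Lemma omega_ge S J : (forall x, x \in J -> x \notin S) ->
  {in J &, forall x y, connect (adj_del S) x y -> x = y} -> #|J| <= omega S.
Proof.
move=> JS Jc; rewrite /omega /n_comp_mem.
have inj : {in J &, injective (root (adj_del S))}.
  by move=> x y xJ yJ /eqP; rewrite (root_connect (connect_del_sym S)); apply: Jc.
rewrite -(card_in_imset inj); apply/subset_leq_card/subsetP=> _ /imsetP[z zJ ->].
by apply/root_del/JS.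
Qed.

Definition stable J := {in J &, forall x y, ~~ adj x y}.

(** The edge [x y] and [k] vertices of [J] would induce the forbidden graph. Every use of freeness
    goes through this bound. *)
Lemma free_stable k J x y : free_of (P2_kP1 k) G -> adj x y -> stable J ->
  (forall z, z \in J -> ~~ adj x z /\ ~~ adj y z) -> #|J| < k.
Proof.
move=> fr xy st Jn; rewrite ltnNge; apply/negP=> kJ; apply: fr.
pose f (i : P2_kP1 k) : G := match i with
  | inl j => if (j : nat) == 0 then x else y
  | inr j => nth x (enum J) j.1 end.
have lt (j : 'I_k) : j < size (enum J) by rewrite -cardE (leq_trans _ kJ).
have inJ (j : 'I_k) : nth x (enum J) j \in J by rewrite -mem_enum mem_nth.
exists f; split.
  case=> [i|[i i']] [j|[j j']] //=.
  - case: i j => [[|[|//]]] Hi [[|[|//]] Hj] /= E; congr inl; apply/val_inj => //=.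
      by move: xy; rewrite E adj_irr.
    by move: xy; rewrite E adj_irr.
  - case: (_ == _) => E; move: (Jn _ (inJ j)); rewrite -E; case.
      by move=> _; rewrite adj_sym xy.
    by rewrite xy.
  - case: (_ == _) => E; move: (Jn _ (inJ i)); rewrite E; case.
      by move=> _; rewrite adj_sym xy.
    by rewrite xy.
  move=> /eqP; rewrite nth_uniq ?enum_uniq ?lt // => /eqP E.
  by congr inr; congr pair; apply/val_inj => //; rewrite !ord1.
case=> [i|[i i']] [j|[j j']] //=.
- case: i j => [[|[|//]]] Hi [[|[|//]] Hj] /=; rewrite ?adj_irr ?xy //.
  by rewrite adj_sym xy.
- by case: (_ == _); apply/negbTE; case: (Jn _ (inJ j)).
- by rewrite adj_sym; case: (_ == _); apply/negbTE; case: (Jn _ (inJ i)).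
- have -> : copies_adj (i, i') (j, j') = false.
    by rewrite /copies_adj /= !ord1 /path_adj /= andbF.
  by apply/negbTE/st.
Qed.

Lemma min_deg_le x : min_deg G <= deg x.
Proof.
rewrite /min_deg; have: x \in index_enum G by rewrite mem_index_enum.
elim: (index_enum G) => //= y r IH; rewrite big_cons inE.
by case/predU1P=> [->|/IH le]; rewrite ?geq_minl // geq_min le orbT.
Qed.

Lemma deg_pos_neighbours k x : 2 <= k -> k <= min_deg G ->
  exists y z, [/\ adj x y, adj x z & y != z].
Proof.
move=> k2 kd; have := leq_trans (leq_trans k2 kd) (min_deg_le x).
by case/card_gt1P=> y [z [+ + yz]]; rewrite !inE => xy xz; exists y, z.
Qed.

Lemma path_del S x s : path (adj_del S) x s -> x \notin S ->
  path (@adj G) x s /\ {in x :: s, forall y, y \notin S}.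
Proof.
elim: s x => [|a s IH] x /=; first by move=> _ xS; split=> // y; rewrite inE => /eqP->.
case/andP=> /and3P[xS aS xa] /IH /(_ aS)[ps ns] _; rewrite xa ps; split=> // y.
by rewrite inE => /predU1P[->//|/ns].
Qed.

(** Deleting [x] leaves two of its neighbours connected; a simple path between them closes up
    through [x]. *)
Lemma exists_cycle m : 2 <= m -> k_connected m G -> 2 <= min_deg G ->
  exists c, [/\ 2 < size c, cycle (@adj G) c & uniq c].
Proof.
move=> m2 conn d2; have [lt _] := conn.
have /card_gt0P[x _] : 0 < #|G| by apply: leq_ltn_trans lt.
have [y [z [xy xz yz]]] := deg_pos_neighbours x (leqnn 2) d2.
pose e := adj_del [set x].
have yx : y \notin [set x] by rewrite inE eq_sym adj_neq.
have : connect e y z.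
  apply/negPn/negP=> ncon.
  suff: m <= #|[set x]| by rewrite cards1 leqNgt m2.
  apply: (@separator_card m [set x] [set u | connect e y u] y z conn) => //;
    rewrite ?inE ?connect0 // ?(eq_sym z) ?(adj_neq xz) //.
  move=> u v; rewrite !inE orbC; have [//|vx] /= := eqVneq v x => yu uv.
  apply: connect_trans (yu) (connect1 _).
  case/connectP: yu => p pp lp; have [_ /(_ u)] := path_del pp yx.
  by rewrite lp mem_last => /(_ isT) ux; rewrite /e /adj_del /= ux inE vx -lp.
case/connectP=> p0 p0p lp0; case: (shortenP p0p) lp0 => p pp U _ lp.
have [pp' np] := path_del pp yx.
exists (x :: y :: p); split.
- by case: p lp {pp U pp' np} => //= E; move: yz; rewrite E eqxx.
- by rewrite (cycle_path x) /= -lp adj_sym xz xy.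
- rewrite cons_uniq U andbT; apply/negP=> /np; by rewrite inE eqxx.
Qed.

(** The bound on the size matters: on lists, [cycle] also accepts the empty list and the two ends of
    an edge. *)
Definition longest c := [/\ 2 < size c, cycle (@adj G) c, uniq c &
  forall s, cycle (@adj G) s -> uniq s -> size s <= size c].

Lemma exists_longest c0 : 2 < size c0 -> cycle (@adj G) c0 -> uniq c0 ->
  exists c, longest c.
Proof.
move=> s0 cy0 U0.
pose P m := [exists t : m.-tuple G, cycle (@adj G) t && uniq t].
have P0 : exists m, P m.
  by exists (size c0); apply/existsP; exists (in_tuple c0); rewrite /= cy0.
have Pm m : P m -> m <= #|G|.
  by case/existsP=> t /andP[_ /card_uniqP]; rewrite size_tuple => <-; apply: max_card.
case: (ex_maxnP P0 Pm) => m /existsP[t /andP[ct Ut]] mm.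
have mx s : cycle (@adj G) s -> uniq s -> size s <= size t.
  move=> cs Us; rewrite size_tuple; apply: mm; apply/existsP; exists (in_tuple s).
  by rewrite /= cs.
by exists t; split=> //; apply: leq_trans s0 (mx _ cy0 U0).
Qed.

End Graph.

(** * Attachment sets of a longest cycle *)

Section Attachment.

Variables (G : sgraph) (c : seq G).
Hypothesis Lc : longest c.

Let Uc : uniq c. Proof. by case: Lc. Qed.
Let c2 : 2 < size c. Proof. by case: Lc. Qed.
Let cc : cycle (@adj G) c. Proof. by case: Lc. Qed.

(** [s] holds the vertices gained and [l] those lost, so [r] would be longer than [c]. *)
Lemma longest_exchange r s l : cycle (@adj G) r -> perm_eq (l ++ r) (s ++ c) ->
  uniq s -> (forall z, z \in s -> z \notin c) -> size l < size s -> False.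
Proof.
move=> cr pr Us sc lt; have [_ _ _ mx] := Lc.
have Usc : uniq (s ++ c).
  rewrite cat_uniq Us Uc andbT /=; apply/hasPn => z zc; apply: contraTN zc.
  exact: sc.
have: uniq r by move: Usc; rewrite -(perm_uniq pr) cat_uniq => /and3P[].
move/(mx _ cr); have := perm_size pr; rewrite !size_cat => E le.
by move: lt; rewrite ltnNge -(leq_add2r (size c)) -E leq_add2l le.
Qed.

Lemma piece_walk n S1 s S2 z : rot n c = S1 ++ s ++ S2 -> s != [::] ->
  walk (head z s) (last z s) s.
Proof.
case: s => // x s E _; have: cycle (@adj G) (x :: s ++ S2 ++ S1).
  have [m Em] := rot_catC E; have: cycle (@adj G) (rot m c) by rewrite rot_cycle.
  by rewrite Em -catA.
rewrite /walk /= => /cycle_walk[/and3P[_ + _] _].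
by rewrite !eqxx cat_path => /andP[->].
Qed.

Lemma perm_cat_rot q n L : rot n c = L -> perm_eq (q ++ L) (q ++ c).
Proof. by move=> <-; rewrite perm_cat2l perm_rot. Qed.

Lemma next_piece n S1 x s y S2 : rot n c = S1 ++ (x :: s) ++ y :: S2 ->
  next c (last x s) = y.
Proof.
rewrite lastI => E; have E' : rot n c = (S1 ++ belast x s) ++ last x s :: y :: S2.
  by rewrite E cat_rcons catA.
by rewrite -(next_rot n Uc) E' next_cat2 // -E' rot_uniq.
Qed.

Lemma next_last n x s : rot n c = x :: s -> next c (last x s) = x.
Proof.
move=> E; have s0 : s != [::] by apply: contraTneq c2; rewrite -(size_rot n) E => ->.
have E1 : rot n c = [:: x] ++ s by rewrite E.
have [m Em] := rot_catC E1; case: s s0 E E1 Em => // y s _ _ _ Em.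
by apply: (@next_piece m [::] y s x [::]); rewrite Em.
Qed.

Variable A : {set G}.
Hypothesis Ac : forall a, a \in A -> a \in c.
Hypothesis join : forall a a', a \in A -> a' \in A -> a != a' ->
  exists s x y, [/\ walk x y s, adj a x, adj y a', uniq s & forall z, z \in s -> z \notin c].

Let D := [set next c a | a in A].

Lemma attach_c d : d \in D -> d \in c.
Proof. by case/imsetP=> a /Ac ac ->; rewrite mem_next. Qed.

Lemma card_attach : #|D| = #|A|.
Proof. by apply: card_imset; apply: can_inj (prev_next Uc). Qed.

Lemma attach_rot a : a \in A -> exists n s, rot n c = next c a :: s ++ [:: a].
Proof.
move=> aA; have [n [s E]] := rot_next Uc (ltnW c2) (Ac aA).
have E1 : rot n c = [:: a] ++ (next c a :: s) by rewrite E.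
by have [m Em] := rot_catC E1; exists m, s.
Qed.

Lemma attach_disjoint d : d \in D -> d \notin A.
Proof.
case/imsetP=> a aA ->; apply/negP=> dA; have [n [s En]] := attach_rot aA.
have E : rot n c = [::] ++ (next c a :: s ++ [:: a]) ++ [::] by rewrite cats0.
have := piece_walk a E isT; rewrite /= last_cat /= => W.
have nad : a != next c a by apply: (adj_neq (next_cycle cc (Ac aA))).
have [q [x [y [Wq ax yd Uq qc]]]] := join aA dA nad.
apply: (@longest_exchange ((next c a :: s ++ [:: a]) ++ q) q [::]) => //.
- exact: (walk_cycle (walk_cat W ax Wq)).
- by rewrite -[_ :: s ++ _]En /= perm_catC perm_cat2l perm_rot.
- by case: q Wq {ax yd Uq qc}.
Qed.

(** The two arcs used by every rerouting with two successors: from [d] to the predecessor of [d'],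
    and from [d'] to the predecessor of [d]. *)
Lemma attach_cut d d' : d \in D -> d' \in D -> d != d' -> exists a a' s1 s2 n,
  [/\ a \in A, a' \in A, rot n c = (d :: s1 ++ [:: a']) ++ (d' :: s2),
      walk d a' (d :: s1 ++ [:: a']) & walk d' a (d' :: s2)].
Proof.
move=> dD; case/imsetP: (dD) => a aA Ed /imsetP[a' a'A Ed'] dd.
have [n [s En]] := attach_rot aA; rewrite -Ed in En.
have aa : a != a' by apply: contraNneq dd => E; rewrite Ed E -Ed'.
have a's : a' \in s.
  have := Ac a'A; rewrite -(mem_rot n) En inE mem_cat inE (eq_sym a' a) (negPf aa) orbF.
  by case/predU1P=> // E; move: (attach_disjoint dD); rewrite -E a'A.
case/splitPr: a's En => s1 s2 En.
case: s2 En => [|e s2] En.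
  have E : next c a' = a.
    by apply: (@next_piece n (d :: s1) a' [::] a [::]); rewrite En /= -catA.
  have: a \in D by rewrite -E imset_f.
  by move/attach_disjoint; rewrite aA.
have E : d' = e.
  rewrite Ed'; apply: (@next_piece n (d :: s1) a' [::] e (s2 ++ [:: a])).
  by rewrite En /= -catA.
rewrite -E in En; exists a, a', s1, (s2 ++ [:: a]), n.
have E2 : rot n c = (d :: s1 ++ [:: a']) ++ (d' :: s2 ++ [:: a]) by rewrite En /= -!catA.
split=> //.
  have := @piece_walk n [::] (d :: s1 ++ [:: a']) (d' :: s2 ++ [:: a]) d E2 isT.
  by rewrite /= last_cat.
have := @piece_walk n (d :: s1 ++ [:: a']) (d' :: s2 ++ [:: a]) [::] d.
by rewrite cats0 => /(_ E2 isT); rewrite /= last_cat.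
Qed.

Lemma attach_cut_neq d d' a a' s1 s2 n : 
  rot n c = (d :: s1 ++ [:: a']) ++ (d' :: s2) -> walk d' a (d' :: s2) -> a' != a.
Proof.
move=> En W; have: uniq (rot n c) by rewrite rot_uniq.
rewrite En cat_uniq => /and3P[_ /hasPn H _]; have /= la := walk_last d' W.
apply: contraTneq (H (last d' s2) (mem_last _ _)) => E.
by rewrite la -E /= inE mem_cat inE eqxx !orbT.
Qed.

(** An edge [d d'] closes a longer cycle: along one arc, through the outside from [a'] to [a], and
    back along the other arc. *)
Lemma attach_stable : stable D.
Proof.
move=> d d' dD d'D; have [->|dd] := eqVneq d d'; first by rewrite adj_irr.
apply/negP=> ad; have [a [a' [s1 [s2 [n [aA a'A En W1 W2]]]]]] := attach_cut dD d'D dd.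
have [q [x [y [Wq ax yd Uq qc]]]] := join a'A aA (attach_cut_neq En W2).
apply: (@longest_exchange (((d :: s1 ++ [:: a']) ++ q) ++ rev (d' :: s2)) q [::]) => //.
- refine (walk_cycle (walk_cat (walk_cat W1 ax Wq) yd (walk_rev W2)) _).
  by rewrite adj_sym.
- by apply: perm_trans (perm_cat_rot q En); perm_count.
- by case: q Wq {ax yd Uq qc}.
Qed.

(** The rerouting of [attach_stable] with the edge replaced by an outside walk [r]; [uniq (r ++ s)]
    keeps the joining walk disjoint from it. *)
Lemma attach_no_detour d d' r x' y' : d \in D -> d' \in D -> d != d' ->
  walk x' y' r -> adj d' x' -> adj y' d -> uniq r -> (forall z, z \in r -> z \notin c) ->
  (forall a a', a \in A -> a' \in A -> a != a' -> exists s x y,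
     [/\ walk x y s, adj a x, adj y a', uniq (r ++ s) & forall z, z \in s -> z \notin c]) ->
  False.
Proof.
move=> dD d'D dd Wr dx yd Ur rc join'.
have [a [a' [s1 [s2 [n [aA a'A En W1 W2]]]]]] := attach_cut dD d'D dd.
have [q [x [y [Wq ax ya Uq qc]]]] := join' _ _ a'A aA (attach_cut_neq En W2).
apply: (@longest_exchange ((((d :: s1 ++ [:: a']) ++ q) ++ rev (d' :: s2)) ++ r) (r ++ q) [::]) => //.
- exact: (walk_cycle (walk_cat (walk_cat (walk_cat W1 ax Wq) ya (walk_rev W2)) dx Wr) yd).
- by apply: perm_trans (perm_cat_rot (r ++ q) En); perm_count.
- by move=> z; rewrite mem_cat => /orP[/rc|/qc].
- by case: r Wr {dx yd Ur rc join' Uq}.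
Qed.

End Attachment.

(** * An isolated vertex outside a longest cycle *)

(** Here [t], [b] and [s] are the sizes of [A], [Z :\: W] and [S], and the last inequality is twice
    the edge count. With [t = k + u], collecting the terms in [s] leaves the factor [2 * u + b + 4]
    on the left, against a right side free of [s]. *)
Lemma counting_contradiction k t b s : 4 <= k -> k <= t -> t + b + 3 <= 2 * k ->
  k ^ 2 + k + 1 <= 2 * s ->
  2 * (s * (t + b + 2)) <= 2 * (s * k) + 2 * (t * (t + b)) + b * (s + (t + b)) + 2 * t ->
  False.
Proof.
move=> k4 kt tb ks le.
have [u Et] : exists u, t = k + u by exists (t - k); lia.
subst t; have ub : u + b + 3 <= k by lia.
(* 2 s >= k^2 + k + 2, since k^2 + k is even *)
have ks' : k * k + k + 2 <= 2 * s.
  move: ks; rewrite expnS expn1; have : ~~ odd (k * k + k) by rewrite oddD oddM; case: odd.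
  lia.
have le1 : s * (2 * u + 4 + b) <= 2 * (k + u) + 2 * (k + u) * (k + u + b) + b * (k + u + b).
  nia.
have le2 : (k * k + k + 2) * (2 * u + 4 + b) <= 2 * s * (2 * u + 4 + b) by rewrite leq_mul2r ks' orbT.
have le3 : (k * k + k + 2) * (2 * u + 4 + b) <=
    4 * (k + u) + 4 * (k + u) * (k + u + b) + 2 * b * (k + u + b) by lia.
clear le le1 le2 ks ks' kt tb s.
(* With [q = k - 3] the bound on [u + b] becomes [u + b <= q]. The estimate [3 * q <= q * q] needs
   [3 <= q]; the values 1 and 2 are checked separately. *)
have [q Ek] : exists q, k = q + 3 by exists (k - 3); lia.
subst k; have {ub} ub : u + b <= q by lia.
have h1 : u * (2 * u + 3 * b) <= u * (3 * q) by rewrite leq_mul2l; apply/orP; right; lia.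
case: (leqP 3 q) => q3.
  have qq : 3 * q <= q * q by rewrite leq_mul2r q3 orbT.
  have h2 : b * (2 * b + 4) <= b * (q * q + q) by rewrite leq_mul2l; apply/orP; right; lia.
  lia.
have b2 : b <= 2 by lia.
have [Eq|Eq] : q = 1 \/ q = 2 by lia.
  by subst q; case: b b2 ub h1 le3 => [|[|//]] *; lia.
by subst q; case: b b2 ub h1 le3 => [|[|[|//]]] *; lia.
Qed.

Section IsolatedVertex.

Variables (G : sgraph) (k : nat) (c : seq G) (h : G).
Hypothesis hk : 4 <= k.
Hypothesis htough : one_tough G.
Hypothesis hfree : free_of (P2_kP1 k) G.
Hypothesis hcard : k ^ 2 + k + 1 <= #|G|.
Hypothesis hdeg : k <= min_deg G.
Hypothesis Lc : longest c.
Hypothesis hc : h \notin c.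
Hypothesis hiso : forall y, y \notin c -> ~~ adj h y.

Let Uc : uniq c. Proof. by case: Lc. Qed.
Let c2 : 2 < size c. Proof. by case: Lc. Qed.
Let cc : cycle (@adj G) c. Proof. by case: Lc. Qed.

Let A := [set x | adj h x].
Let D := [set next c a | a in A].

Lemma nbr_c a : a \in A -> a \in c.
Proof. by rewrite inE; apply: contraTT => /hiso. Qed.

Lemma nbr_join a a' : a \in A -> a' \in A -> a != a' -> exists s x y,
  [/\ walk x y s, adj a x, adj y a', uniq s & forall z, z \in s -> z \notin c].
Proof.
rewrite !inE => ha ha' _; exists [:: h], h, h; split=> //; first exact: walk1.
  by rewrite adj_sym.
by move=> z; rewrite inE => /eqP->.
Qed.

Lemma succ_c d : d \in D -> d \in c. Proof. exact: (attach_c nbr_c). Qed.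

Lemma card_succ : #|D| = #|A|. Proof. exact: (card_attach Lc). Qed.

Lemma card_nbr : k <= #|A|.
Proof. exact: leq_trans hdeg (min_deg_le h). Qed.

Lemma no_h_cycle s : cycle (@adj G) s -> perm_eq s (h :: c) -> False.
Proof.
move=> cs ps; apply: (@longest_exchange _ _ Lc s [:: h] [::] cs ps) => // z.
by rewrite inE => /eqP->.
Qed.

Lemma succ_nadj d : d \in D -> d \notin A.
Proof. exact: (attach_disjoint Lc nbr_c nbr_join). Qed.

Lemma succ_stable : stable (h |: D).
Proof.
have hD d : d \in D -> ~~ adj h d by move=> dD; have := succ_nadj dD; rewrite inE.
move=> x y /setU1P[->|xD] /setU1P[->|yD]; rewrite ?adj_irr ?hD //.
  by rewrite adj_sym hD.
exact: (attach_stable Lc nbr_c nbr_join).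
Qed.

Lemma off_succ v d d' : v \notin c -> v != h -> d \in D -> d' \in D -> adj v d -> adj v d' -> d = d'.
Proof.
move=> vc vh dD d'D vd vd'; apply/eqP/negPn/negP=> dd.
apply: (@attach_no_detour _ _ Lc A nbr_c nbr_join d d' [:: v] v v) => //.
- exact: walk1.
- by rewrite adj_sym.
- by move=> z; rewrite inE => /eqP->.
move=> a a'; rewrite !inE => ha ha' _; exists [:: h], h, h; split=> //.
- exact: walk1.
- by rewrite adj_sym.
- by rewrite /= inE vh.
- by move=> z; rewrite inE => /eqP->.
Qed.

Let stableb (J : {set G}) := [forall x in J, [forall y in J, ~~ adj x y]].

Lemma stableP J : reflect (stable J) (stableb J).
Proof.
apply: (iffP forall_inP) => [st x y /st/forall_inP H /H //|st x xJ].
by apply/forall_inP => y; apply: st.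
Qed.

Lemma exists_maximal_stable : exists I : {set G}, [/\ stable I, h |: D \subset I &
  forall v, v \notin I -> exists2 x, x \in I & adj v x].
Proof.
have [I /maxsetP[/stableP sI mI] DI] := @maxset_exists _ stableb _ (introT (stableP _) succ_stable).
exists I; split=> // v vI; apply/exists_inP; apply: contraNT vI => /exists_inPn nv.
suff <- : v |: I = I by rewrite setU11.
apply: mI (subsetUr _ _); apply/stableP => x y.
move=> /setU1P[->|xI] /setU1P[->|yI]; first by rewrite adj_irr.
- exact: nv.
- by rewrite adj_sym; apply: nv.
- exact: sI.
Qed.

(** * A maximal stable set containing [h |: D], and its complement *)

Section MaximalStable.

Variable I : {set G}.
Hypothesis sI : stable I.
Hypothesis DI : h |: D \subset I.
Hypothesis mI : forall v, v \notin I -> exists2 x, x \in I & adj v x.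

Let S := ~: I.

(** Maximality gives [v] a neighbour in [I], and freeness applies to that edge and the vertices of
    [I] missed by [v]. *)
Lemma miss_I v : v \in S -> #|[set x in I | ~~ adj v x]| < k.
Proof.
rewrite inE => /mI[x xI vx]; apply: (free_stable hfree vx).
  by move=> y z; rewrite !inE => /andP[yI _] /andP[zI _]; apply: sI.
by move=> z; rewrite inE => /andP[zI ->]; split=> //; apply: sI.
Qed.

Lemma miss_sub v (K : {set G}) : v \in S -> K \subset I ->
  #|K| < k + #|[set x in K | adj v x]|.
Proof.
move=> vS KI; rewrite -(cardsID [set x | adj v x] K) addnC.
have -> : K :&: [set x | adj v x] = [set x in K | adj v x] by apply/setP=> x; rewrite !inE.
rewrite ltn_add2r; apply: leq_ltn_trans (miss_I vS); apply: subset_leq_card.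
by apply/subsetP=> x; rewrite !inE => /andP[-> /(subsetP KI)->].
Qed.

Lemma h_I : h \in I. Proof. by rewrite (subsetP DI) ?setU11. Qed.
Lemma D_I d : d \in D -> d \in I. Proof. by move=> dD; rewrite (subsetP DI) ?setU1r. Qed.

Lemma h_D : h \notin D.
Proof. by apply/negP=> /succ_c; rewrite (negPf hc). Qed.

(** The set [h |: D] has more than [k] vertices, so [v] sees two of them. Off the cycle, neither
    could be [h], and two in [D] contradict [off_succ]. *)
Lemma S_c v : v \in S -> v \in c.
Proof.
move=> vS; apply/negPn/negP=> vc; have := miss_sub vS DI.
rewrite cardsU1 h_D card_succ add1n => lt.
have : 1 < #|[set x in h |: D | adj v x]| by have := card_nbr; lia.
case/card_gt1P=> d [d' []]; rewrite !inE => /andP[dD vd] /andP[d'D vd'] dd.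
have vh : v != h by apply: contraTneq vS => ->; rewrite inE h_I.
have hv : ~~ adj v h by rewrite adj_sym hiso.
case/predU1P: dD vd dd => [->|dD vd dd]; first by rewrite (negPf hv).
case/predU1P: d'D vd' => [->|d'D vd']; first by rewrite (negPf hv).
by move: dd; rewrite (@off_succ v d d') ?eqxx.
Qed.

(** Removing [S] isolates every vertex of [I], so toughness applies with at least [#|I|]
    components. *)
Lemma card_IS : #|I| <= #|S|.
Proof.
have I2 : 2 <= #|I|.
  have := subset_leq_card DI; rewrite cardsU1 h_D card_succ; have := card_nbr; lia.
have le : #|I| <= omega S.
  apply: omega_ge => [x xI|x y xI _ /connectP[p]]; first by rewrite inE xI.
  case: p => [|z p] //= /andP[/and3P[_ + xz] _].
  by rewrite !inE negbK => zI; move: (sI xI zI); rewrite xz.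
exact: leq_trans le (htough (leq_trans I2 le)).
Qed.

(** Otherwise the successor map sends [S] injectively into [I] while missing [h], against
    [card_IS]. *)
Lemma exists_SS : exists2 y, y \in S & next c y \in S.
Proof.
apply/exists_inP; apply: contraT => /exists_inPn nS.
suff: #|S| < #|I| by rewrite ltnNge card_IS.
have inj : injective (next c) := can_inj (prev_next Uc).
rewrite -(card_imset (mem S) inj) [X in _ < X](cardsD1 h) h_I add1n ltnS.
apply/subset_leq_card/subsetP => _ /imsetP[y yS ->]; rewrite !inE.
have := nS _ yS; rewrite inE negbK => ->; rewrite andbT.
by apply: contraNneq hc => <-; rewrite mem_next; apply: S_c.
Qed.

Let Z := [set x in I | (x \in c) && (x \notin D)].

Lemma next_I x : x \in I -> x \in c -> next c x \in S.
Proof. by move=> xI xc; rewrite inE; apply: contraTN (next_cycle cc xc) => /(sI xI)/negbTE->. Qed.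

Lemma prev_I x : x \in I -> x \in c -> prev c x \in S.
Proof.
move=> xI xc; rewrite inE; have := next_cycle cc (_ : prev c x \in c).
rewrite mem_prev next_prev // => /(_ xc); apply: contraTN => yI.
by apply: sI.
Qed.

Let swap (z x u : G) := if u == z then x else if u == x then z else u.

Lemma swapK z x : involutive (swap z x).
Proof.
move=> u; rewrite /swap; have [->|uz] := eqVneq u z.
  by rewrite eqxx; case: eqVneq => // ->.
have [->|ux] := eqVneq u x; first by rewrite eqxx.
by rewrite (negPf uz) (negPf ux).
Qed.

Let common (x u v : G) := adj x u && adj x v.
(** [R x z] lets [x] take the place of [z] on the cycle, and [SScommon x] lets [x] be inserted into
    a cycle edge inside [S]. *)
Let R := [rel x z | [&& x \in Z, z \in Z & common x (prev c z) (next c z)]].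
Let SScommon x := [exists u in S, (next c u \in S) && common x u (next c u)].

(* A cycle through [h] that misses only [z] can be improved by shifting vertices of [Z]
   along a chain of replacements that ends at an edge of the cycle inside [S]. *)
Lemma replacement_chain p z c' : cycle (@adj G) c' -> perm_eq (z :: c') (h :: c) ->
  (forall u, u \in S -> next c u \in S -> nb c' u (next c u)) ->
  (forall x, x \in p -> nb c' (prev c x) x /\ nb c' x (next c x)) ->
  uniq (z :: p) -> z \in Z -> path R z p -> SScommon (last z p) -> False.
Proof.
elim: p z c' => [|x p IH] z c' cc' pc' SSp lp U zZ.
  move=> _ /exists_inP[u uS /andP[nuS /andP[zu znu]]].
  have Uzc : uniq (z :: c') by rewrite (perm_uniq pc') /= hc.
  have mc v : v \in S -> v \in c'.
    move=> vS; have: v \in z :: c' by rewrite (perm_mem pc') inE S_c ?orbT.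
    rewrite inE => /predU1P[E|//]; move: zZ vS; rewrite -E !inE.
    by case/andP=> ->.
  have sz : size c' = size c by have := perm_size pc'; case.
  have [s cs ps] : exists2 s, cycle (@adj G) s & perm_eq s ([:: z] ++ c').
    apply: (@cycle_insert _ c' _ u (next c u) z z) => //.
    - by case/andP: Uzc.
    - by rewrite sz ltnW.
    - exact: mc.
    - exact: mc.
    - exact: SSp.
    - exact: walk1.
    - by rewrite adj_sym.
  by apply: (no_h_cycle cs); apply: perm_trans ps pc'.
case/andP=> /and3P[_ xZ /andP[zp zn]] pp lst.
have Uzc : uniq (z :: c') by rewrite (perm_uniq pc') /= hc.
have Uc' : uniq c' by case/andP: Uzc.
have [zI zc] : z \in I /\ z \in c by move: zZ; rewrite inE => /and3P[].
have [xI xc] : x \in I /\ x \in c by move: xZ; rewrite inE => /and3P[].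
have zx : z != x by move: U; rewrite /= inE negb_or => /andP[/andP[]].
(* Transposing [z] and [x] in [c'] gives a cycle that misses [x] instead of [z]. Both lie in [I], so
   pairs in [S] and the neighbours of the later vertices of the chain are not moved. *)
pose f := swap z x.
have finj : injective f := can_inj (swapK z x).
have f_id u : u != z -> u != x -> f u = u by rewrite /f /swap => /negPf-> /negPf->.
have fz : f z = x by rewrite /f /swap eqxx.
have fx : f x = z by rewrite /f /swap eqxx; case: eqVneq zx => // ->; rewrite eqxx.
have fS u : u \in S -> f u = u.
  by rewrite inE => uI; apply: f_id; apply: contraNneq uI => ->.
have fnb a b : nb (map f c') (f a) (f b) = nb c' a b.
  by rewrite /nb !next_map // !(inj_eq finj).
have [N1 N2] := lp x (mem_head _ _).
have xc' : x \in c'.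
  have: x \in z :: c' by rewrite (perm_mem pc') inE xc orbT.
  by rewrite inE eq_sym (negPf zx).
(* The cyclic neighbours of [x] in [c'] are its two neighbours on [c], in one order or the other,
   and [z] sees both. *)
have zNx u : u \in c' -> (u == x) || (next c' u == x) -> 
    adj z (if u == x then next c' x else u).
  move=> uc'; have pn : prev c x != next c x.
    apply: contraTneq (next_next_neq Uc c2 (_ : prev c x \in c)); last by rewrite mem_prev.
    by rewrite next_prev // => <-; rewrite eqxx.
  have inj' : injective (next c') := can_inj (prev_next Uc').
  case/orP: N1 => /eqP N1; case/orP: N2 => /eqP N2; case: (eqVneq u x) => [_ _|ux /= /eqP E].
  - by rewrite N2.
  - by rewrite (inj' _ _ (etrans E (esym N1))).
  - by move: pn; rewrite (inj' _ _ (etrans N1 (esym N2))) eqxx.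
  - by move: pn; rewrite (inj' _ _ (etrans N1 (esym N2))) eqxx.
  - by move: pn; rewrite -N1 N2 eqxx.
  - by move: pn; rewrite -N1 N2 eqxx.
  - by rewrite N1.
  - by rewrite (inj' _ _ (etrans E (esym N2))).
apply: (IH x (map f c')) => //; first last.
- by move: U => /= /andP[].
- move=> y yp; have [yN1 yN2] := lp y (@mem_behead _ (x :: p) y yp).
  have yZ : y \in Z.
    move: pp yp; elim: (p) (x) => //= a q IHq b /andP[/and3P[_ aZ _] pq].
    by rewrite inE => /predU1P[->//|]; apply: (IHq a).
  have [yI yc] : y \in I /\ y \in c by move: yZ; rewrite inE => /and3P[].
  have fy : f y = y.
    move: U; rewrite /= !inE !negb_or => /and3P[/andP[_ zp'] xp _].
    by apply: f_id; [apply: contraNneq zp' => <-|apply: contraNneq xp => <-].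
  have := fnb (prev c y) y; have := fnb y (next c y).
  by rewrite fy (fS _ (next_I yI yc)) (fS _ (prev_I yI yc)) => -> ->.
- by move=> u uS nuS; have := fnb u (next c u); rewrite !fS // => ->; apply: SSp.
- have -> : x :: map f c' = map f (z :: c') by rewrite /= fz.
  apply: perm_trans (perm_map f pc') _; apply: uniq_perm.
  + by rewrite map_inj_uniq //= hc.
  + by rewrite /= hc.
  move=> u; have -> : (u \in map f (h :: c)) = (f u \in h :: c).
    by rewrite -{1}[u](swapK z x) (mem_map finj).
  case: (eqVneq u z) => [->|uz]; first by rewrite fz !inE xc zc !orbT.
  case: (eqVneq u x) => [->|ux]; first by rewrite fx !inE xc zc !orbT.
  by rewrite f_id.
apply: cycle_from_next; first by rewrite map_inj_uniq.
move=> _ /mapP[u uc' ->]; rewrite next_map //.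
have zc' : z \notin c' by case/andP: Uzc.
have uz : u != z by apply: contraNneq zc' => <-.
have nuz : next c' u != z by apply: contraNneq zc' => <-; rewrite mem_next.
case: (eqVneq u x) => [E|ux].
  have := zNx u uc'; rewrite E eqxx fx => /(_ isT) H.
  have nxx : next c' x != x by rewrite eq_sym; apply: (adj_neq (next_cycle cc' xc')).
  by rewrite f_id //; move: nuz; rewrite E.
case: (eqVneq (next c' u) x) => [E|nux].
  have := zNx u uc'; rewrite E eqxx (negPf ux) orbT => /(_ isT) H.
  by rewrite fx f_id // adj_sym.
by rewrite !f_id //; apply: next_cycle.
Qed.

(** A path of [R] from [z] is a sequence of replacements: each vertex pushes out the next one, and
    the last is inserted into an edge inside [S]. *)
Let W := [set z in Z | [exists z1, SScommon z1 && connect R z z1]].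

Lemma W_Z w : w \in W -> w \in Z.
Proof. by rewrite inE => /andP[]. Qed.

(** [S] and [Z] are disjoint from [D], so preserving the pairs that avoid [D] and [z] preserves
    every neighbourhood that a replacement chain needs. *)
Lemma W_absurd z c' : z \in W -> cycle (@adj G) c' -> perm_eq (z :: c') (h :: c) ->
  (forall x, x \in c -> x != z -> next c x != z -> x \notin D -> next c x \notin D ->
     nb c' x (next c x)) -> False.
Proof.
rewrite inE => /andP[zZ /existsP[z1 /andP[z1S /connectP[p0 pp0 z1E]]]] cc' pc' pres.
case: (shortenP pp0) z1E => p pp U _ z1E.
have S_D x : x \in S -> x \notin D by rewrite inE; apply: contra => /D_I.
have zS x : x \in S -> x != z.
  by apply: contraTneq => ->; move: zZ; rewrite !inE => /andP[->].
have pZ : {in p, forall x, x \in Z}.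
  move: pp; elim: (p) (z) => //= a q IHq b /andP[/and3P[_ aZ _] pq] x.
  by rewrite inE => /predU1P[->//|]; apply: (IHq a).
apply: (replacement_chain cc' pc' _ _ U zZ pp); last by rewrite -z1E.
  by move=> u uS nuS; apply: pres; rewrite ?S_c ?zS ?S_D.
move=> x xp; have xz : x != z by move: U => /andP[+ _]; apply: contraNneq => <-.
have /and3P[xI xc xD] : [&& x \in I, x \in c & x \notin D] by have := pZ _ xp; rewrite inE.
split; last by apply: pres => //; [apply/zS/next_I | apply/S_D/next_I].
have := pres (prev c x); rewrite next_prev // mem_prev.
by apply=> //; [apply/zS/prev_I | apply/S_D/prev_I].
Qed.

(** Two vertices of [S] that are consecutive on [c], or separated by a single vertex of [W], which
    may be dropped. [P] is the rest of the cycle, read from [v] round to [u]; the two situations can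
    then be treated alike. *)
Let gap (P tl : seq G) u v := [/\ walk v u P, u \in S, v \in S,
  exists n, rot n c = P ++ tl & tl = [::] \/ exists2 w, w \in W & tl = [:: w]].

(** With [tl] empty, [c'] is longer than [c]; otherwise [W_absurd] recovers the one lost vertex. *)
Lemma gap_absurd P tl u v c' : gap P tl u v -> cycle (@adj G) c' ->
  perm_eq c' (h :: P) ->
  (forall x y, consec x y P -> x \notin D -> y \notin D -> nb c' x y) -> False.
Proof.
case=> Wp uS vS [n En] tlW cc' pc' pres.
have pP : perm_eq c (P ++ tl) by rewrite -En perm_sym perm_rot.
case: tlW => [E|[w wW E]].
  rewrite E cats0 in pP; apply: (no_h_cycle cc').
  by rewrite (perm_trans pc') // perm_cons perm_sym.
apply: (W_absurd wW cc') => [|x xc xw nxw xD nxD].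
  rewrite -(perm_cons w) in pc'; apply: perm_trans pc' _.
  rewrite -(perm_cons h) perm_sym in pP; apply: perm_trans pP.
  by rewrite E -cat1s -cat_cons perm_catC.
apply: pres => //; have xP : x \in P.
  by move: xc; rewrite (perm_mem pP) mem_cat E inE (negPf xw) orbF.
have Un : uniq (rot n c) by rewrite rot_uniq.
case/splitPr: xP En => s1 [|y s2] En; apply/consecP.
  move: nxw; rewrite -(next_rot n Uc).
  by rewrite En E -catA /= next_cat2 ?eqxx // -?E; move: Un; rewrite En E -catA.
exists s1, s2; rewrite -(next_rot n Uc) En -catA /= next_cat2 //.
by move: Un; rewrite En -catA.
Qed.

(** [D] is disjoint from [S] and [W], so a vertex of [D] neither starts [P] nor is dropped, and its
    predecessor on [c] stays just before it. *)
Lemma gap_D_split P tl u v d : gap P tl u v -> d \in D ->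
  exists X a Y, P = X ++ a :: d :: Y /\ adj h a.
Proof.
case=> Wp uS vS [n En] tlW dD.
have dP : d \in P.
  have: d \in rot n c by rewrite mem_rot succ_c.
  rewrite En mem_cat => /orP[//|]; case: tlW => [->//|[w /W_Z]]; rewrite inE.
  by case/and3P=> _ _ wD ->; rewrite inE => /eqP E; move: wD; rewrite -E dD.
have Un : uniq (rot n c) by rewrite rot_uniq.
case/splitPr: dP Wp En => X Y Wp En.
case: (lastP X) Wp En => [|X' a] Wp En.
  by have /= E := walk_head h Wp; move: vS; rewrite -E inE D_I.
exists X', a, Y; split; first by rewrite cat_rcons.
case/imsetP: dD => a0 a0A Ed; rewrite inE in a0A.
suff -> : a = a0 by [].
rewrite -[a0](prev_next Uc) -Ed -(prev_rot n Uc) En cat_rcons -catA.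
by rewrite prev_cat2 // ; move: Un; rewrite En cat_rcons -catA.
Qed.

(** The cycle follows [P] from [v] to [a], passes through [h] to [a'], runs back to [d], crosses to
    [u], runs back to [d'] and returns to [v]. *)
Lemma gap_violation P tl u v X a d Y a' d' Y' : gap P tl u v ->
  P = X ++ a :: d :: Y ++ a' :: d' :: Y' -> d \in D -> d' \in D ->
  adj h a -> adj h a' -> adj u d -> adj v d' -> False.
Proof.
move=> gp EP dD d'D ha ha' ud vd'; have [Wp uS vS _ _] := gp; rewrite EP in Wp.
have [W1 _ W2] := walk_cut Wp.
have [W3 _ W4] := @walk_cut _ _ _ (d :: Y) _ _ _ W2.
pose c' := (((X ++ [:: a]) ++ [:: h]) ++ rev (d :: Y ++ [:: a'])) ++ rev (d' :: Y').
have pc' : perm_eq c' (h :: P) by rewrite /c' EP; perm_count.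
have UP : uniq (h :: P).
  have [_ _ _ [n En] _] := gp; have: uniq (rot n c) by rewrite rot_uniq.
  rewrite En cat_uniq /= => /andP[-> _]; rewrite andbT.
  by apply: contra hc => hP; rewrite -(mem_rot n) En mem_cat hP.
have Uc' : uniq c' by rewrite (perm_uniq pc').
apply: (gap_absurd gp (c' := c')) => //.
  refine (walk_cycle (walk_cat (walk_cat (walk_cat W1 _ (walk1 h)) ha' (walk_rev W3)) _ (walk_rev W4)) _).
  - by rewrite adj_sym.
  - by rewrite adj_sym.
  - by rewrite adj_sym.
move=> x y; have -> : P = (X ++ [:: a]) ++ ((d :: Y ++ [:: a']) ++ (d' :: Y')).
  by rewrite EP /= -!catA.
move=> con xD yD; apply: consec_nb => //.
case/consec_catE: con => [con|con|[s1 [t1 [_ [E _]]]]]; last by rewrite -E dD in yD.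
  by rewrite /c'; consec_auto.
case/consec_catE: con => [con|con|[s1 [t1 [_ [E _]]]]]; last by rewrite -E d'D in yD.
  by rewrite /c'; consec_auto.
by rewrite /c'; consec_auto.
Qed.

(** [d] is lifted out and placed between [u] and [v]. The hole is bridged through [h], entered from
    [a], and through a second neighbour [z] of the successor [x] of [d]. One rerouting serves each
    of the cases [z = h], [z] before [a], and [z] after [x]. *)
Lemma gap_common P tl u v d : gap P tl u v -> d \in D ->
  adj u d -> adj v d -> False.
Proof.
move=> gp dD ud vd; have [Wp uS vS [n En] _] := gp.
have UP : uniq (h :: P).
  have: uniq (rot n c) by rewrite rot_uniq.
  rewrite En cat_uniq /= => /andP[-> _]; rewrite andbT.
  by apply: contra hc => hP; rewrite -(mem_rot n) En mem_cat hP.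
have [X [a [Y [EP ha]]]] := gap_D_split gp dD; rewrite EP in Wp.
have [W1 _ W2] := walk_cut Wp.
case: Y EP W2 {Wp} => [|x Y] EP W2.
  by have := walk_last u W2 => /= E; move: uS; rewrite -E inE D_I.
have [_ dx W3] := @walk_cut _ _ _ [::] _ _ _ W2.
have vd' : adj d v by rewrite adj_sym.
have ah : adj a h by rewrite adj_sym.
(* freeness of the edge d x gives x a second neighbour in h |: D *)
have [z zD xz] : exists2 z, z \in (h |: D) :\ d & adj x z.
  apply/exists_inP; apply: contraT => /exists_inPn nz.
  have : #|(h |: D) :\ d| < k.
    apply: (free_stable hfree dx) => [y z|z zD].
      by rewrite !in_setD1 => /andP[_ /(subsetP DI) yI] /andP[_ /(subsetP DI) zI]; apply: sI.
    split; last exact: nz.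
    by move: zD; rewrite in_setD1 => /andP[_ /(subsetP DI) zI]; apply: sI; first exact: D_I.
  have : d \in h |: D by rewrite setU1r.
  have := cardsD1 d (h |: D); rewrite cardsU1 h_D card_succ => + dh; rewrite dh.
  by have := card_nbr; move: #|A| #|_ :\ _| => m1 m2; clear; lia.
move: zD; rewrite !inE => /andP[zd /predU1P[zh|zD]].
  pose c' := (((X ++ [:: a]) ++ [:: h]) ++ (x :: Y)) ++ [:: d].
  have pc' : perm_eq c' (h :: P) by rewrite /c' EP; perm_count.
  have Uc' : uniq c' by rewrite (perm_uniq pc').
  apply: (gap_absurd gp (c' := c')) => //.
    refine (walk_cycle (walk_cat (walk_cat (walk_cat W1 ah (walk1 h)) _ W3) ud (walk1 d)) vd').
    by rewrite adj_sym -zh.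
  move=> y y'; have -> : P = (X ++ [:: a]) ++ ([:: d] ++ (x :: Y)) by rewrite EP /= -!catA.
  move=> con yD y'D; apply: consec_nb => //.
  case/consec_catE: con => [con|con|[s1 [t1 [_ [E _]]]]]; last by rewrite -E dD in y'D.
    by rewrite /c'; consec_auto.
  case/consec_catE: con => [//|con|[s1 [t1 [E _]]]].
    by rewrite /c'; consec_auto.
  by move: yD; case: s1 E => [|? [|? ?]] //= [<-]; rewrite dD.
have [X' [a' [Y' [EP' ha']]]] := gap_D_split gp zD.
have zP : z \in P by rewrite EP' !mem_cat !inE eqxx !orbT.
have xzn : x != z by apply: contraTneq xz => ->; rewrite adj_irr.
have Uz := UP; rewrite /= EP in Uz.
have za : z != a by apply: contraTneq ha => <-; have := succ_nadj zD; rewrite inE.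
have [zXX|zY] : z \in X \/ z \in Y.
  move: zP; rewrite EP !mem_cat !inE (negPf za) (negPf zd) (eq_sym z x) (negPf xzn) /=.
  by case/orP; [left|right].
- case/splitPr: zXX EP W1 => X1 X2 EP W1.
  case: (lastP X1) EP W1 => [|X1' b] EP W1.
    by have /= E := walk_head h W1; move: vS; rewrite -E inE D_I.
  have Eb : b = a'.
    have U1 : uniq P by case/andP: UP.
    transitivity (prev P z).
      by rewrite EP cat_rcons -!catA /= prev_cat2 //; move: U1; rewrite EP cat_rcons -!catA.
    by rewrite EP' prev_cat2 // -EP'.
  rewrite {b}Eb in EP W1.
  have W1' : walk v a (X1' ++ a' :: z :: X2 ++ [:: a]) by move: W1; rewrite cat_rcons -!catA.
  have [W4 _ W5] := walk_cut W1'.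
  pose c' := ((((X1' ++ [:: a']) ++ [:: h]) ++ rev (z :: X2 ++ [:: a])) ++ (x :: Y)) ++ [:: d].
  have pc' : perm_eq c' (h :: P) by rewrite /c' EP; perm_count.
  have Uc' : uniq c' by rewrite (perm_uniq pc').
  have ah' : adj a' h by rewrite adj_sym.
  apply: (gap_absurd gp (c' := c')) => //.
    refine (walk_cycle (walk_cat (walk_cat (walk_cat (walk_cat W4 ah' (walk1 h)) ha (walk_rev W5)) _ W3) ud (walk1 d)) vd').
    by rewrite adj_sym.
  move=> y y'; have -> : P = (X1' ++ [:: a']) ++ ((z :: X2 ++ [:: a]) ++ ([:: d] ++ (x :: Y))).
    by rewrite EP cat_rcons /= -!catA.
  move=> con yD y'D; apply: consec_nb => //.
  case/consec_catE: con => [con|con|[s1 [t1 [_ [E _]]]]]; last by rewrite -E zD in y'D.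
    by rewrite /c'; consec_auto.
  case/consec_catE: con => [con|con|[s1 [t1 [_ [E _]]]]]; last by rewrite -E dD in y'D.
    by rewrite /c'; consec_auto.
  case/consec_catE: con => [//|con|[s1 [t1 [E _]]]].
    by rewrite /c'; consec_auto.
  by move: yD; case: s1 E => [|? [|? ?]] //= [<-]; rewrite dD.
case/splitPr: zY EP W3 {W2} => Y1 Y2 EP W3.
have [Y1' EY1] : exists Y1', x :: Y1 = rcons Y1' a'.
  have [Y1' [b E]] : exists Y1' b, x :: Y1 = rcons Y1' b.
    by exists (belast x Y1), (last x Y1); rewrite -lastI.
  exists Y1'; rewrite E; congr rcons.
  have U1 : uniq P by case/andP: UP.
  have EPb : P = (X ++ a :: d :: Y1') ++ b :: z :: Y2.
    by rewrite EP -!catA /= -(cat_rcons b Y1') -E.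
  transitivity (prev P z); last by rewrite EP' prev_cat2 // -EP'.
  by rewrite EPb prev_cat2 // -EPb.
have W3' : walk x u (Y1' ++ a' :: z :: Y2) by rewrite -cat_rcons -EY1.
have [W4 _ W5] := walk_cut W3'.
pose c' := ((((X ++ [:: a]) ++ [:: h]) ++ rev (Y1' ++ [:: a'])) ++ (z :: Y2)) ++ [:: d].
have EP2 : P = (X ++ [:: a]) ++ ([:: d] ++ ((Y1' ++ [:: a']) ++ (z :: Y2))).
  by rewrite EP /= -!catA /= -[x :: Y1 ++ _]/((x :: Y1) ++ _) EY1 cat_rcons.
have pc' : perm_eq c' (h :: P) by rewrite /c' EP2; perm_count.
have Uc' : uniq c' by rewrite (perm_uniq pc').
apply: (gap_absurd gp (c' := c')) => //.
  exact: (walk_cycle (walk_cat (walk_cat (walk_cat (walk_cat W1 ah (walk1 h)) ha' (walk_rev W4)) xz W5) ud (walk1 d)) vd').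
move=> y y'; rewrite EP2 => con yD y'D; apply: consec_nb => //.
case/consec_catE: con => [con|con|[s1 [t1 [_ [E _]]]]]; last by rewrite -E dD in y'D.
  by rewrite /c'; consec_auto.
case/consec_catE: con => [//|con|[s1 [t1 [E _]]]]; last first.
  by move: yD; case: s1 E => [|? [|? ?]] //= [<-]; rewrite dD.
case/consec_catE: con => [con|con|[s1 [t1 [_ [E _]]]]]; last by rewrite -E zD in y'D.
  by rewrite /c'; consec_auto.
by rewrite /c'; consec_auto.
Qed.

(** Equality is excluded by [gap_common] and the opposite order by [gap_violation]; the latter needs
    [d] and [a'] distinct, which holds as [h] does not see [d]. *)
Lemma gap_order P tl u v d d' : gap P tl u v -> d \in D -> d' \in D ->
  adj u d -> adj v d' -> index d' P < index d P.
Proof.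
move=> gp dD d'D ud vd'; rewrite ltnNge; apply/negP=> le.
have dd : d' != d by apply/eqP=> E; apply: (gap_common gp dD ud); rewrite -E.
have [X [a [Y [EP ha]]]] := gap_D_split gp dD.
have [X' [a' [Y' [EP' ha']]]] := gap_D_split gp d'D.
have UP : uniq P.
  have [_ _ _ [n En] _] := gp; have: uniq (rot n c) by rewrite rot_uniq.
  by rewrite En cat_uniq => /andP[].
have EP3 : P = (X ++ [:: a]) ++ d :: Y by rewrite EP -catA.
have iP : index d P = (size X).+1.
  rewrite EP3 index_cat.
  have: uniq ((X ++ [:: a]) ++ d :: Y) by rewrite -EP3.
  rewrite cat_uniq => /and3P[_ + _]; rewrite -all_predC => /allP/(_ d).
  by rewrite inE eqxx /= => /(_ isT)/negPf->; rewrite size_cat addn1 eqxx addn0.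
have d'P : d' \in P by rewrite EP' mem_cat !inE eqxx !orbT.
have d'Y : d' \in Y.
  have: d' \in (X ++ [:: a]) ++ d :: Y by rewrite -EP3.
  rewrite mem_cat inE (negPf dd) /= => /orP[d'X|//].
  move: le; rewrite iP {1}EP3 index_cat d'X leqNgt.
  by rewrite -(addn1 (size X)) -(size_cat X [:: a]) index_mem d'X.
case/splitPr: d'Y EP => Y1 Y2 EP.
case: (lastP Y1) EP => [|Y1' b] EP.
  have: adj h d.
    have -> : d = a'; last by [].
    transitivity (prev P d'); last by rewrite EP' prev_cat2 // -EP'.
    have EP2 : P = (X ++ [:: a]) ++ d :: d' :: Y2 by rewrite EP -catA.
    by rewrite EP2 prev_cat2 // -EP2.
  by have := succ_nadj dD; rewrite inE => /negPf->.
rewrite cat_rcons in EP; have Eb : b = a'.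
  transitivity (prev P d'); last by rewrite EP' prev_cat2 // -EP'.
  have EP2 : P = (X ++ a :: d :: Y1') ++ b :: d' :: Y2 by rewrite EP -catA.
  by rewrite EP2 prev_cat2 // -EP2.
by apply: (gap_violation gp EP) => //; rewrite Eb.
Qed.

(** * Double counting between [S] and [K] *)

Let K := D :|: (Z :\: W).

Lemma S_hits w : w \in S -> exists2 d, d \in D & adj w d.
Proof.
move=> wS; have := miss_sub wS DI; rewrite cardsU1 h_D card_succ add1n => lt.
have : 1 < #|[set x in h |: D | adj w x]|.
  by have := card_nbr; move: #|A| #|[set x in _ | _]| lt => m1 m2; clear; lia.
case/card_gt1P=> x [y []]; rewrite !inE => /andP[/predU1P[->|xD] wx].
  by case/andP=> /predU1P[->|yD wy]; [rewrite eqxx|exists y].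
by exists x.
Qed.

(** A cycle vertex outside [K] lies in [S] or [W], and no two vertices of [I] are consecutive, so
    successive members of [S] in a stretch without [K] form a [gap]. By [gap_order] their neighbours
    in [D] move strictly backwards; hence no [d] is seen twice within the stretch. *)
Lemma chain_decreasing Y M w d n : rot n c = M ++ w :: Y -> w \in S ->
  (forall y, y \in Y -> y \notin K) -> d \in D -> adj w d ->
  forall w' d', w' \in Y -> w' \in S -> d' \in D -> adj w' d' -> index d' M < index d M.
Proof.
have [m] := ubnP (size Y); elim: m Y M w d n => // m IH Y M w d n ltm En wS YK dD wd.
have Un : uniq (M ++ w :: Y) by rewrite -En rot_uniq.
have cn : cycle (@adj G) (M ++ w :: Y) by rewrite -En rot_cycle.
have inM e : e \in D -> e \in M.
  move=> eD; have: e \in M ++ w :: Y by rewrite -En mem_rot succ_c.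
  rewrite mem_cat inE => /or3P[//|/eqP E|/YK]; last by rewrite inE eD.
  by move: wS; rewrite -E inE D_I.
have step v Y'' tl : Y = tl ++ v :: Y'' -> v \in S ->
    tl = [::] \/ (exists2 y, y \in W & tl = [:: y]) ->
    (forall e, e \in D -> adj v e -> index e M < index d M) /\
    forall w' d', w' \in Y'' -> w' \in S -> d' \in D -> adj w' d' -> index d' M < index d M.
  move=> EY vS tlW.
  have E1 : rot n c = (M ++ w :: tl) ++ (v :: Y'') by rewrite En EY -catA.
  have [n1 En1] := rot_catC E1.
  have cP : cycle (@adj G) ((v :: Y'') ++ (M ++ [:: w]) ++ tl).
    have -> : (M ++ [:: w]) ++ tl = M ++ w :: tl by rewrite -catA.
    by rewrite -En1 rot_cycle.
  have gp : gap ((v :: Y'') ++ (M ++ [:: w])) tl w v.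
    split=> //; last by exists n1; rewrite En1 -!catA.
    have [Wk _] := cycle_walk cP.
    case: tlW Wk => [->|[y _ ->]]; first by rewrite !cats0 !last_cat.
    rewrite !last_cat /= => Wk.
    have Wk' : walk v y ((v :: Y'' ++ M) ++ w :: [:: y]).
      by move: Wk; rewrite /= -!catA.
    by have [W1 _ _] := walk_cut Wk'; rewrite /= catA.
  have nYD e : e \in D -> e \notin v :: Y''.
    move=> eD; apply/negP=> eY; have /YK : e \in Y by rewrite EY mem_cat eY orbT.
    by rewrite inE eD.
  (* All of [D] lies in [M], so positions in the list of the gap are positions in [M] shifted by a
     constant. *)
  have idx e : e \in D -> index e ((v :: Y'') ++ (M ++ [:: w])) = size (v :: Y'') + index e M.
    by move=> eD; rewrite index_cat (negPf (nYD _ eD)) index_cat inM.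
  have hv e : e \in D -> adj v e -> index e M < index d M.
    by move=> eD ve; have := gap_order gp dD eD wd ve; rewrite !idx // ltn_add2l.
  split=> // w' d' w'Y w'S d'D w'd'.
  have [e eD ve] := S_hits vS.
  have := IH Y'' (M ++ w :: tl) v e n _ E1 vS _ eD ve w' d' w'Y w'S d'D w'd'.
  rewrite !index_cat !inM // => H; apply: leq_trans (H _ _) (ltnW (hv e eD ve)).
    by move: ltm; rewrite EY size_cat /=; clear; lia.
  by move=> y yY; apply: YK; rewrite EY mem_cat inE yY !orbT.
move=> w' d' w'Y w'S d'D w'd'.
case: Y => [//|y Y] in ltm En YK Un cn inM step w'Y *.
have [yS|yI] := boolP (y \in S).
  have [H1 H2] := step y Y [::] (erefl _) yS (or_introl (erefl _)).
  by move: w'Y; rewrite inE => /predU1P[E|w'Y]; [apply: H1; rewrite -?E|apply: H2 w'd'].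
rewrite inE negbK in yI.
have yc : y \in c by rewrite -(mem_rot n) En mem_cat !inE eqxx !orbT.
have yW : y \in W.
  have := YK y (mem_head _ _); rewrite !in_setU in_setD negb_or negb_and negbK => /andP[yD].
  by case/orP=> //; rewrite inE yI yc yD.
have wy : w' != y by apply: contraTneq w'S => ->; rewrite inE yI.
move: w'Y; rewrite inE (negPf wy) /= => w'Y.
case: Y => [//|v Y] in ltm En YK Un cn inM step w'Y *.
have vS : v \in S.
  have Env : rot n c = (M ++ [:: w]) ++ y :: v :: Y by rewrite En -catA.
  have -> : v = next c y; last exact: next_I.
  by rewrite -(next_rot n Uc) Env next_cat2 // -Env rot_uniq.
have [H1 H2] := step v Y [:: y] (erefl _) vS (or_intror (ex_intro2 _ _ y yW (erefl _))).
by move: w'Y; rewrite inE => /predU1P[E|w'Y]; [apply: H1; rewrite -?E|apply: H2 w'd'].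
Qed.

Lemma K_c x : x \in K -> x \in c.
Proof.
by rewrite !in_setU in_setD => /orP[/succ_c//|/andP[_]]; rewrite inE => /and3P[].
Qed.

Lemma K_I x : x \in K -> x \in I.
Proof.
by rewrite !in_setU in_setD => /orP[/D_I//|/andP[_]]; rewrite inE => /and3P[].
Qed.

(** A neighbour of [d] in [S] is labelled by the number of vertices of [K] met before it when [c] is
    read from [d]. Equal labels would put two neighbours in one stretch without [K], against
    [chain_decreasing]. Labels start at 1 because [d] is in [K]. *)
Lemma card_D_S d : d \in D -> #|[set w in S | adj w d]| <= #|K|.
Proof.
move=> dD; have [n L EL] := rot_to (succ_c dD).
set T := [set w in S | adj w d].
have dK : d \in K by rewrite inE dD.
have Un : uniq (d :: L) by rewrite -EL rot_uniq.
pose cn w := count (mem K) (take (index w (d :: L)) (d :: L)).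
have TL w : w \in T -> w \in L.
  rewrite !inE => /andP[wI wd]; have: w \in d :: L by rewrite -EL mem_rot S_c ?inE.
  by rewrite inE (negPf (adj_neq wd)).
have sub : {subset [seq cn w | w <- enum T] <= iota 1 #|K|}.
  move=> m /mapP[w]; rewrite mem_enum => wT ->; rewrite mem_iota; apply/andP; split.
    have := TL _ wT; rewrite /cn /= => wL; case: eqVneq => [E|_] /=; last by rewrite dK.
    by move: Un; rewrite /= E wL.
  rewrite add1n ltnS /cn; apply: leq_trans (_ : count (mem K) (d :: L) <= _).
    rewrite -[X in _ <= count _ X](cat_take_drop (index w (d :: L))).
    by rewrite count_cat leq_addr.
  rewrite -size_filter cardE; apply: uniq_leq_size; first exact: filter_uniq.
  by move=> x; rewrite mem_filter mem_enum => /andP[].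
rewrite cardE -(size_map cn) -[X in _ <= X](size_iota 1); apply: uniq_leq_size sub.
rewrite map_inj_in_uniq ?enum_uniq // => w w'; rewrite !mem_enum => wT w'T E.
apply/eqP/negPn/negP=> ww.
have main u u' : u \in T -> u' \in T -> cn u = cn u' -> index u L < index u' L -> False.
  move=> uT u'T Ecn lt.
  have [uL u'L] := (TL _ uT, TL _ u'T); rewrite /cn in Ecn.
  case/splitPr: uL EL Un lt Ecn u'L => M0 R0 EL Un lt Ecn u'L.
  have uM : u \notin M0.
    by move: Un => /= /andP[_]; rewrite cat_uniq /= negb_or => /and3P[_ /andP[]].
  have u'R : u' \in R0.
    move: u'L lt; rewrite !index_cat (negPf uM) /= eqxx addn0 mem_cat inE.
    case u'M: (u' \in M0) => /=; first by rewrite ltnNge ltnW ?index_mem.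
    case/predU1P=> [->|//]; by rewrite eqxx addn0 ltnn.
  case/splitPr: u'R EL Un lt Ecn u'L => Y0 Y1 EL Un lt Ecn u'L.
  have EL1 : d :: M0 ++ u :: Y0 ++ u' :: Y1 = (d :: M0) ++ u :: Y0 ++ u' :: Y1 by [].
  have EL2 : d :: M0 ++ u :: Y0 ++ u' :: Y1 = (d :: M0 ++ u :: Y0) ++ u' :: Y1.
    by rewrite /= -catA.
  have cnE X v Y : uniq (X ++ v :: Y) ->
      count (mem K) (take (index v (X ++ v :: Y)) (X ++ v :: Y)) = count (mem K) X.
    rewrite cat_uniq /= negb_or => /and3P[_ /andP[vX _] _].
    by rewrite index_cat (negPf vX) /= eqxx addn0 take_size_cat.
  have cn1 := cnE (d :: M0) u (Y0 ++ u' :: Y1).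
  have cn2 := cnE (d :: M0 ++ u :: Y0) u' Y1.
  rewrite -EL2 in cn2; move: Ecn; rewrite cn1 // cn2 // -cat_cons count_cat /= => Ecn.
  have Y0K y : y \in Y0 -> y \notin K.
    have: ~~ has (mem K) Y0 by rewrite has_count; move: Ecn; clear; lia.
    by move=> /hasPn H /H.
  have [m Em] := rot_catC (etrans EL EL2).
  have [m' Em'] : exists m', rot m' c = (Y1 ++ d :: M0) ++ u :: (Y0 ++ [:: u']).
    have E3 : rot m c = [:: u'] ++ (Y1 ++ d :: M0 ++ u :: Y0) by rewrite Em.
    have [m' Em'] := rot_catC E3; exists m'; rewrite Em' -!catA /=.
    by rewrite -catA.
  move: uT u'T; rewrite ![_ \in T]inE => /andP[uS ud] /andP[u'S u'd].
  have u'Y : u' \in Y0 ++ [:: u'] by rewrite mem_cat inE eqxx orbT.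
  have YK y : y \in Y0 ++ [:: u'] -> y \notin K.
    rewrite mem_cat inE => /orP[/Y0K//|/eqP->].
    by apply: contraTN u'S => /K_I; rewrite inE => ->.
  by have := chain_decreasing Em' uS YK dD ud u'Y u'S dD u'd; rewrite ltnn.
case: (ltngtP (index w L) (index w' L)) => [lt|lt|eq].
- exact: main lt.
- exact: main lt.
- by move: ww; rewrite -(nth_index d (TL _ wT)) eq (nth_index d (TL _ w'T)) eqxx.
Qed.

(** [nS] moves to the next vertex of [S] along [c]. If [x] sees [w] and [nS w], the vertex after [w]
    is in [K]: otherwise [x] could be inserted there or replace a vertex of [W], and would itself be
    in [W]. So the neighbourhood of [x] in [S] and its shift overlap in at most [#|K|] vertices. *)
Lemma card_Z_S x : x \in Z :\: W -> 2 * #|[set w in S | adj w x]| <= #|S| + #|K|.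
Proof.
rewrite in_setD => /andP[xW xZ]; set T := [set w in S | adj w x].
pose nS w := if next c w \in S then next c w else next c (next c w).
have inj : injective (next c) := can_inj (prev_next Uc).
have nxtS w : w \in S -> nS w \in S.
  move=> wS; rewrite /nS; case: ifPn => //; rewrite inE negbK => nI.
  by apply: next_I; rewrite // mem_next S_c.
have nSinj : {in S &, injective nS}.
  move=> u v uS vS; rewrite /nS; case: ifPn => nu; case: ifPn => nv.
  - exact: inj.
  - by move/inj=> E; move: nv; rewrite -E uS.
  - by move/inj=> E; move: nu; rewrite E vS.
  - by move/inj/inj.
have TS w : w \in T -> w \in S by rewrite inE => /andP[].
have Tinj : {in T &, injective nS} by move=> u v /TS uS /TS vS; apply: nSinj.
have cI : #|T :&: nS @: T| <= #|K|.
  pose B := [set w in T | nS w \in T].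
  have -> : T :&: nS @: T = nS @: B.
    apply/setP=> y; rewrite in_setI; apply/andP/imsetP=> [[yT /imsetP[w wT Ey]]|[w wB ->]].
      by exists w => //; rewrite inE wT -Ey yT.
    by move: wB; rewrite inE => /andP[wT nwT]; split=> //; apply: imset_f.
  apply: leq_trans (leq_imset_card _ _) _; rewrite -(card_imset (mem B) inj).
  apply/subset_leq_card/subsetP=> _ /imsetP[w wB ->].
  move: wB; rewrite inE => /andP[]; rewrite ![_ \in T]inE => /andP[wS wx] /andP[nwS nwx].
  apply: contraNT xW => nK.
  have [nwS'|nwI] := boolP (next c w \in S).
    rewrite inE xZ; apply/existsP; exists x; rewrite connect0 andbT.
    apply/exists_inP; exists w => //; rewrite nwS' /common adj_sym wx adj_sym.
    by move: nwx; rewrite /nS nwS'.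
  have nwW : next c w \in W.
    move: nK; rewrite !in_setU in_setD negb_or negb_and negbK => /andP[nD /orP[//|]].
    by rewrite inE nD mem_next S_c // andbT; rewrite inE negbK in nwI; rewrite nwI.
  have nwZ := W_Z nwW; move: nwW; rewrite inE nwZ => /existsP[z1 /andP[z1S con]].
  rewrite inE xZ; apply/existsP; exists z1; rewrite z1S.
  apply: connect_trans (connect1 _) con.
  rewrite /R /= xZ nwZ /common prev_next // adj_sym wx adj_sym.
  by move: nwx; rewrite /nS (negPf nwI).
have cT : #|nS @: T| = #|T| by apply: card_in_imset.
have := cardsUI T (nS @: T); rewrite cT.
have : #|T :|: nS @: T| <= #|S|.
  apply/subset_leq_card/subsetP=> y /setUP[/TS//|/imsetP[w /TS wS ->]]; exact: nxtS.
move: cI; move: #|T| #|_ :&: _| #|_ :|: _| #|S| #|K| => a1 a2 a3 a4 a5; clear; lia.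
Qed.

Lemma SS_gap y : y \in S -> next c y \in S -> exists P, gap P [::] y (next c y).
Proof.
move=> yS nyS; have [n [t E]] := rot_next Uc (ltnW c2) (S_c yS).
have E1 : rot n c = [:: y] ++ (next c y :: t) by rewrite E.
have [m Em] := rot_catC E1; exists ((next c y :: t) ++ [:: y]); split=> //.
- have cy : cycle (@adj G) (next c y :: t ++ [:: y]) by rewrite -[_ :: _ ++ _]Em rot_cycle.
  by have [] := cycle_walk cy; rewrite last_cat.
- by exists m; rewrite cats0.
- by left.
Qed.

(** No vertex of [h |: K] is seen by both ends of a cycle edge inside [S], and each end misses at
    most [k - 1] vertices of [I], so [#|K| + 1 <= 2 * (k - 1)]. *)
Lemma card_K : #|K| + 3 <= 2 * k.
Proof.
have [y yS nyS] := exists_SS; have [P gp] := SS_gap yS nyS.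
have ny : ~~ adj y h.
  apply/negP=> yh; have: next c y \in D by apply: imset_f; rewrite inE adj_sym.
  by move/D_I; move: nyS; rewrite inE => /negPf->.
pose M v := [set x in I | ~~ adj v x].
have sub : h |: K \subset M y :|: M (next c y).
  apply/subsetP=> x /setU1P[->|xK]; first by rewrite !inE h_I ny.
  rewrite !inE K_I //= -negb_and; apply/negP=> /andP[yx nyx].
  move: xK; rewrite !in_setU in_setD => /orP[xD|/andP[xW xZ]].
    exact: (gap_common gp xD).
  case/negP: xW; rewrite inE xZ; apply/existsP; exists x; rewrite connect0 andbT.
  by apply/exists_inP; exists y => //; rewrite nyS /common !(adj_sym x) yx nyx.
have hK : h \notin K by apply/negP=> /K_c; rewrite (negPf hc).
have := leq_trans (subset_leq_card sub) (leq_card_setU _ _).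
rewrite cardsU1 hK; have := miss_I yS; have := miss_I nyS; rewrite -!/(M _).
move: #|M y| #|M _| #|K| => a1 a2 a3; clear -hk; lia.
Qed.

Lemma card_adj_sum (B : {set G}) (e : pred G) : #|[set x in B | e x]| = \sum_(x in B) (e x : nat).
Proof.
rewrite -sum1dep_card big_mkcondr; apply: eq_bigr => x _; by case: (e x).
Qed.

(** [miss_sub] for [h |: K]; the last term accounts for [h]. Over all of [S] these terms add up to
    at most [#|A|]. *)
Lemma S_K_hits w : w \in S ->
  #|K| + 2 <= k + \sum_(x in K) (adj w x : nat) + (w \in A).
Proof.
move=> wS; have hK : h \notin K by apply/negP=> /K_c; rewrite (negPf hc).
have sub : h |: K \subset I.
  by apply/subsetP=> x /setU1P[->|/K_I//]; apply: h_I.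
have := miss_sub wS sub; rewrite cardsU1 hK card_adj_sum big_setU1 //= inE adj_sym.
by move: (\sum_(_ in K) _) #|K| => a1 a2; clear; case: (adj _ _); lia.
Qed.

Lemma isolated_contradiction : False.
Proof.
have DZ : [disjoint D & Z :\: W].
  apply/pred0P=> x /=; apply/negP=> /andP[xD]; rewrite in_setD => /andP[_].
  by rewrite inE xD !andbF.
have cK : #|K| = #|A| + #|Z :\: W|.
  by rewrite -card_succ -cardsUI; move: DZ; rewrite -setI_eq0 => /eqP->; rewrite cards0 addn0.
have n2 : #|G| <= 2 * #|S|.
  by have := card_IS; have := cardsC I; rewrite -/S; move: #|I| #|S| #|G| => a1 a2 a3; clear; lia.
have tot : #|S| * (#|K| + 2) <= #|S| * k + \sum_(w in S) \sum_(x in K) (adj w x : nat) + #|A|.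
  have -> : #|S| * (#|K| + 2) = \sum_(w in S) (#|K| + 2) by rewrite sum_nat_const.
  apply: (leq_trans (n := \sum_(w in S)
      (k + \sum_(x in K) (adj w x : nat) + (w \in A)))); first exact: leq_sum S_K_hits.
  rewrite !big_split /= sum_nat_const leq_add2l.
  rewrite -(card_adj_sum S (mem A)); apply/subset_leq_card/subsetP => w.
  by rewrite inE => /andP[].
have swap' : \sum_(w in S) \sum_(x in K) (adj w x : nat) =
    \sum_(x in D) #|[set w in S | adj w x]| + \sum_(x in Z :\: W) #|[set w in S | adj w x]|.
  rewrite exchange_big /= (big_setID D) /=; congr addn.
    rewrite setUK; apply: eq_bigr => x _.
    by rewrite (card_adj_sum S (fun w => adj w x)).
  have -> : K :\: D = Z :\: W.
    rewrite /K setDUl setDv set0U; apply/setDidPl; rewrite disjoint_sym; exact: DZ.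
  by apply: eq_bigr => x _; rewrite (card_adj_sum S (fun w => adj w x)).
have s1 : \sum_(x in D) #|[set w in S | adj w x]| <= #|A| * #|K|.
  rewrite -card_succ -sum_nat_const; apply: leq_sum => x; exact: card_D_S.
have s2 : 2 * \sum_(x in Z :\: W) #|[set w in S | adj w x]| <= #|Z :\: W| * (#|S| + #|K|).
  rewrite -sum_nat_const big_distrr /=; apply: leq_sum => x; exact: card_Z_S.
rewrite {}swap' in tot; have kA := card_nbr; have cK' := card_K.
rewrite cK in tot s1 s2 cK'.
apply: (@counting_contradiction k #|A| #|Z :\: W| #|S|) => //.
  exact: leq_trans hcard n2.
move: tot s1 s2; move: (\sum_(x in D) _) (\sum_(x in _ :\: _) _) => x1 x2.
move: #|S| #|A| #|Z :\: W| => s0 t0 b0; clear; lia.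
Qed.

End MaximalStable.

Theorem isolated_vertex_absurd : False.
Proof.
by have [I [sI DI mI]] := exists_maximal_stable; apply: (isolated_contradiction sI DI mI).
Qed.

End IsolatedVertex.

(** * Chains of a longest cycle missing a clique *)

Ltac list_assoc := rewrite /=; repeat progress rewrite -?catA /=.

Section Chains.

(** [priv d v] is meant to say that no vertex of [D] other than [d] equals or sees [v]. It is kept
    abstract, with only the properties listed below. *)
Variables (G : sgraph) (k : nat) (c : seq G) (H A : {set G}) (priv : G -> G -> bool).
Let D := [set next c a | a in A].
Hypothesis hk : 4 <= k.
Hypothesis htough : one_tough G.
Hypothesis hconn : k_connected k.-1 G.
Hypothesis hdeg : k <= min_deg G.
Hypothesis Lc : longest c.
Hypothesis HE : forall v, (v \in H) = (v \notin c).
Hypothesis H1 : 1 < #|H|.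
Hypothesis Ac : forall a, a \in A -> a \in c.
Hypothesis card_A : #|A| = k.-1.
Hypothesis H_nbr : forall y z, y \in H -> adj y z -> z \in H \/ z \in A.
Hypothesis H_span : forall a a', a \in A -> a' \in A -> a != a' ->
  exists s x y, [/\ walk x y s, adj a x, adj y a' & perm_eq s (enum H)].
Hypothesis D_A : forall d, d \in D -> d \notin A.
Hypothesis next_D_A : forall d, d \in D -> next c d \notin A.
Hypothesis D_hit : forall v, v \in c -> v \notin A -> exists2 d, d \in D & (v == d) || adj v d.
Hypothesis privP : forall d v, priv d v -> v \in c /\ v \notin A.
Hypothesis priv_eq : forall d v d', priv d v -> d' \in D -> (v == d') || adj v d' -> d' = d.
Hypothesis privN : forall d v, v \in c -> v \notin A -> ~~ priv d v ->
  exists2 d', d' \in D & (d' != d) && ((v == d') || adj v d').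
Hypothesis priv_D : forall d, d \in D -> priv d d.
Hypothesis priv_next : forall d, d \in D -> priv d (next c d).
Hypothesis priv_clique : forall d u v, d \in D -> priv d u -> priv d v -> u != v -> adj u v.

Let Uc : uniq c. Proof. by case: Lc. Qed.
Let c2 : 2 < size c. Proof. by case: Lc. Qed.
Let cc : cycle (@adj G) c. Proof. by case: Lc. Qed.

(** Gaining all of [H], at least two vertices, pays for one lost vertex. *)
Lemma span_exchange r q l : cycle (@adj G) r -> perm_eq q (enum H) ->
  perm_eq (l ++ r) (q ++ c) -> size l <= 1 -> False.
Proof.
move=> cr pq pr l1; apply: (longest_exchange Lc cr pr).
- by rewrite (perm_uniq pq) enum_uniq.
- by move=> z; rewrite (perm_mem pq) mem_enum HE.
- by rewrite (perm_size pq) -cardE; apply: leq_ltn_trans H1.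
Qed.

Lemma segment_walk n S1 X b S2 : rot n c = S1 ++ (X ++ [:: b]) ++ S2 ->
  walk (head b X) b (X ++ [:: b]).
Proof.
move=> E; have := @piece_walk _ _ Lc n S1 (X ++ [:: b]) S2 b E.
by rewrite last_cat /=; case: X E => [|x X] E /=; apply.
Qed.

Lemma segment_walkl n S1 a X S2 : rot n c = S1 ++ (a :: X) ++ S2 ->
  walk a (last a X) (a :: X).
Proof. by move=> E; have := @piece_walk _ _ Lc n S1 (a :: X) S2 a E isT. Qed.

Lemma next_segment n S1 a B Y b S2 : rot n c = S1 ++ (a :: B) ++ Y ++ b :: S2 ->
  next c (last a B) = head b Y.
Proof.
by case: Y => [|y Y] E; apply: (@next_piece _ _ Lc n S1 a B _ _ E).
Qed.

Lemma rot_neq n S1 a X b S2 : rot n c = S1 ++ a :: X ++ b :: S2 -> a != b.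
Proof.
move=> E; have: uniq (rot n c) by rewrite rot_uniq.
rewrite E cat_uniq /= mem_cat inE => /and3P[_ _ /andP[+ _]].
by rewrite !negb_or => /and3P[].
Qed.

(** The block can be entered at any of its vertices, traversed completely and left to the vertex
    that follows it on [c]. *)
Definition entry a (B : seq G) := a \in A /\ forall x, x \in B -> exists B' y,
  [/\ perm_eq B' B, walk x y B' & adj y (next c (last a B))].

(** The cycle runs along [X] to [ai], through [H] to [aj], back along [Y], through [Bi] to [t], back
    along [Z], and through [Bj] to the head of [X]. Only the order in which [t] and its successor
    see the two blocks matters. *)
Lemma cross_absurd n X ai Bi Y aj Bj Z t :
  rot n c = X ++ (ai :: Bi) ++ Y ++ (aj :: Bj) ++ Z ++ [:: t] ->
  entry ai Bi -> entry aj Bj -> has (adj t) Bi -> has (adj (head ai X)) Bj -> False.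
Proof.
move=> E [aiA enti] [ajA entj] /hasP[xi xiB tx] /hasP[xj xjB hx].
have [B'i [yi [pi Wi]]] := enti _ xiB; have [B'j [yj [pj Wj]]] := entj _ xjB.
rewrite (@next_segment n (X ++ (ai :: Bi) ++ Y) aj Bj Z t [::]); last by rewrite E -!catA.
rewrite (@next_segment n X ai Bi Y aj (Bj ++ Z ++ [:: t])) // => aj_ ai_.
have aa : ai != aj.
  by apply: (@rot_neq n X ai (Bi ++ Y) aj (Bj ++ Z ++ [:: t])); rewrite E -!catA.
have WX : walk (head ai X) ai (X ++ [:: ai]).
  by apply: (@segment_walk n [::] X ai (Bi ++ Y ++ (aj :: Bj) ++ Z ++ [:: t])); rewrite E -!catA.
have WY : walk (head aj Y) aj (Y ++ [:: aj]).
  by apply: (@segment_walk n (X ++ ai :: Bi) Y aj (Bj ++ Z ++ [:: t])); rewrite E -!catA.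
have WZ : walk (head t Z) t (Z ++ [:: t]).
  by apply: (@segment_walk n (X ++ (ai :: Bi) ++ Y ++ aj :: Bj) Z t [::]); rewrite E -!catA.
have [q [x [y [Wq ax ya pq]]]] := H_span aiA ajA aa.
have W : cycle (@adj G) (((((X ++ [:: ai]) ++ q) ++ rev (Y ++ [:: aj])) ++ rev B'i) ++ rev (Z ++ [:: t]) ++ rev B'j).
  refine (walk_cycle (walk_cat (walk_cat (walk_cat (walk_cat WX ax Wq) ya (walk_rev WY)) _ (walk_rev Wi)) _ (walk_cat (walk_rev WZ) _ (walk_rev Wj))) _); by rewrite adj_sym.
apply: (span_exchange (l := [::]) W pq) => //.
apply: perm_trans (perm_cat_rot q E); apply/permP=> P; repeat progress rewrite ?(count_cat, count_rev) /=.
by rewrite !(permP pi) !(permP pj) /=; clear; lia.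
Qed.

(** Along [Y] to [aj], through [H] to [ai], back along [Z], then through [Bj] and across the edge
    into [Bi], which exits to the start of [Y]. *)
Lemma entries_nonadj n ai Bi Y aj Bj Z :
  rot n c = (ai :: Bi) ++ Y ++ (aj :: Bj) ++ Z -> entry ai Bi -> entry aj Bj ->
  forall x y, x \in Bi -> y \in Bj -> ~~ adj x y.
Proof.
move=> E [aiA enti] [ajA entj] xi xj xiB xjB; apply/negP=> xx.
have [B'i [yi [pi Wi]]] := enti _ xiB; have [B'j [yj [pj Wj]]] := entj _ xjB.
have [m Em] := @rot_catC _ c (ai :: Bi) (Y ++ (aj :: Bj) ++ Z) n E.
have [m' Em'] := @rot_catC _ c [:: ai] (Bi ++ Y ++ (aj :: Bj) ++ Z) n E.
rewrite (@next_segment m Y aj Bj Z ai Bi); last by rewrite Em -!catA.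
rewrite (@next_segment n [::] ai Bi Y aj (Bj ++ Z)) // => aj_ ai_.
have aa : ai != aj.
  by apply: (@rot_neq n [::] ai (Bi ++ Y) aj (Bj ++ Z)); rewrite E -!catA.
have WY : walk (head aj Y) aj (Y ++ [:: aj]).
  by apply: (@segment_walk n (ai :: Bi) Y aj (Bj ++ Z)); rewrite E -!catA.
have WZ : walk (head ai Z) ai (Z ++ [:: ai]).
  by apply: (@segment_walk m (Y ++ aj :: Bj) Z ai Bi); rewrite Em -!catA.
have [q [x [y [Wq ax ya pq]]]] := H_span ajA aiA (contra_neq (@esym _ _ _) aa).
have W : cycle (@adj G) (((((Y ++ [:: aj]) ++ q) ++ rev (Z ++ [:: ai])) ++ rev B'j) ++ B'i).
  refine (walk_cycle (walk_cat (walk_cat (walk_cat (walk_cat WY ax Wq) ya (walk_rev WZ)) _ (walk_rev Wj)) _ Wi) _) => //; by rewrite adj_sym.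
apply: (span_exchange (l := [::]) W pq) => //.
apply: perm_trans (perm_cat_rot q E); apply/permP=> P; repeat progress rewrite ?(count_cat, count_rev) /=.
by rewrite !(permP pi) !(permP pj) /=; clear; lia.
Qed.

(** Along [S] to [aj], through [Bm] and [W] to [t], through [Bj] and [Rj] to [am], and through [H]
    to the vertex of [A] that follows [t]. *)
Lemma detour_absurd n aj Bj Rj am Bm W t S :
  rot n c = (aj :: Bj) ++ Rj ++ (am :: Bm) ++ (W ++ [:: t]) ++ S ->
  entry aj Bj -> entry am Bm -> head aj S \in A ->
  has (adj t) Bj -> has (adj aj) Bm -> False.
Proof.
move=> E [ajA entj] [amA entm] hS /hasP[xj xjB txj] /hasP[xm xmB axm].
have [B'j [yj [pj Wj]]] := entj _ xjB; have [B'm [ym [pm Wm]]] := entm _ xmB.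
rewrite (@next_segment n ((aj :: Bj) ++ Rj) am Bm W t S); last by rewrite E -!catA.
rewrite (@next_segment n [::] aj Bj Rj am (Bm ++ (W ++ [:: t]) ++ S)) // => am_ aj_.
have E' : rot n c = ((aj :: Bj) ++ Rj ++ (am :: Bm) ++ (W ++ [:: t])) ++ S by rewrite E -!catA.
have [m Em] := rot_catC E'.
have aS : am != head aj S.
  case: S E hS {E' Em} => [|u S] E hS /=.
    by rewrite eq_sym; apply: (@rot_neq n [::] aj (Bj ++ Rj) am (Bm ++ W ++ [:: t])); rewrite E cats0 -!catA.
  by apply: (@rot_neq n ((aj :: Bj) ++ Rj) am (Bm ++ W ++ [:: t]) u S); rewrite E -!catA.
have WS : walk (head aj S) aj (S ++ [:: aj]).
  by apply: (@segment_walk m [::] S aj (Bj ++ Rj ++ (am :: Bm) ++ (W ++ [:: t]))); rewrite Em -!catA.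
have WW : walk (head t W) t (W ++ [:: t]).
  by apply: (@segment_walk n ((aj :: Bj) ++ Rj ++ (am :: Bm)) W t S); rewrite E -!catA.
have WR : walk (head am Rj) am (Rj ++ [:: am]).
  by apply: (@segment_walk n (aj :: Bj) Rj am (Bm ++ (W ++ [:: t]) ++ S)); rewrite E -!catA.
have [q [x [y [Wq ax ya pq]]]] := H_span amA hS aS.
have W' : cycle (@adj G) (((((S ++ [:: aj]) ++ B'm) ++ (W ++ [:: t])) ++ B'j) ++ (Rj ++ [:: am]) ++ q).
  exact (walk_cycle (walk_cat (walk_cat (walk_cat (walk_cat WS axm Wm) am_ WW) txj Wj) aj_ (walk_cat WR ax Wq)) ya).
apply: (span_exchange (l := [::]) W' pq) => //.
apply: perm_trans (perm_cat_rot q E); apply/permP=> P; repeat progress rewrite ?(count_cat, count_rev) /=.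
by rewrite !(permP pj) !(permP pm) /=; clear; lia.
Qed.

(* The vertex ak is left out, which is harmless since H has at least two vertices. *)
Lemma skip_absurd n ai Y ak Bk Rk al Bl W t :
  rot n c = (ai :: Y) ++ (ak :: Bk) ++ Rk ++ (al :: Bl) ++ W ++ [:: t] ->
  ai \in A -> entry ak Bk -> entry al Bl ->
  has (adj t) Bk -> has (adj (last ai Y)) Bl -> False.
Proof.
move=> E aiA [akA entk] [alA entl] /hasP[xk xkB txk] /hasP[xl xlB bxl].
have [B'k [yk [pk Wk]]] := entk _ xkB; have [B'l [yl [pl Wl]]] := entl _ xlB.
rewrite (@next_segment n ((ai :: Y) ++ (ak :: Bk) ++ Rk) al Bl W t [::]); last by rewrite E -!catA.
rewrite (@next_segment n (ai :: Y) ak Bk Rk al (Bl ++ W ++ [:: t])) // => al_ ak_.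
have aa : al != ai.
  by rewrite eq_sym; apply: (@rot_neq n [::] ai (Y ++ (ak :: Bk) ++ Rk) al (Bl ++ W ++ [:: t])); rewrite E -!catA.
have WY : walk ai (last ai Y) (ai :: Y) by apply: (@segment_walkl n [::] ai Y _ E).
have WW : walk (head t W) t (W ++ [:: t]).
  by apply: (@segment_walk n ((ai :: Y) ++ (ak :: Bk) ++ Rk ++ (al :: Bl)) W t [::]); rewrite E -!catA.
have WR : walk (head al Rk) al (Rk ++ [:: al]).
  by apply: (@segment_walk n ((ai :: Y) ++ ak :: Bk) Rk al (Bl ++ W ++ [:: t])); rewrite E -!catA.
have [q [x [y [Wq ax ya pq]]]] := H_span alA aiA aa.
have W' : cycle (@adj G) (((((ai :: Y) ++ B'l) ++ (W ++ [:: t])) ++ B'k) ++ (Rk ++ [:: al]) ++ q).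
  exact (walk_cycle (walk_cat (walk_cat (walk_cat (walk_cat WY bxl Wl) al_ WW) txk Wk) ak_ (walk_cat WR ax Wq)) ya).
apply: (span_exchange (l := [:: ak]) W' pq) => //.
apply: perm_trans (perm_cat_rot q E); apply/permP=> P; repeat progress rewrite ?(count_cat, count_rev) /=.
by rewrite !(permP pk) !(permP pl) /=; clear; lia.
Qed.

(** The mirror image of [attach_stable], for predecessors of vertices of [A]. *)
Lemma preds_nonadj n a Y a' Y' : rot n c = (a :: Y) ++ (a' :: Y') -> a \in A -> a' \in A ->
  ~~ adj (last a Y) (last a' Y').
Proof.
move=> E aA a'A; apply/negP=> ad.
have aa : a != a' by apply: (@rot_neq n [::] a Y a' Y').
have WY : walk a (last a Y) (a :: Y) by apply: (@segment_walkl n [::] a Y _ E).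
have WY' : walk a' (last a' Y') (a' :: Y').
  by apply: (@segment_walkl n (a :: Y) a' Y' [::]); rewrite cats0.
have [q [x [y [Wq ax ya pq]]]] := H_span aA a'A aa.
have W : cycle (@adj G) ((rev (a :: Y) ++ q) ++ (a' :: Y')).
  refine (walk_cycle (walk_cat (walk_cat (walk_rev WY) ax Wq) ya WY') _); by rewrite adj_sym.
apply: (span_exchange (l := [::]) W pq) => //.
by apply: perm_trans (perm_cat_rot q E); perm_count.
Qed.

(* A chain (a, B, R) is a stretch a :: B ++ R of the cycle between consecutive vertices of A.
   B and the T in [good_split] form the maximal run of vertices after a that are private to
   next c a; its last vertex is moved from B to T when the vertex after the run sees no
   other vertex of the run, so that every vertex of B starts a spanning path of B that
   leaves through the usual exit. *)
Definition chain := (G * seq G * seq G)%type.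
Definition anchor (e : chain) := e.1.1.
Definition block (e : chain) := e.1.2.
Definition remainder (e : chain) := e.2.
Definition chain_seq (e : chain) := anchor e :: block e ++ remainder e.

Record good (e : chain) : Prop := Good {
  good_A : anchor e \in A;
  good_rot : exists n S, rot n c = chain_seq e ++ S;
  good_succ : next c (anchor e) \in block e;
  good_block : {in block e, forall x, priv (next c (anchor e)) x};
  good_remainder : {in remainder e, forall x, x \notin A};
  good_end : next c (last (anchor e) (block e ++ remainder e)) \in A;
  good_split : exists T rest, [/\ remainder e = T ++ rest, {in T, forall x, priv (next c (anchor e)) x},
    1 < size (block e ++ T),
    rest = [::] \/ ~~ priv (next c (anchor e)) (next c (last (anchor e) (block e ++ T))) &
    (T = [::] /\ exists2 y, y \in block e & (y != last (anchor e) (block e)) && adj y (next c (last (anchor e) (block e))))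
    \/ (exists q, T = [:: q] /\ forall y, y \in block e -> ~~ adj y (next c q))] }.

Lemma succ_anchor e : good e -> next c (anchor e) \in D.
Proof. by case=> aA *; apply: imset_f. Qed.

Lemma chain_seq_uniq e : good e -> uniq (chain_seq e).
Proof.
case=> _ [n [S E]] _ _ _ _ _; have: uniq (rot n c) by rewrite rot_uniq.
by rewrite E cat_uniq => /andP[].
Qed.

Lemma block_uniq e : good e -> uniq (block e).
Proof. by move/chain_seq_uniq; rewrite /= cat_uniq => /and3P[_ ->]. Qed.

Lemma block_clique e : good e -> clique (block e).
Proof. by move=> oe x y xB yB; apply: (priv_clique (succ_anchor oe)); apply: (good_block oe). Qed.

(** If [T] holds a vertex, it sees the whole block and any end will do. Otherwise a walk ends at the
    last vertex of the block, or, when it starts there, at the other vertex that sees the exit. *)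
Lemma good_entry e : good e -> entry (anchor e) (block e).
Proof.
move=> oe; split=> [|x xB]; first exact: good_A.
have UB := block_uniq oe; have clB := block_clique oe.
have [T [rest [ER TP sB _ TT]]] := good_split oe.
have lB : last (anchor e) (block e) \in block e by case: (block e) xB => // u s _; rewrite /= mem_last.
have adjl : adj (last (anchor e) (block e)) (next c (last (anchor e) (block e))).
  by apply: next_cycle cc _; case: (privP (good_block oe lB)).
case: TT => [[ET [y0 y0B /andP[y0l y0v]]]|[q [ET _]]].
  have [Ex|xl] := eqVneq x (last (anchor e) (block e)).
    rewrite -Ex eq_sym in y0l *; have [B' p W] := clique_walk clB UB xB y0B y0l.
    by exists B', y0; split=> //; rewrite Ex.
  have [B' p W] := clique_walk clB UB xB lB xl.
  by exists B', (last (anchor e) (block e)).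
have Eq : next c (last (anchor e) (block e)) = q.
  have [n [S E]] := good_rot oe.
  by apply: (@next_segment n [::] (anchor e) (block e) [::] q (rest ++ S)); rewrite E /chain_seq ER ET /= -!catA.
have qB y : y \in block e -> adj y q.
  move=> yB; apply: (priv_clique (succ_anchor oe)); first exact: (good_block oe).
    by apply: TP; rewrite ET mem_head.
  have := chain_seq_uniq oe; rewrite /= ER ET cat_uniq => /and3P[_ _ /andP[/hasPn/(_ q) h _]].
  by apply: contraTneq yB => ->; apply: h; rewrite mem_head.
rewrite Eq; case: (rem x (block e)) (perm_to_rem xB) => [|y s] p.
  by exists [:: x], x; split; rewrite ?walk1 ?qB // perm_sym.
have yB : y \in block e by rewrite (perm_mem p) !inE eqxx orbT.
have xy : x != y.
  by move: UB; rewrite (perm_uniq p) /= inE negb_or => /andP[/andP[]].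
by have [B' pB W] := clique_walk clB UB xB yB xy; exists B', y; split=> //; apply: qB.
Qed.

(* Bypassing the private run Bl of e through H frees Bl for insertion elsewhere. *)
Lemma bypass e T rest t : good e -> remainder e = T ++ rest ->
  {in T, forall x, priv (next c (anchor e)) x} ->
  rest = [::] \/ ~~ priv (next c (anchor e)) (next c (last (anchor e) (block e ++ T))) ->
  t \in c -> t \notin block e ++ T -> next c t \notin block e ++ T ->
  (exists2 y, y \in block e & adj (next c t) y) ->
  exists q r, [/\ perm_eq q (enum H), cycle (@adj G) r,
    perm_eq ((block e ++ T) ++ r) (q ++ c), t \in r /\ next c t \in r & nb r t (next c t)].
Proof.
move=> oe ER TP TV tc tB tB' [yB yBB tyB].
have [n [S E]] := good_rot oe; rewrite /chain_seq ER in E.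
set d := next c (anchor e) in TP TV; set Bl := block e ++ T in tB tB' TV *.
have BlP : {in Bl, forall x, priv d x}.
  by move=> x; rewrite mem_cat => /orP[/(good_block oe)|/TP].
have dBl : d \in Bl by rewrite mem_cat good_succ.
have E1 : rot n c = ((anchor e) :: Bl) ++ (rest ++ S) by rewrite E /= -!catA.
have E2 : rot n c = [:: anchor e] ++ (Bl ++ rest ++ S) by rewrite E /= -!catA.
have lBl : last (anchor e) Bl \in Bl by case: Bl dBl {tB tB' TV BlP E1 E2} => // u s _; rewrite /= mem_last.
have [m Em] := rot_catC E1.
have lBlA : last (anchor e) Bl \notin A by case: (privP (BlP _ lBl)).
set v := next c (last (anchor e) Bl) in TV.
(* The run cannot be all of [c] except the anchor, as [A] has at least three vertices. *)
case EM : (rest ++ S) => [|v' S'].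
  exfalso; have: #|A| <= #|[set anchor e]|.
    apply/subset_leq_card/subsetP=> a' a'A; rewrite inE.
    have := Ac a'A; rewrite -(mem_rot n) E1 EM cats0 inE => /orP[//|/BlP/privP[_]].
    by rewrite a'A.
  by rewrite cards1 card_A; move: hk; clear; lia.
have Ev : v = v' by apply: (@next_segment n [::] (anchor e) Bl [::] v' S'); rewrite E1 EM.
rewrite EM -Ev in Em E1.
pose M := v :: S' ++ [:: anchor e].
have EmM : rot m c = M ++ Bl by rewrite Em /M /= -catA.
have UM : uniq (M ++ Bl) by rewrite -EmM rot_uniq.
have inM u : u \in c -> u \notin Bl -> u \in M.
  by rewrite -(mem_rot m) EmM mem_cat => /orP[//|->].
have tM := inM _ tc tB; have t'M : next c t \in M by apply: inM; rewrite ?mem_next.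
have WM : walk v (anchor e) M.
  have := @segment_walk m [::] (v :: S') (anchor e) Bl; apply; by rewrite EmM.
have conM : consec t (next c t) M.
  case/splitPr EM' : M / (tM) => [s1 s2].
  case: s2 EM' => [|z s2] EM'.
    have := walk_last v WM; rewrite EM' last_cat /= => Et.
    by move: tB'; rewrite Et dBl.
  have -> : next c t = z.
    by apply: (@next_segment m s1 t [::] [::] z (s2 ++ Bl)); rewrite EmM EM' -!catA.
  by apply/consecP; exists s1, s2.
have fin q r : perm_eq q (enum H) -> cycle (@adj G) r -> perm_eq r (q ++ M) ->
    consec t (next c t) r || consec (next c t) t r -> exists q r, [/\ perm_eq q (enum H),
    cycle (@adj G) r, perm_eq (Bl ++ r) (q ++ c), t \in r /\ next c t \in r & nb r t (next c t)].
  move=> pq cr pr cons; exists q, r; split=> //.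
  - apply: perm_trans (perm_cat_rot q EmM); apply/permP=> P.
    by rewrite !count_cat (permP pr) count_cat /=; clear; lia.
  - by rewrite !(perm_mem pr) !mem_cat tM t'M !orbT.
  apply: consec_nb cons; rewrite (perm_uniq pr) cat_uniq (perm_uniq pq) enum_uniq.
  move: UM; rewrite cat_uniq => /andP[-> _]; rewrite andbT; apply/hasPn=> z zM.
  rewrite (perm_mem pq) mem_enum HE negbK -(mem_rot m) EmM mem_cat.
  by rewrite zM.
have va : v != anchor e.
  by apply: (@rot_neq m [::] v S' (anchor e) Bl); rewrite Em.
(* If the vertex [v] after the run is in [A], then [H] joins it to the anchor. Otherwise [v] is not
   private and sees some [d'] in [D]; the part from [d'] on is reversed and [H] joins [a'] to the
   anchor. *)
have [vA|vA] := boolP (v \in A).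
  have [q [x [y [Wq ax ya pq]]]] := H_span (good_A oe) vA (contra_neq (@esym _ _ _) va).
  apply: (fin q (M ++ q) pq); first exact: (walk_cycle (walk_cat WM ax Wq)).
    by rewrite perm_catC.
  by rewrite consec_catl.
have vc : v \in c by rewrite mem_next; case: (privP (BlP _ lBl)).
have vp : ~~ priv d v.
  case: TV => // Er; move: (good_end oe); rewrite ER Er cats0 -/Bl -/v => vA'.
  by rewrite vA' in vA.
have [d' d'D /andP[dd]] := privN vc vA vp.
case/imsetP: (d'D) => a' a'A Ed'.
have -> : v == d' = false.
  apply/negbTE; apply: contraNneq lBlA; rewrite /v Ed' => /(can_inj (prev_next Uc))->//.
move=> /= vd'.
have aa : a' != anchor e by apply: contraNneq dd => Ea; rewrite Ed' Ea.
have a'M : a' \in M.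
  apply: inM; first exact: Ac.
  by apply/negP=> /BlP/privP[_]; rewrite a'A.
case/splitPr EM' : M / (a'M) => [M1 M2].
case: M2 EM' => [|z Y] EM'.
  by have := walk_last v WM; rewrite EM' last_cat /= => Et; rewrite Et eqxx in aa.
have Ez : z = d'.
  by rewrite Ed'; apply/esym; apply: (@next_segment m M1 a' [::] [::] z (Y ++ Bl)); rewrite EmM EM' -!catA.
rewrite Ez in EM'; move: (WM); rewrite EM' => /walk_cut[W1 _ W2].
have [q [x [y [Wq ax ya pq]]]] := H_span a'A (good_A oe) aa.
apply: (fin q (((M1 ++ [:: a']) ++ q) ++ rev (d' :: Y)) pq).
- by refine (walk_cycle (walk_cat (walk_cat W1 ax Wq) ya (walk_rev W2)) _); rewrite adj_sym.
- by rewrite EM'; perm_count.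
have EM2 : M = (M1 ++ [:: a']) ++ d' :: Y by rewrite EM' -catA.
(* The only edge of [M] that is cut goes from [a'] to [d']. It is not the edge at [t], since [d']
   would then see the private vertex [yB]. *)
move: conM; rewrite EM2 => /consec_catE[h|h|[u1 [u2 [_ [Eu _]]]]].
- by apply/orP; left; apply: consec_catl; apply: consec_catl.
- by apply/orP; right; apply/consec_catr/consec_revI.
- move: tyB; rewrite -Eu adj_sym => h.
  by move: dd; rewrite (priv_eq (good_block oe yBB) d'D) ?h ?orbT ?eqxx.
Qed.

(** The run freed by [bypass] is put back between [t] and its successor, as a spanning walk from [x]
    to [y] if these differ. If [x] is the whole block, inserting it alone loses just the vertex of
    [T]. *)
Lemma insert_thin e t x y : good e -> t \in c -> t \notin block e ++ remainder e ->
  next c t \notin block e ++ remainder e -> x \in block e -> y \in block e ->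
  adj t x -> adj (next c t) y -> x = y /\ 1 < size (block e).
Proof.
move=> oe tc tB tB' xB yB tx ty; have [T [rest [ER TP sB TV TT]]] := good_split oe.
have sub u : u \notin block e ++ remainder e -> u \notin block e ++ T.
  by apply: contra => uB; rewrite ER catA mem_cat uB.
have [|q [r [pq cr pr [tr tr'] nbr]]] := bypass oe ER TP TV tc (sub _ tB) (sub _ tB').
  by exists y.
have Uqc : uniq (q ++ c).
  rewrite cat_uniq (perm_uniq pq) enum_uniq Uc andbT; apply/hasPn=> z zc.
  by rewrite (perm_mem pq) mem_enum HE zc.
move: (Uqc); rewrite -(perm_uniq pr) cat_uniq => /and3P[UBl _ Ur].
have r1 : 1 < size r.
  have tt : t != next c t by apply/adj_neq/next_cycle.
  case: r {pr cr nbr Ur} tr tr' tt => [|u [|u' r]] //; rewrite !inE => /eqP-> /eqP->.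
  by rewrite eqxx.
have ty' : adj y (next c t) by rewrite adj_sym.
have clBl : clique (block e ++ T).
  move=> u w uB wB; apply: (priv_clique (succ_anchor oe)).
    by move: uB; rewrite mem_cat => /orP[/(good_block oe)|/TP].
  by move: wB; rewrite mem_cat => /orP[/(good_block oe)|/TP].
have inBl u : u \in block e -> u \in block e ++ T by rewrite mem_cat => ->.
have [Exy|xy] := eqVneq x y; last first.
  exfalso; have [s ps Ws] := clique_walk clBl UBl (inBl _ xB) (inBl _ yB) xy.
  have [r' cr' pr'] := cycle_insert Ur r1 cr tr tr' nbr Ws tx ty'.
  apply: (span_exchange (l := [::]) cr' pq) => //; apply: perm_trans pr.
  by apply: (perm_trans pr'); rewrite perm_cat2r.
split=> //; rewrite ltnNge; apply/negP=> sB1.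
have EB : block e = [:: x].
  by case: (block e) xB sB1 => [|u [|u' s]] //; rewrite inE => /eqP->.
case: TT => [[ET _]|[q0 [ET _]]]; first by move: sB; rewrite EB ET.
rewrite -Exy in ty'.
have [r' cr' pr'] := cycle_insert Ur r1 cr tr tr' nbr (walk1 x) tx ty'.
apply: (span_exchange (l := [:: q0]) cr' pq) => //; apply: perm_trans pr.
apply/permP=> P; rewrite EB ET /= (permP pr') /= ; clear; lia.
Qed.

(** * Decompositions of the cycle into chains, and the blocks seen by a tail *)

Definition chains_seq (l : seq chain) := flatten (map chain_seq l).
Definition decomposition (l : seq chain) := (exists n, rot n c = chains_seq l) /\ {in l, forall e, good e}.
Definition hit u (e : chain) := has (adj u) (block e).
(** The anchor that follows the chain is included, so the tails together cover every cycle vertex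
    outside the blocks. *)
Definition tail (e : chain) := remainder e ++ [:: next c (last (anchor e) (block e ++ remainder e))].

Lemma chains_seq_cons e l : chains_seq (e :: l) = chain_seq e ++ chains_seq l. Proof. by []. Qed.

Lemma chains_seq_cat l1 l2 : chains_seq (l1 ++ l2) = chains_seq l1 ++ chains_seq l2.
Proof. by rewrite /chains_seq map_cat flatten_cat. Qed.

Lemma chains_seq1 e : chains_seq [:: e] = chain_seq e. Proof. by rewrite /chains_seq /= cats0. Qed.

Lemma mem_chains_seq l u : reflect (exists2 e, e \in l & u \in chain_seq e) (u \in chains_seq l).
Proof. exact: flatten_mapP. Qed.

Lemma decomposition_catC l1 l2 : decomposition (l1 ++ l2) -> decomposition (l2 ++ l1).
Proof.
case=> [[n E]] ok_l; rewrite chains_seq_cat in E; have [m Em] := rot_catC E.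
split; first by exists m; rewrite chains_seq_cat.
by move=> e; rewrite mem_cat orbC -mem_cat => /ok_l.
Qed.

Lemma decomposition_rot i l : decomposition l -> decomposition (rot i l).
Proof. by move=> dl; apply: decomposition_catC; rewrite cat_take_drop. Qed.

Lemma decomposition_mem l u : decomposition l -> (u \in c) = (u \in chains_seq l).
Proof. by case=> [[n E] _]; rewrite -E mem_rot. Qed.

Lemma decomposition_uniq l : decomposition l -> uniq (chains_seq l).
Proof. by case=> [[n E] _]; rewrite -E rot_uniq. Qed.

Lemma chain_seq_inj l e e' u : decomposition l -> e \in l -> e' \in l -> u \in chain_seq e -> u \in chain_seq e' -> e = e'.
Proof.
move=> dl el e'l ue ue'; apply/eqP/negPn/negP=> ee.
have [i l' El] := rot_to el; have dl' := decomposition_rot i dl; rewrite El in dl'.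
have : e' \in e :: l' by rewrite -El mem_rot.
rewrite inE eq_sym (negPf ee) /= => e'l'.
have := decomposition_uniq dl'; rewrite chains_seq_cons cat_uniq => /and3P[_ /hasPn h _].
have: u \in chains_seq l' by apply/mem_chains_seq; exists e'.
by move/h => /negP; apply.
Qed.

Lemma chains_uniq l : decomposition l -> uniq l.
Proof.
move/decomposition_uniq; elim: l => // e l IH; rewrite chains_seq_cons cat_uniq => /and3P[_ /hasPn h /IH U].
rewrite /= U andbT; apply/negP=> el.
have: anchor e \in chains_seq l by apply/mem_chains_seq; exists e; rewrite ?mem_head.
by move/h; rewrite mem_head.
Qed.

Lemma block_A e u : good e -> u \in block e -> u \notin A.
Proof. by move=> oe /(good_block oe)/privP[]. Qed.

Lemma A_chain l a : decomposition l -> a \in A -> exists2 e, e \in l & a = anchor e.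
Proof.
move=> dl aA; have := Ac aA; rewrite (decomposition_mem _ dl) => /mem_chains_seq[e el].
have oe := dl.2 e el.
rewrite inE mem_cat => /or3P[/eqP->|/(block_A oe)|/(good_remainder oe)]; rewrite ?aA //.
by exists e.
Qed.

Lemma remainder_block l e e' u : decomposition l -> e \in l -> e' \in l -> u \in remainder e -> u \notin block e'.
Proof.
move=> dl el e'l uR; apply/negP=> uB.
have E : e = e' by apply: (chain_seq_inj (u := u) dl); rewrite ?inE ?mem_cat ?uR ?uB ?orbT.
have := chain_seq_uniq (dl.2 e el); rewrite /= cat_uniq => /and3P[_ _ /andP[/hasPn/(_ u uR)]].
by rewrite E uB.
Qed.

Lemma succ_chain l e u d : decomposition l -> e \in l -> u \in remainder e -> d \in D ->
  (u == d) || adj u d -> exists2 e', e' \in l & d = next c (anchor e') /\ hit u e'.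
Proof.
move=> dl el uR /imsetP[a /(A_chain dl)[e' e'l ->] ->] h; exists e' => //; split=> //.
have dB := good_succ (dl.2 _ e'l); case/orP: h => [/eqP E|h]; last by apply/hasP; exists (next c (anchor e')).
by move: (remainder_block dl el e'l uR); rewrite E dB.
Qed.

Lemma remainder_c l e u : decomposition l -> e \in l -> u \in remainder e -> u \in c.
Proof.
move=> dl el uR; rewrite (decomposition_mem _ dl); apply/mem_chains_seq; exists e => //.
by rewrite inE mem_cat uR !orbT.
Qed.

Lemma remainder_hit l e u : decomposition l -> e \in l -> u \in remainder e -> exists2 e', e' \in l & hit u e'.
Proof.
move=> dl el uR; have uA := good_remainder (dl.2 _ el) uR.
have [d dD' h] := D_hit (remainder_c dl el uR) uA.
by have [e' e'l [_ he']] := succ_chain dl el uR dD' h; exists e'.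
Qed.

Lemma remainder_other l e e' u : decomposition l -> e \in l -> u \in remainder e ->
  ~~ priv (next c (anchor e')) u -> exists2 e'', e'' \in l & hit u e'' /\ e'' != e'.
Proof.
move=> dl el uR np; have uA := good_remainder (dl.2 _ el) uR.
have [d dD' /andP[dd h]] := privN (remainder_c dl el uR) uA np.
have [e'' e''l [Ed he']] := succ_chain dl el uR dD' h; exists e'' => //; split=> //.
by apply: contraNneq dd => <-; rewrite Ed.
Qed.

Lemma chains_nonadj e l e' : decomposition (e :: l) -> e' \in l ->
  forall x y, x \in block e -> y \in block e' -> ~~ adj x y.
Proof.
move=> [[n E] okl] e'l; have oe := okl e (mem_head _ _).
have oe' : good e' by apply: okl; rewrite inE e'l orbT.
case/splitPr: e'l E {okl} => s1 s2 E.
apply: (@entries_nonadj n (anchor e) (block e) (remainder e ++ chains_seq s1) (anchor e') (block e') (remainder e' ++ chains_seq s2));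
  [|exact: good_entry|exact: good_entry].
by rewrite E chains_seq_cons chains_seq_cat chains_seq_cons /chain_seq /= -!catA.
Qed.

Lemma next_wrap n X b S t : rot n c = (X ++ b :: S) ++ [:: t] -> next c t = head b X.
Proof.
by move/rot_catC=> [m Em]; apply: (@next_segment m [::] t [::] X b S); rewrite Em.
Qed.

(* Consecutive vertices t, t+ of one chain see the blocks in the order opposite to the cycle. *)
Lemma order_absurd l e R1 t R2 s1 ei s2 ej s3 : decomposition (l ++ [:: e]) -> remainder e = R1 ++ t :: R2 ->
  l ++ [:: e] = s1 ++ ei :: s2 ++ ej :: s3 -> hit t ei -> hit (next c t) ej -> False.
Proof.
move=> dl ER El hi hj; have [[n E] okl] := dl.
have oi : good ei by apply: okl; rewrite El mem_cat mem_head orbT.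
have oj : good ej by apply: okl; rewrite El mem_cat inE mem_cat mem_head !orbT.
have E1 : rot n c = (chains_seq l ++ (anchor e :: block e) ++ R1 ++ [:: t]) ++ R2.
  by rewrite E chains_seq_cat chains_seq1 /chain_seq ER; list_assoc.
have [m Em] := rot_catC E1.
have El' : l ++ [:: e] = rcons (s1 ++ ei :: s2) ej ++ s3 by rewrite El -cats1; list_assoc.
case: (lastP s3) El' => [|s3' e'].
  rewrite cats0 cats1 => /eqP; rewrite eqseq_rcons => /andP[/eqP El2 /eqP Ee].
  have Em' : rot m c = (R2 ++ chains_seq s1) ++ (anchor ei :: block ei) ++ (remainder ei ++ chains_seq s2) ++ (anchor ej :: block ej) ++ R1 ++ [:: t].
    by rewrite Em El2 chains_seq_cat chains_seq_cons /chain_seq -Ee /=; list_assoc.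
  apply: (cross_absurd Em' (good_entry oi) (good_entry oj) hi).
  suff <- : next c t = head (anchor ei) (R2 ++ chains_seq s1) by [].
  apply: (@next_wrap m _ _ (block ei ++ (remainder ei ++ chains_seq s2) ++ (anchor ej :: block ej) ++ R1)).
  by rewrite Em'; list_assoc.
rewrite cats1 -rcons_cat => /eqP; rewrite eqseq_rcons => /andP[/eqP El2 /eqP Ee].
rewrite cat_rcons -catA /= in El2.
have Em' : rot m c = (R2 ++ chains_seq s1) ++ (anchor ei :: block ei) ++ (remainder ei ++ chains_seq s2) ++ (anchor ej :: block ej) ++
    (remainder ej ++ chains_seq s3' ++ anchor e :: block e ++ R1) ++ [:: t].
  by rewrite Em El2 chains_seq_cat chains_seq_cons chains_seq_cat chains_seq_cons /chain_seq /=; list_assoc.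
apply: (cross_absurd Em' (good_entry oi) (good_entry oj) hi).
suff <- : next c t = head (anchor ei) (R2 ++ chains_seq s1) by [].
apply: (@next_wrap m _ _ (block ei ++ (remainder ei ++ chains_seq s2) ++ (anchor ej :: block ej) ++ (remainder ej ++ chains_seq s3' ++ anchor e :: block e ++ R1))).
by rewrite Em'; list_assoc.
Qed.

Lemma next_remainder e R1 t p R2 : good e -> remainder e = R1 ++ t :: p :: R2 -> next c t = p.
Proof.
move=> oe ER; have [n [S E]] := good_rot oe.
apply: (@next_segment n (anchor e :: block e ++ R1) t [::] [::] p (R2 ++ S)).
by rewrite E /chain_seq ER /= -!catA.
Qed.

Lemma next_tail e R1 t p S : good e -> tail e = R1 ++ t :: p :: S ->
  next c t = p /\ exists R2, remainder e = R1 ++ t :: R2.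
Proof.
move=> oe; rewrite /tail; case: (lastP S) => [|S' z].
  have -> : R1 ++ [:: t; p] = rcons (rcons R1 t) p by rewrite -!cats1 -catA.
  rewrite cats1 => /eqP; rewrite eqseq_rcons => /andP[/eqP ER /eqP <-].
  by rewrite ER !last_cat last_rcons; split=> //; exists [::]; rewrite -cats1.
rewrite -!rcons_cons -rcons_cat cats1 => /eqP; rewrite eqseq_rcons => /andP[/eqP ER _].
by split; [apply: next_remainder ER|exists (p :: S')].
Qed.

Lemma tail_mem e u : u \in tail e -> u \in remainder e \/ u = next c (last (anchor e) (block e ++ remainder e)).
Proof. by rewrite mem_cat inE => /orP[->|/eqP->]; [left|right]. Qed.

Lemma tail_notin l e e' u : decomposition l -> e \in l -> e' \in l -> e != e' -> u \in tail e ->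
  u \notin block e' ++ remainder e'.
Proof.
move=> dl el e'l ee /tail_mem[uR|->].
  apply/negP=> h; case/eqP: ee; apply: (chain_seq_inj (u := u) dl el e'l); rewrite inE ?h ?orbT //.
  by rewrite mem_cat uR !orbT.
have zA := good_end (dl.2 _ el); have oe' := dl.2 _ e'l.
by rewrite mem_cat; apply/negP=> /orP[/(block_A oe')|/(good_remainder oe')]; rewrite zA.
Qed.

Lemma tail_c l e u : decomposition l -> e \in l -> u \in tail e -> u \in c.
Proof.
move=> dl el /tail_mem[/(remainder_c dl el)//|->]; apply: Ac; exact: good_end (dl.2 _ el).
Qed.

Lemma has_split (T : eqType) (p : pred T) (s : seq T) : has p s ->
  exists s1 x s2, [/\ s = s1 ++ x :: s2, p x & ~~ has p s1].
Proof.
elim: s => //= x s IH; have [px _|npx /= /IH[s1 [y [s2 [-> py h]]]]] := boolP (p x).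
  by exists [::], x, s.
by exists (x :: s1), y, s2; rewrite /= negb_or npx.
Qed.

Lemma after_hit l e R1 t R2 P Q ei ej : decomposition (l ++ [:: e]) -> l = P ++ Q ->
  remainder e = R1 ++ t :: R2 -> ei \in P -> hit t ei -> ej \in l ++ [:: e] ->
  hit (next c t) ej -> ej \in P.
Proof.
move=> dl El ER eiP hi ejl hj; apply/negPn/negP=> ejP.
have : ej \in Q ++ [:: e] by move: ejl; rewrite El -catA mem_cat (negPf ejP).
case/splitPr EQ : (Q ++ [:: e]) / => [q1 q2].
case/splitPr: eiP El {ejP} => p1 p2 El.
apply: (@order_absurd l e R1 t R2 p1 ei (p2 ++ q1) ej q2) => //.
by rewrite El; list_assoc; rewrite EQ.
Qed.

(** Every vertex of a remainder sees some block, so the restriction given by [after_hit] passes from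
    vertex to vertex. *)
Lemma after_hits l e R1 t R2 P Q ei : decomposition (l ++ [:: e]) -> l = P ++ Q ->
  remainder e = R1 ++ t :: R2 -> ei \in P -> hit t ei ->
  forall p ej, p \in R2 -> ej \in l ++ [:: e] -> hit p ej -> ej \in P.
Proof.
move=> dl El; elim: R2 R1 t ei => // p R2 IH R1 t ei ER eiP hi.
have eel : e \in l ++ [:: e] by rewrite mem_cat mem_head orbT.
have Ep : next c t = p by apply: next_remainder ER; apply: dl.2.
have step ej : ej \in l ++ [:: e] -> hit p ej -> ej \in P.
  by rewrite -Ep; apply: after_hit dl El ER eiP hi.
have pR : p \in remainder e by rewrite ER mem_cat !inE eqxx !orbT.
have [e' e'l he'] := remainder_hit dl eel pR.
move=> p' ej; rewrite inE => /predU1P[->|p'R]; first exact: step.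
apply: (IH (R1 ++ [:: t]) p e') => //; last exact: step.
by rewrite ER -catA.
Qed.

(** A vertex [p] between them, just before [u'], sees only the block of [ek]: later blocks are
    excluded by [u], earlier ones by [u']. So [p] is private there and sees the whole block, and
    [insert_thin] at [p] and [u'] demands two vertices in the block while forcing them all to be
    equal. *)
Lemma second_hit l e s1 ek s2 R1 u M u' S : decomposition (l ++ [:: e]) -> l = s1 ++ ek :: s2 ->
  tail e = R1 ++ u :: M ++ u' :: S -> hit u ek -> hit u' ek -> M = [::].
Proof.
move=> dl El ET hu hu'; case: (lastP M) ET => // M' p ET; exfalso.
have eel : e \in l ++ [:: e] by rewrite mem_cat mem_head orbT.
have ekl : ek \in l ++ [:: e] by rewrite El !mem_cat mem_head orbT.
have oe := dl.2 _ eel; have ok_ := dl.2 _ ekl.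
have ee : e != ek.
  have := chains_uniq dl; rewrite cat_uniq => /and3P[_ + _]; rewrite /= orbF.
  by apply: contraNneq => ->; rewrite El mem_cat mem_head orbT.
have ET' : tail e = (R1 ++ u :: M') ++ p :: u' :: S by rewrite ET -cats1; list_assoc.
have [Ep [R2 ER]] := next_tail oe ET'; rewrite -catA /= in ER.
have pR : p \in remainder e by rewrite ER mem_cat inE mem_cat mem_head !orbT.
have pT : p \in tail e by rewrite mem_cat pR.
have u'T : u' \in tail e by rewrite ET' mem_cat !inE eqxx !orbT.
have El' : l = rcons s1 ek ++ s2 by rewrite El cat_rcons.
have ekP : ek \in rcons s1 ek by rewrite mem_rcons mem_head.
have ph ej : ej \in l ++ [:: e] -> hit p ej -> ej = ek.
  move=> ejl hj.
  have : ej \in rcons s1 ek.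
    by apply: (after_hits dl El' ER ekP hu _ ejl hj); rewrite mem_cat mem_head orbT.
  rewrite mem_rcons inE => /predU1P[//|/splitPr]; move: El => /[swap] -[t1 t2] El.
  exfalso; apply: (@order_absurd l e (R1 ++ u :: M') p R2 t1 ej t2 ek (s2 ++ [:: e])) => //.
  - by rewrite ER -catA.
  - by rewrite El; list_assoc.
  - by rewrite Ep.
have pp : priv (next c (anchor ek)) p.
  apply/negPn/negP=> /(remainder_other dl eel pR)[e'' e''l [h /eqP]]; apply; exact: ph.
have pk := tail_notin dl eel ekl ee pT; have u'k := tail_notin dl eel ekl ee u'T.
have pc := remainder_c dl eel pR.
case/hasP: hu' => y yB u'y.
have thin x : x \in block ek -> x = y /\ 1 < size (block ek).
  move=> xB; apply: (insert_thin ok_ pc pk) => //; rewrite ?Ep //.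
  apply: (priv_clique (succ_anchor ok_)) pp (good_block ok_ xB) _.
  by apply: contraNneq pk => ->; rewrite mem_cat xB.
have := block_uniq ok_; case: (thin y yB) => _.
case EB : (block ek) => [|x1 [|x2 s]] //= _.
have -> : x1 = y by apply: (thin _ _).1; rewrite EB mem_head.
have -> : x2 = y by apply: (thin _ _).1; rewrite EB !inE eqxx orbT.
by rewrite mem_head.
Qed.

(** One vertex [x] that meets every edge between [U] and the block: the only member of [U], or the
    only block vertex seen by the two members of [U]. *)
Definition blocked ek x (U : seq G) := [/\ U = [:: x], x \in c & x \notin block ek] \/
  [/\ x \in block ek, size U = 2, 1 < size (block ek) &
      forall u y, u \in U -> y \in block ek -> adj u y -> y = x].

(** By [second_hit] at most two vertices of the tail see the block, and two such are consecutive;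
    [insert_thin] then gives them one common neighbour. *)
Lemma chain_hits l e ek : decomposition (l ++ [:: e]) -> ek \in l -> exists x U,
  (forall u, u \in tail e -> hit u ek -> u \in U) /\ blocked ek x U.
Proof.
move=> dl ekl0; have [s1 [s2 El]] : exists s1 s2, l = s1 ++ ek :: s2.
  by case/splitPr: ekl0 => s1 s2; exists s1, s2.
have eel : e \in l ++ [:: e] by rewrite mem_cat mem_head orbT.
have ekl : ek \in l ++ [:: e] by rewrite mem_cat ekl0.
have oe := dl.2 _ eel; have ok_ := dl.2 _ ekl.
have ee : e != ek.
  have := chains_uniq dl; rewrite cat_uniq => /and3P[_ + _]; rewrite /= orbF.
  by apply: contraNneq => ->.
have TB u : u \in tail e -> u \notin block ek.
  by move/(tail_notin dl eel ekl ee); rewrite mem_cat => /norP[].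
have TC := tail_c dl eel.
have [hT|hT] := boolP (has (hit^~ ek) (tail e)); last first.
  have zT : next c (last (anchor e) (block e ++ remainder e)) \in tail e by rewrite mem_cat mem_head orbT.
  exists (next c (last (anchor e) (block e ++ remainder e))), [:: next c (last (anchor e) (block e ++ remainder e))].
  by split; [move=> u /(hasPn hT)/negP|left; rewrite TB // TC].
have [R1 [u [S [ET hu nR1]]]] := has_split hT.
have uT : u \in tail e by rewrite ET mem_cat mem_head orbT.
have [hS|hS] := boolP (has (hit^~ ek) S); last first.
  exists u, [:: u]; split; last by left; rewrite TB // TC.
  move=> w; rewrite ET mem_cat inE => /or3P[/(hasPn nR1)/negP//|/eqP->|/(hasPn hS)/negP//].
  by rewrite mem_head.
have [M [u' [S' [ES hu' _]]]] := has_split hS; rewrite ES in ET.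
have EM := second_hit dl El ET hu hu'; rewrite EM /= in ET.
have [Eu [R2 ER]] := next_tail oe ET.
have u'T : u' \in tail e by rewrite ET mem_cat !inE eqxx !orbT.
have uR : u \in remainder e by rewrite ER mem_cat mem_head orbT.
have uc := remainder_c dl eel uR.
have uk := tail_notin dl eel ekl ee uT; have u'k := tail_notin dl eel ekl ee u'T.
case/hasP: (hu) => x xB ux; case/hasP: (hu') => y yB u'y.
have thin x1 y1 : x1 \in block ek -> y1 \in block ek -> adj u x1 -> adj u' y1 ->
    x1 = y1 /\ 1 < size (block ek).
  by move=> x1B y1B ux1 uy1; apply: (insert_thin ok_ uc uk); rewrite ?Eu.
exists x, [:: u; u']; split.
  move=> w; rewrite ET mem_cat !inE => /or4P[/(hasPn nR1)/negP//|->//|->|wS] //; rewrite ?orbT //.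
  move=> hw; case/splitPr: wS ET => S1 S2 ET.
  by have := @second_hit l e s1 ek s2 R1 u (u' :: S1) w S2 dl El ET hu hw.
right; split=> //; first by case: (thin x y).
have xy := (thin x y xB yB ux u'y).1.
move=> w z; rewrite !inE => /orP[]/eqP-> zB wz.
  by rewrite xy; apply: (thin z y _ _ _ _).1.
by apply/esym; apply: (thin x z _ _ _ _).1.
Qed.

(** As [e] comes last in the list, seeing its own block right after another one would contradict
    [order_absurd]. *)
Lemma rest_hit l e R1 t R2 ei : decomposition (l ++ [:: e]) -> remainder e = R1 ++ t :: R2 -> ei \in l ->
  hit t ei -> forall p, p \in R2 -> exists2 ej, ej \in l & hit p ej.
Proof.
move=> dl; elim: R2 R1 t ei => // p R2 IH R1 t ei ER eil hi.
have eel : e \in l ++ [:: e] by rewrite mem_cat mem_head orbT.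
have Ep : next c t = p by apply: next_remainder ER; apply: dl.2.
have pR : p \in remainder e by rewrite ER mem_cat !inE eqxx !orbT.
have [e' e'l he'] : exists2 ej, ej \in l & hit p ej.
  have [e' + he'] := remainder_hit dl eel pR.
  rewrite mem_cat inE => /orP[e'l|/eqP Ee]; first by exists e'.
  exfalso; case/splitPr: eil dl {eel pR IH} => p1 p2 dl.
  apply: (@order_absurd _ e R1 t (p :: R2) p1 ei p2 e [::] dl ER) => //.
    by rewrite -catA.
  by rewrite Ep -Ee.
move=> p'; rewrite inE => /predU1P[->|p'R]; first by exists e'.
by apply: (IH (R1 ++ [:: t]) p e') => //; rewrite ER -catA.
Qed.

Lemma tail_hit l e T rest : decomposition (l ++ [:: e]) -> remainder e = T ++ rest ->
  rest = [::] \/ ~~ priv (next c (anchor e)) (next c (last (anchor e) (block e ++ T))) ->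
  forall p, p \in rest -> exists2 ej, ej \in l & hit p ej.
Proof.
move=> dl ER [->//|]; case: rest ER => // v rest ER np.
have eel : e \in l ++ [:: e] by rewrite mem_cat mem_head orbT.
have oe := dl.2 _ eel.
have Ev : next c (last (anchor e) (block e ++ T)) = v.
  have [n [S E]] := good_rot oe.
  by apply: (@next_segment n [::] (anchor e) (block e ++ T) [::] v (rest ++ S)); rewrite E /chain_seq ER /= -!catA.
have vR : v \in remainder e by rewrite ER mem_cat mem_head orbT.
rewrite Ev in np; have [e'' + [h ne]] := remainder_other dl eel vR np.
rewrite mem_cat inE (negPf ne) orbF => e''l.
move=> p; rewrite inE => /predU1P[->|pR]; first by exists e''.
exact: rest_hit dl ER e''l h _ pR.
Qed.

(** Any later vertex follows either the vertex of [T], whose successor sees nothing of the block by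
    construction, or a vertex that sees another block, against [order_absurd]. *)
Lemma own_hits l e u : decomposition (l ++ [:: e]) -> u \in tail e -> hit u e ->
  u = next c (last (anchor e) (block e)).
Proof.
move=> dl uT hu; have eel : e \in l ++ [:: e] by rewrite mem_cat mem_head orbT.
have oe := dl.2 _ eel; have [T [rest [ER TP _ TV TT]]] := good_split oe.
case/splitPr ET : (tail e) / uT => [R1 S].
case: (lastP R1) ET => [|R1' p] ET.
  have [n [S' E]] := good_rot oe; case ER' : (remainder e) => [|r R].
    by move: ET; rewrite /tail ER' /= cats0 => -[->].
  move: ET; rewrite /tail ER' => -[<- _]; apply/esym.
  by apply: (@next_segment n [::] (anchor e) (block e) [::] r (R ++ S')); rewrite E /chain_seq ER' /= -catA.
rewrite cat_rcons in ET; have [Ep [R2 ER2]] := next_tail oe ET.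
have pR : p \in remainder e by rewrite ER2 mem_cat mem_head orbT.
move: (pR); rewrite ER mem_cat => /orP[pT|pr].
  case: TT => [[E _]|[q [E nq]]]; first by rewrite E in pT.
  move: pT; rewrite E inE => /eqP Epq; case/hasP: hu => y yB; rewrite adj_sym -Ep Epq.
  by rewrite (negPf (nq y yB)).
have [ei eil hi] := tail_hit dl ER TV pr.
exfalso; case/splitPr: eil dl {eel} => p1 p2 dl.
apply: (@order_absurd _ e R1' p R2 p1 ei p2 e [::] dl ER2) => //; last by rewrite Ep.
by rewrite -catA.
Qed.

(** * Separating a block by one vertex per chain *)

Definition tip (e : chain) := last (anchor e) (block e ++ remainder e).

Lemma tip_tail e : next c (tip e) \in tail e.
Proof. by rewrite mem_cat mem_head orbT. Qed.

Lemma block_two e y : good e -> 1 < size (block e) -> exists2 x, x \in block e & x != y.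
Proof.
move=> /block_uniq; case: (block e) => [|x1 [|x2 s]] //=; rewrite inE negb_or => /andP[/andP[xx _] _] _.
have [E|ne] := eqVneq x1 y; last by exists x1; rewrite ?mem_head.
by exists x2; rewrite ?inE ?eqxx ?orbT // -E eq_sym.
Qed.

Lemma block_last e : good e -> last (anchor e) (block e) \in block e.
Proof. by move/good_succ; case: (block e) => // x s _; rewrite /= mem_last. Qed.

Lemma blocked_any l e ek : decomposition l -> e \in l -> ek \in l -> exists x U,
  (forall u, u \in tail e -> hit u ek -> u \in U) /\ blocked ek x U.
Proof.
move=> dl el ekl; have [l' dl' ekl'] : exists2 l', decomposition (l' ++ [:: e]) & ek \in l' ++ [:: e].
  case/splitPr: el dl ekl => l1 l2 dl ekl.
  exists (l2 ++ l1); first by rewrite -catA; apply: decomposition_catC; rewrite -catA.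
  by move: ekl; rewrite !mem_cat !inE -!orbA orbCA => /or3P[]->; rewrite ?orbT.
move: ekl'; rewrite mem_cat inE => /orP[ekl'|/eqP Eek]; first exact: chain_hits dl' ekl'.
subst ek; have eel : e \in l' ++ [:: e] by rewrite mem_cat mem_head orbT.
have oe := dl'.2 _ eel; set x := next c (last (anchor e) (block e)).
exists x, [:: x]; split; first by move=> u uT hu; rewrite inE (own_hits dl' uT hu).
left; split=> //.
  have: last (anchor e) (block e) \in c.
    by case: (privP (good_block oe (block_last oe))).
  by rewrite mem_next.
have [n [S E]] := good_rot oe; case ER : (remainder e) => [|r R].
  by have := good_end oe; rewrite ER cats0 -/x => xA; apply/negP=> /(block_A oe); rewrite xA.
have -> : x = r.
  by apply: (@next_segment n [::] (anchor e) (block e) [::] r (R ++ S)); rewrite E /chain_seq ER /= -catA.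
by apply: (remainder_block dl' eel eel); rewrite ER mem_head.
Qed.

Lemma next_tip e l m : decomposition (e :: l ++ [:: m]) -> next c (tip m) = anchor e.
Proof.
case=> [[n E] _]; move: E; rewrite chains_seq_cons chains_seq_cat chains_seq1 /chain_seq => E.
have := @next_last _ _ Lc n (anchor e) ((block e ++ remainder e) ++ chains_seq l ++ anchor m :: block m ++ remainder m).
by rewrite !last_cat /=; apply; rewrite E; list_assoc.
Qed.

Lemma next_tip_ex l e : decomposition l -> e \in l -> exists2 e', e' \in l & anchor e = next c (tip e').
Proof.
move=> dl el; have [i l' El] := rot_to el; have := decomposition_rot i dl; rewrite El.
case: (lastP l') El => [|s m] El dl'.
  exists e => //; have [[n E] _] := dl'; rewrite chains_seq1 in E.
  by apply/esym; apply: (@next_last _ _ Lc n (anchor e) (block e ++ remainder e)).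
rewrite -cats1 in El dl'; exists m; last by rewrite (next_tip dl').
by rewrite -(mem_rot i) El inE mem_cat mem_head !orbT.
Qed.

Lemma choose_seq (T S : eqType) (Q : T -> S -> Prop) (es : seq T) :
  (forall e, e \in es -> exists p, Q e p) -> exists ps, [/\ size ps = size es,
    forall p, p \in ps -> exists2 e, e \in es & Q e p &
    forall e, e \in es -> exists2 p, p \in ps & Q e p].
Proof.
elim: es => [|e es IH] h; first by exists [::].
have [p Qp] := h e (mem_head _ _).
have [|ps [sp h1 h2]] := IH; first by move=> e' e's; apply: h; rewrite inE e's orbT.
exists (p :: ps); split=> /=; first by rewrite sp.
  move=> p'; rewrite inE => /predU1P[->|/h1[e' e's Q']]; first by exists e; rewrite ?mem_head.
  by exists e'; rewrite // inE e's orbT.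
move=> e'; rewrite inE => /predU1P[->|/h2[p' p's Q']]; first by exists p; rewrite ?mem_head.
by exists p'; rewrite // inE p's orbT.
Qed.

Lemma sum_weights (T : eqType) (f g : T -> nat) (h : pred T) (ps : seq T) :
  (forall p, p \in ps -> f p + g p + 2 * h p <= 2) ->
  sumn (map f ps) + sumn (map g ps) + 2 * count h ps <= 2 * size ps.
Proof.
elim: ps => //= p ps IH w; have := w p (mem_head _ _).
have := IH (fun q qs => w q (ltac:(by rewrite inE qs orbT))).
by move: (sumn _) (sumn _) (count _ _) => x y z; clear; lia.
Qed.

(* Picking one vertex x per chain gives a set of k - 2 vertices that separates the block
   from H, unless it swallows the block; then two block vertices have degree sum below 2 k. *)
Lemma separated_entry ek (P : seq (G * seq G)) : good ek -> size P <= k.-2 ->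
  (forall p, p \in P -> blocked ek p.1 p.2) ->
  (forall y z, y \in block ek -> adj y z -> z \in block ek \/ exists2 p, p \in P & z \in p.2) ->
  False.
Proof.
move=> oe sP bP nP.
pose Sg := [set x in map fst P].
have cSg : #|Sg| <= k.-2.
  by apply: leq_trans sP; rewrite cardsE (leq_trans (card_size _)) ?size_map.
have inSg p : p \in P -> p.1 \in Sg by move=> pP; rewrite inE map_f.
have [/allP/= sub|] := boolP (all [in Sg] (block ek)); last first.
  case/allPn=> y yB yS; have /card_gt0P[h hH] : 0 < #|H| by apply: ltnW.
  have: k.-1 <= #|Sg|.
    apply: (@separator_card _ _ Sg [set z in block ek | z \notin Sg] y h hconn) => //.
    - move=> u v; rewrite !inE => /andP[uB uS] uv.
      case: (nP u v uB uv) => [vB|[p pP vp]]; first by rewrite vB /=; case: (_ \in _).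
      case: (bP p pP) => [[Ep _ _]|[_ _ _ thin]].
        by move: vp; rewrite Ep inE => /eqP->; have := inSg p pP; rewrite inE => ->; rewrite orbT.
      move: uS; rewrite (thin v u vp uB _) 1?adj_sym //.
      by have := inSg p pP; rewrite inE => ->.
    - by rewrite inE yB.
    - rewrite inE negb_and; apply/orP; left; apply: contraTN hH => hB.
      by rewrite HE negbK; case: (privP (good_block oe hB)).
    - apply: contraTN hH; rewrite HE negbK inE => /mapP[p pP ->].
      by case: (bP p pP) => [[]//|[xB _ _ _]]; case: (privP (good_block oe xB)).
  by move: hk cSg; move: #|_| => x; clear; lia.
have y0B := good_succ oe; have: next c (anchor ek) \in Sg by apply: sub.
rewrite inE => /mapP[p0 p0P Ep0]; have s1 : 1 < size (block ek).
  by case: (bP p0 p0P) => [[_ _]|[]//]; rewrite -Ep0 y0B.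
set y := next c (anchor ek) in y0B; have [y' y'B yy] := block_two y oe s1.
have UB := block_uniq oe.
have dg z : z \in block ek ->
    k <= (size (block ek)).-1 + sumn [seq count (adj z) p.2 | p <- P].
  move=> zB; apply: leq_trans hdeg (leq_trans (min_deg_le z) _); rewrite /deg.
  have -> : (size (block ek)).-1 + sumn [seq count (adj z) p.2 | p <- P] =
      size (rem z (block ek) ++ flatten [seq [seq w <- p.2 | adj z w] | p <- P]).
    rewrite size_cat size_rem // size_flatten /shape -map_comp; congr (_ + sumn _).
    by apply: eq_map => p; rewrite /= size_filter.
  apply: leq_trans (card_size _); apply/subset_leq_card/subsetP=> w; rewrite inE => zw.
  rewrite mem_cat mem_rem_uniq // inE.
  case: (nP z w zB zw) => [wB|[p pP wp]].
    by rewrite wB eq_sym (adj_neq zw).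
  apply/orP; right; apply/flatten_mapP; exists p => //; by rewrite mem_filter zw.
(* [h] marks the picks that are block vertices other than [y] and [y']; their tail vertices see
   neither. All of the block is picked, so at least [size (block ek) - 2] picks are marked, and the
   degrees of [y] and [y'] add up to at most [2 * size P + 2 <= 2 * k - 2]. *)
pose h (p : G * seq G) := [&& p.1 \in block ek, p.1 != y & p.1 != y'].
have cnt : size (block ek) - 2 <= count h P.
  rewrite -size_filter -(size_map fst).
  have -> : size (block ek) - 2 = size (rem y' (rem y (block ek))).
    rewrite !size_rem ?subn2 // mem_rem_uniq // inE y'B andbT; exact: yy.
  apply: uniq_leq_size => [|w]; first by rewrite !rem_uniq.
  rewrite mem_rem_uniq ?rem_uniq // inE mem_rem_uniq // inE => /and3P[wy' wy wB].
  have := sub w wB; rewrite inE => /mapP[p pP Ew]; apply/mapP; exists p => //.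
  by rewrite mem_filter pP /h -Ew wB wy wy'.
have := @sum_weights _ (fun p => count (adj y) p.2) (fun p => count (adj y') p.2) h P.
have: forall p, p \in P -> count (adj y) p.2 + count (adj y') p.2 + 2 * h p <= 2.
  move=> p pP; case: (bP p pP) => [[-> _ pB]|[pB p2 _ thin]].
    rewrite /h (negPf pB) /=; move: (adj _ _) (adj _ _) => [] []; by [].
  have cz z : z \in block ek -> z != p.1 -> count (adj z) p.2 = 0.
    move=> zB zp; apply/eqP; rewrite -leqn0 leqNgt -has_count; apply/hasPn=> u up.
    by apply: contra zp => zu; apply/eqP; apply: (thin u) => //; rewrite adj_sym.
  have c2' z : count (adj z) p.2 <= 2 by rewrite -p2 count_size.
  have [E|ny] := eqVneq p.1 y.
    rewrite (cz y') ?E // /h E eqxx andbF /= addn0 addn0; exact: c2'.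
  rewrite (cz y) 1?eq_sym //; have [E|ny'] := eqVneq p.1 y'.
    rewrite /h E eqxx !andbF /= addn0; exact: c2'.
  rewrite (cz y') 1?eq_sym // /h pB ny ny' //.
move=> /[swap] /[apply].
have := dg y y0B; have := dg y' y'B; move: cnt s1 sP hk.
move: (sumn _) (sumn _) (count h P) (size P) (size (block ek)) => v1 v2 v3 v4 v5; clear; lia.
Qed.

(** If both fail, nothing in the tail of [m] sees the block of [ek]. The other [k - 2] chains then
    supply all the picks, as [separated_entry] requires. *)
Lemma dichotomy ej ek s m : decomposition (ej :: ek :: s ++ [:: m]) -> (size s).+3 = k.-1 ->
  hit (anchor ej) ek \/ hit (tip m) ek.
Proof.
move=> dl sz; have [|na] := boolP (hit (anchor ej) ek); first by left.
have [|nb] := boolP (hit (tip m) ek); first by right.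
exfalso; set l := _ :: _ in dl.
have El : l = (ej :: ek :: s) ++ [:: m] by [].
have ml : m \in l by rewrite El mem_cat mem_head orbT.
have jl : ej \in l by rewrite mem_head.
have kl : ek \in l by rewrite !inE eqxx orbT.
have Ul := chains_uniq dl.
have mj : m != ej.
  by move: Ul => /= /andP[+ _]; apply: contraNneq => <-; rewrite inE mem_cat mem_head !orbT.
have om := dl.2 _ ml; have oj := dl.2 _ jl; have okk := dl.2 _ kl.
have Eb : next c (tip m) = anchor ej by apply: (@next_tip ej (ek :: s)).
have mh u : u \in tail m -> ~~ hit u ek.
  move=> uT; apply/negP=> hu; case/tail_mem: (uT) => [uR|Eu]; last first.
    by move: na; rewrite -Eb /tip -Eu hu.
  case/splitPr ER : (remainder m) / uR => [R1 R2].
  case: (lastP R2) ER => [|R2' b] ER.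
    by move: nb; rewrite /tip ER !last_cat /= hu.
  have Ebl : tip m = b by rewrite /tip ER !last_cat /= last_rcons.
  have bR : b \in remainder m by rewrite ER mem_cat inE mem_rcons mem_head !orbT.
  (* After [u] sees the block of [ek], the tip can see only the blocks of [ej] and [ek], and [ek] is
     excluded. Being private to [ej], the tip sees that whole block, and [insert_thin] at the tip
     and the anchor of [ej] fails. *)
  have pj : priv (next c (anchor ej)) b.
    apply/negPn/negP=> /(remainder_other dl ml bR)[e'' e''l [h ne]].
    have : e'' \in [:: ej; ek].
      rewrite El in dl e''l; apply: (after_hits (P := [:: ej; ek]) (Q := s) dl _ ER (ei := ek) _ hu _ e''l h) => //.
        by rewrite !inE eqxx orbT.
      by rewrite mem_rcons mem_head.
    rewrite !inE (negPf ne) /= => /eqP E; move: nb; rewrite Ebl -E h //.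
  have bT : b \in tail m by rewrite mem_cat bR.
  have zT : anchor ej \in tail m by rewrite -Eb tip_tail.
  have bj := tail_notin dl ml jl mj bT; have zj := tail_notin dl ml jl mj zT.
  have thin x : x \in block ej -> x = next c (anchor ej) /\ 1 < size (block ej).
    move=> xB; apply: (insert_thin oj (remainder_c dl ml bR) bj _ xB (good_succ oj)); rewrite -Ebl ?Eb //.
      rewrite Ebl; apply: (priv_clique (succ_anchor oj)) pj (good_block oj xB) _.
      by apply: contraNneq bj => ->; rewrite mem_cat xB.
    by apply: next_cycle cc _; apply: Ac; apply: good_A.
  have [x xB /eqP] := block_two (next c (anchor ej)) oj (thin _ (good_succ oj)).2.
  by apply; apply: (thin x xB).1.
pose Q e (p : G * seq G) := (forall u, u \in tail e -> hit u ek -> u \in p.2) /\ blocked ek p.1 p.2.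
have [|P [sP PQ QP]] := @choose_seq _ _ Q (ej :: ek :: s).
  move=> e es; have el : e \in l by rewrite El mem_cat es.
  by have [x [U [h1 h2]]] := blocked_any dl el kl; exists (x, U).
have TlP e z : e \in l -> z \in tail e -> hit z ek -> exists2 p, p \in P & z \in p.2.
  rewrite El mem_cat mem_seq1 => /orP[/QP[p pP [h _]]|/eqP->] zT hz; first by exists p => //; apply: h.
  by move: (mh z zT); rewrite hz.
apply: (@separated_entry ek P okk).
- by rewrite sP /= -sz.
- by move=> p /PQ[e _ []].
move=> y z yB yz; have hz : hit z ek by apply/hasP; exists y; rewrite // adj_sym.
have [zH|] := boolP (z \in H).
  have zy : adj z y by rewrite adj_sym.
  have [yc yA] := privP (good_block okk yB).
  by case: (H_nbr zH zy); rewrite ?HE ?yc // (negPf yA).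
rewrite HE negbK (decomposition_mem _ dl) => /mem_chains_seq[e el].
rewrite inE mem_cat => /or3P[/eqP Ez|zB|zR]; last 1 first.
- by right; apply: (TlP e); rewrite // mem_cat zR.
- have [e' e'l E'] := next_tip_ex dl el; right; apply: (TlP e') => //.
  by rewrite Ez E' tip_tail.
left; have [Ee|ne] := eqVneq e ek; first by rewrite -Ee.
exfalso; have [i l' El'] := rot_to kl; have := decomposition_rot i dl; rewrite El' => dl'.
have el' : e \in l'.
  by have : e \in ek :: l'; [rewrite -El' mem_rot|rewrite inE (negPf ne)].
by move: (chains_nonadj dl' el' yB zB); rewrite yz.
Qed.

(** * Jumps from the end of one chain to the block of another *)

Lemma tip_remainder e l e' : decomposition (e :: l) -> e' \in l -> hit (tip e') e -> remainder e' != [::].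
Proof.
move=> dl e'l; have na := chains_nonadj dl e'l.
have lB e0 : good e0 -> remainder e0 = [::] -> tip e0 \in block e0.
  move=> oe0 E; rewrite /tip E cats0; have := good_succ oe0.
  by case: (block e0) => // x s _; rewrite /= mem_last.
have oe' : good e' by apply: dl.2; rewrite inE e'l orbT.
move=> /hasP[y yB ad]; apply/eqP=> E.
by move: (na _ _ yB (lB _ oe' E)); rewrite adj_sym ad.
Qed.

Lemma chain_seq_last e : exists Z, chain_seq e = Z ++ [:: tip e].
Proof. by exists (belast (anchor e) (block e ++ remainder e)); rewrite /chain_seq lastI cats1. Qed.

Lemma remainder_last e : remainder e != [::] -> exists Z, remainder e = Z ++ [:: tip e].
Proof.
rewrite /tip; case: (lastP (remainder e)) => // Z t _.
by exists Z; rewrite last_cat last_rcons cats1.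
Qed.

Lemma detour ej s2 e s1 : decomposition (ej :: s2 ++ e :: s1) -> hit (tip e) ej ->
  hit (anchor ej) (head e s2) -> False.
Proof.
move=> dl hb ha; have [[n E] okl] := dl; move: E.
rewrite chains_seq_cons chains_seq_cat chains_seq_cons => E.
have oj := okl ej (mem_head _ _).
have oe : good e by apply: okl; rewrite inE mem_cat mem_head !orbT.
have hS : head (anchor ej) (chains_seq s1) \in A.
  case: s1 dl E okl => [|e1 s1] dl E okl /=; first exact: good_A.
  by apply: good_A; apply: okl; rewrite inE mem_cat !inE eqxx !orbT.
case: s2 dl E okl ha => [|ek s2] dl E okl /= ha.
  have /remainder_last[Z EZ] := tip_remainder dl (mem_head _ _) hb.
  apply: (@detour_absurd n _ _ (remainder ej) _ _ Z (tip e) (chains_seq s1) _ (good_entry oj) (good_entry oe) hS hb ha).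
  by rewrite E /chain_seq -EZ; list_assoc.
have [Z EZ] := chain_seq_last e.
have ok_ : good ek by apply: okl; rewrite !inE eqxx orbT.
apply: (@detour_absurd n _ _ (remainder ej) _ _ (remainder ek ++ chains_seq s2 ++ Z) (tip e) (chains_seq s1) _ (good_entry oj) (good_entry ok_) hS hb ha).
by rewrite E EZ chains_seq_cons /chain_seq; list_assoc.
Qed.

(** A jump into the block of [ej] excludes the first alternative of [dichotomy] by [detour]. What
    remains is a jump into the next block from the tip just before [ej]. *)
Lemma jump_step ej ek s m e : decomposition (ej :: ek :: s ++ [:: m]) -> (size s).+3 = k.-1 ->
  e \in ek :: s ++ [:: m] -> hit (tip e) ej -> hit (tip m) ek.
Proof.
move=> dl sz el hb; case: (dichotomy dl sz) => // ha; exfalso.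
case/splitPr EL : (ek :: s ++ [:: m]) / el => [s2 s1].
have Ek : ek = head e s2 by case: s2 EL => [[]|? ? []].
apply: (@detour ej s2 e s1 _ hb); last by rewrite -Ek.
by rewrite -EL.
Qed.

(** Two uses of [jump_step], the second after rotating by one chain, give the pair of jumps that
    [skip_absurd] forbids. This needs three chains, hence [4 <= k]. *)
Lemma jump_absurd l e ej : decomposition l -> size l = k.-1 -> e \in l -> ej \in l -> e != ej ->
  hit (tip e) ej -> False.
Proof.
move=> dl sz el jl ne hb; have [i l' El] := rot_to jl.
have dl' := decomposition_rot i dl; rewrite El in dl'.
have sz' : (size l').+1 = k.-1 by rewrite -sz -(size_rot i l) El.
have el' : e \in l' by have : e \in ej :: l'; [rewrite -El mem_rot|rewrite inE (negPf ne)].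
case: l' dl' sz' el' {El} => [|ek [|el0 s]] dl' sz' el'.
- by [].
- by move: hk sz'; clear => /=; lia.
have [m [s' Es]] : exists m s', el0 :: s = s' ++ [:: m].
  by exists (last el0 s), (belast el0 s); rewrite cats1 -lastI.
have Em : last el0 s = m by have := congr1 (last m) Es; rewrite last_cat.
have sz1 : (size s').+3 = k.-1.
  by have := congr1 size Es; rewrite size_cat /= addn1 => <-; move: sz' => /= <-.
have hm : hit (tip m) ek.
  by apply: (@jump_step ej ek s' m e) => //; rewrite -Es.
have dl2 : decomposition (ek :: el0 :: s ++ [:: ej]).
  by have := @decomposition_catC [:: ej] (ek :: el0 :: s) dl'.
have hj : hit (tip ej) el0.
  apply: (@jump_step ek el0 s ej m) => //.
  by rewrite -Em inE mem_cat inE; have := mem_last el0 s; rewrite inE => /orP[->|->]; rewrite ?orbT.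
have oj : good ej by apply: dl'.2; rewrite mem_head.
have okk : good ek by apply: dl'.2; rewrite !inE eqxx orbT.
have ol : good el0 by apply: dl'.2; rewrite !inE eqxx !orbT.
have [[n E] _] := dl'; rewrite !chains_seq_cons in E.
have [W EW] : exists W, remainder el0 ++ chains_seq s = W ++ [:: tip m].
  case: (lastP s) Em dl2 => [|s3 m'].
    move=> /= Em dl2; subst m; have /remainder_last[Z EZ] := tip_remainder dl2 (mem_head _ _) hm.
    by exists Z; rewrite cats0 -EZ.
  rewrite last_rcons => <- _; have [Z EZ] := chain_seq_last m'.
  by exists (remainder el0 ++ chains_seq s3 ++ Z); rewrite -cats1 chains_seq_cat chains_seq1 EZ -!catA.
apply: (@skip_absurd n (anchor ej) (block ej ++ remainder ej) (anchor ek) (block ek) (remainder ek) (anchor el0) (block el0) W (tip m)) => //.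
- by rewrite E /chain_seq -EW; list_assoc.
- exact: good_A.
- exact: good_entry.
- exact: good_entry.
Qed.

Lemma chains_seq_ends s e : {in s ++ [:: e], forall e', good e'} ->
  exists a Y, [/\ chains_seq (s ++ [:: e]) = a :: Y, a \in A & last a Y = tip e].
Proof.
case: s => [|e1 s] okl.
  by exists (anchor e), (block e ++ remainder e); rewrite chains_seq1; split=> //; apply: good_A (okl _ (mem_head _ _)).
exists (anchor e1), ((block e1 ++ remainder e1) ++ chains_seq s ++ chain_seq e); split.
- by rewrite cat_cons chains_seq_cons chains_seq_cat chains_seq1.
- by apply: good_A; apply: okl; rewrite mem_head.
- by rewrite !last_cat.
Qed.

(** Without a jump every remainder is at most the tip, and chains stripped of their anchors have no
    edges between them. Removing the [k - 1] vertices of [A] would leave at least [k] components,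
    one of them [H]. *)
Lemma jump_exists l : decomposition l -> size l = k.-1 ->
  exists e e', [/\ e \in l, e' \in l, e != e' & hit (tip e) e'].
Proof.
move=> dl sz; have Ul := chains_uniq dl.
have [/hasP[e el /hasP[e' e'l /andP[ne h]]]|no] :=
  boolP (has (fun e => has (fun e' => (e != e') && hit (tip e) e') l) l).
  by exists e, e'.
have {}no e e' : e \in l -> e' \in l -> e != e' -> ~~ hit (tip e) e'.
  move=> el e'l ne; apply/negP=> h; case/hasP: no; exists e => //; apply/hasP; exists e' => //.
  by rewrite ne.
exfalso.
have split_at e : e \in l -> exists l', decomposition (l' ++ [:: e]) /\ l' ++ [:: e] =i l.
  move=> el; case/splitPr: el dl {Ul sz no} => l1 l2 dl; exists (l2 ++ l1); split.
    by rewrite -catA; apply: decomposition_catC; rewrite -catA.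
  by move=> z; rewrite !mem_cat !inE -orbA orbC -orbA orbCA.
have Qe e u : e \in l -> u \in block e ++ remainder e -> u \in block e \/ (u = tip e).
  move=> el; rewrite mem_cat => /orP[|uR]; first by left.
  right; have oe := dl.2 _ el; have [T [rest [ER TP _ TV TT]]] := good_split oe.
  have [l' [dl' El']] := split_at e el.
  case: (lastP rest) ER TV => [|rest' b] ER TV.
    rewrite cats0 in ER; move: uR; rewrite /tip ER last_cat.
    by case: TT => [[-> _]//|[q [-> _]]]; rewrite inE => /eqP.
  have [|ei eil hi] := tail_hit dl' ER TV (p := b); first by rewrite mem_rcons mem_head.
  have Eb : tip e = b by rewrite /tip ER !last_cat last_rcons.
  have eil' : ei \in l by rewrite -El' mem_cat eil.
  have ne : e != ei.
    have := chains_uniq dl'; rewrite cat_uniq => /and3P[_ + _]; rewrite /= orbF.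
    by apply: contraNneq => ->.
  by move: (no e ei el eil' ne); rewrite Eb hi.
have na e e' u w : e \in l -> e' \in l -> e != e' -> u \in block e ++ remainder e ->
    w \in block e' ++ remainder e' -> ~~ adj u w.
  move=> el e'l ne /(Qe _ _ el) hu /(Qe _ _ e'l) hw.
  have [l' [dl' El']] := split_at e' e'l.
  have el' : e \in l'.
    by have : e \in l' ++ [:: e']; [rewrite El'|rewrite mem_cat inE (negPf ne) orbF].
  case: hu hw => [uB|->] [wB|->].
  - rewrite adj_sym; exact: (chains_nonadj (decomposition_catC dl') el').
  - have := no e' e e'l el; rewrite eq_sym ne => /(_ isT)/hasPn/(_ u uB).
    by rewrite adj_sym.
  - exact: (hasPn (no e e' el e'l ne)).
  case/splitPr: el' dl' {El'} => l1 l2 dl'.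
  have [[n E] okl] := dl'.
  have [|a [Y [E1 aA La]]] := @chains_seq_ends l1 e.
    move=> e1 h; apply: okl; move: h; rewrite !mem_cat !inE => /orP[->|->]; by rewrite ?orbT.
  have [|a' [Y' [E2 a'A La']]] := @chains_seq_ends l2 e'.
    move=> e1 h; apply: okl; move: h; rewrite !mem_cat !inE => /orP[->|->]; by rewrite ?orbT.
  rewrite -La -La'; apply: (@preds_nonadj n) => //.
  by rewrite E -E1 -E2 -chains_seq_cat -!catA.
have /card_gt0P[x0 x0H] : 0 < #|H| by apply: ltnW.
have x0c : x0 \notin c by rewrite -HE.
pose J := x0 |: D.
have Dc d : d \in D -> d \in c by case/imsetP=> a /Ac ac ->; rewrite mem_next.
have cJ : #|J| = k.
  rewrite cardsU1; have -> : x0 \notin D by apply: contra x0c => /Dc.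
  rewrite card_imset ?card_A; first by move: hk; clear; lia.
  exact: can_inj (prev_next Uc).
have clH : closed (adj_del A) (mem H).
  by apply: closed_del => u v uH /(H_nbr uH)[vH|vA]; rewrite inE ?vH ?vA ?orbT.
have clQ e : e \in l -> closed (adj_del A) (mem [set u in block e ++ remainder e]).
  move=> el; apply: closed_del => u v; rewrite in_set => uQ uv.
  have oe := dl.2 _ el.
  have [uc uA] : u \in c /\ u \notin A.
    move: uQ; rewrite mem_cat => /orP[/(good_block oe)/privP//|uR].
    by rewrite (remainder_c dl el uR) (good_remainder oe uR).
  rewrite in_setU in_set.
  have [vH|] := boolP (v \in H).
    have vu : adj v u by rewrite adj_sym.
    by case: (H_nbr vH vu); rewrite ?HE ?uc // (negPf uA).
  rewrite HE negbK (decomposition_mem _ dl) => /mem_chains_seq[e' e'l]; rewrite inE => /predU1P[->|vQ].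
    by rewrite (good_A (dl.2 _ e'l)) orbT.
  have [<-|ne] := eqVneq e' e; first by rewrite vQ.
  by move: (na e e' u v el e'l); rewrite eq_sym ne uv => /(_ isT uQ vQ).
have: #|J| <= omega A.
  apply: omega_ge => [z|z z'].
    by case/setU1P=> [->|/D_A//]; apply: contra x0c => /Ac.
  have HD d d' : d \in H -> d' \in D -> connect (adj_del A) d d' -> False.
    move=> dH d'D /(closed_connect clH); rewrite dH => /esym h.
    by have : d' \in H by []; rewrite HE Dc.
  case/setU1P=> [->|zD]; case/setU1P=> [->//|z'D] con.
  - by case: (HD _ _ x0H z'D con).
  - by case: (HD _ _ x0H zD); rewrite connect_del_sym.
  case/imsetP: zD con => a /(A_chain dl)[e el ->] ->.
  case/imsetP: z'D => a' /(A_chain dl)[e' e'l ->] -> con.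
  have := closed_connect (clQ e el) con; rewrite !inE !mem_cat (good_succ (dl.2 _ el)) /= => /esym h.
  have -> // : e = e'.
  apply: (chain_seq_inj (u := next c (anchor e')) dl el e'l); rewrite inE mem_cat ?h ?orbT //.
  by rewrite (good_succ (dl.2 _ e'l)) orbT.
have := htough (S := A).
rewrite cJ card_A; move: hk; move: (omega A) => w; clear => h1 h2 h3.
have /h2 : 1 < w by lia.
lia.
Qed.

(** * Existence of a decomposition *)

Lemma A_split (s : seq G) : exists Q ps, [/\ s = Q ++ flatten [seq p.1 :: p.2 | p <- ps],
  {in Q, forall u, u \notin A} & forall p, p \in ps -> p.1 \in A /\ {in p.2, forall u, u \notin A}].
Proof.
elim: s => [|x s [Q [ps [-> hQ hp]]]]; first by exists [::], [::].
have [xA|xA] := boolP (x \in A).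
  exists [::], ((x, Q) :: ps); split=> // p; rewrite inE => /predU1P[->//|]; exact: hp.
by exists (x :: Q), ps; split=> // u; rewrite inE => /predU1P[->|/hQ].
Qed.

(** The first two vertices after [a] are private to [next c a], so the maximal private run [Bl] has
    at least two vertices. Its last vertex [q] stays in the block exactly when the vertex after it
    sees another vertex of the run. *)
Lemma chain_of m a Q S : rot m c = (a :: Q) ++ S -> a \in A -> {in Q, forall u, u \notin A} ->
  next c (last a Q) \in A -> exists e, good e /\ chain_seq e = a :: Q.
Proof.
move=> E aA QA zA; have dDa : next c a \in D by apply: imset_f.
have [d [f [Q' EQ]]] : exists d f Q', Q = [:: d, f & Q'].
  case: Q E QA zA => [|d [|f Q']] E QA zA; last by exists d, f, Q'.
    by move: (D_A dDa); rewrite zA.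
  have Ed : next c a = d by apply: (@next_segment m [::] a [::] [::] d S); rewrite E.
  by move: (next_D_A dDa); rewrite Ed zA.
have Ed : next c a = d by apply: (@next_segment m [::] a [::] [::] d (f :: Q' ++ S)); rewrite E EQ.
have Ef : next c d = f by apply: (@next_segment m [:: a] d [::] [::] f (Q' ++ S)); rewrite E EQ.
pose p u := ~~ priv d u.
have [Bl [rest [EQ2 BlP restP]]] : exists Bl rest, [/\ Q = Bl ++ rest, {in Bl, forall u, priv d u} &
    rest = [::] \/ ~~ priv d (head a rest)].
  have [/has_split[s1 [x [s2 [-> px h]]]]|h] := boolP (has p Q).
    exists s1, (x :: s2); split=> //; last by right.
    by move=> u /(hasPn h); rewrite negbK.
  exists Q, [::]; rewrite cats0; split=> //; last by left.
  by move=> u /(hasPn h); rewrite negbK.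
rewrite Ed in dDa.
have pd := priv_D dDa; have pf := priv_next dDa; rewrite Ef in pf.
have [B0 [q EBl]] : exists B0 q, Bl = [:: d & B0] ++ [:: q].
  case: Bl EQ2 BlP => [|d' [|f' Bl']].
  - by move=> /= E2 _; case: restP; rewrite -E2 EQ //= pd.
  - by rewrite EQ => -[_ E2] _; case: restP; rewrite -E2 //= pf.
  - by rewrite EQ => -[<- _]; exists (belast f' Bl'), (last f' Bl'); rewrite /= cats1 -lastI.
have UQ : uniq (a :: Q).
  have: uniq (rot m c) by rewrite rot_uniq.
  by rewrite E cat_uniq => /andP[].
have UBl : uniq Bl by move: UQ; rewrite EQ2 cons_uniq cat_uniq => /and3P[].
pose v := next c q.
have lBl : last a Bl = q by rewrite EBl last_cat.
have restV : rest = [::] \/ ~~ priv d (next c (last a Bl)).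
  case: restP => [|h]; first by left.
  case: rest EQ2 h => [|r rest] EQ2 h; first by left.
  right; rewrite (@next_segment m [::] a Bl [::] r (rest ++ S)) //.
  by rewrite E EQ2; list_assoc.
have [/hasP[y yB vy]|nv] := boolP (has (adj v) (d :: B0)).
  exists (a, Bl, rest); split; last by rewrite /chain_seq /anchor /block /remainder /= EQ2.
  have yBl : y \in Bl by rewrite EBl mem_cat yB.
  split; rewrite /chain_seq /anchor /block /remainder /= ?Ed //.
  - by exists m, S; rewrite E EQ2.
  - by rewrite EBl mem_head.
  - by move=> u ur; apply: QA; rewrite EQ2 mem_cat ur orbT.
  - by rewrite -EQ2.
  exists [::], rest; rewrite cats0 lBl; split=> //.
  - by rewrite EBl size_cat /= addn1.
  - by rewrite -lBl.
  left; split=> //; exists y => //; rewrite adj_sym vy andbT.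
  move: UBl; rewrite EBl cat_uniq /= orbF => /and3P[_ + _].
  by apply: contraNneq => <-.
exists (a, d :: B0, q :: rest); split; last by rewrite /chain_seq /anchor /block /remainder /= EQ2 EBl -catA.
have EQ3 : Q = (d :: B0) ++ q :: rest by rewrite EQ2 EBl -catA.
split; rewrite /chain_seq /anchor /block /remainder ?Ed //.
- by exists m, S; rewrite E EQ3.
- by rewrite mem_head.
- by move=> u uB; apply: BlP; rewrite EBl mem_cat uB.
- by move=> u ur; apply: QA; rewrite EQ3 mem_cat ur orbT.
- by move: zA; rewrite EQ3.
exists [:: q], rest; rewrite -EBl; split=> //.
- by move=> u; rewrite inE => /eqP->; apply: BlP; rewrite EBl mem_cat mem_head orbT.
- by rewrite EBl size_cat /= addn1.
right; exists q; split=> // y yB; rewrite adj_sym; exact: (hasPn nv).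
Qed.

Lemma size_decomposition l : decomposition l -> size l = #|A|.
Proof.
move=> dl; have -> : #|A| = count [in A] c.
  rewrite -size_filter -(card_uniqP (filter_uniq _ Uc)); apply: eq_card => u.
  by rewrite mem_filter; have [/Ac->|//] := boolP (u \in A).
have [[n E] okl] := dl.
have -> : count [in A] c = count [in A] (chains_seq l).
  by rewrite -E; apply/permP; rewrite perm_sym perm_rot.
elim: l okl {dl E} => // e l IH okl; rewrite chains_seq_cons count_cat /= -IH; last first.
  by move=> e' h; apply: okl; rewrite inE h orbT.
have oe := okl e (mem_head _ _); rewrite (good_A oe) count_cat.
have z s : {in s, forall u, u \notin A} -> count [in A] s = 0.
  by move=> h; apply/eqP; rewrite -leqn0 leqNgt -has_count; apply/hasPn.
by rewrite !z // => u; [apply: good_remainder|apply: block_A].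
Qed.

Lemma decomposition_exists : exists l, decomposition l.
Proof.
have /card_gt0P[a0 a0A] : 0 < #|A| by rewrite card_A; move: hk; clear; lia.
have [n s En] := rot_to (Ac a0A).
have [Q [ps [Es hQ hps]]] := A_split (a0 :: s).
have EQ : Q = [::].
  by case: Q Es hQ => // x Q [<- _] /(_ a0); rewrite mem_head a0A => /(_ isT).
rewrite EQ /= -En in Es; clear EQ hQ Q En s.
pose f (p : G * seq G) := p.1 :: p.2.
have hp p : p \in ps -> exists e, good e /\ chain_seq e = f p.
  move=> pP; have [pA p2] := hps p pP; case: p pP pA p2 => a Q pP /= aA QA.
  case/splitPr: pP Es hps => p1 p2; rewrite map_cat flatten_cat /= => Es hps.
  have [m Em] := rot_catC Es; rewrite -/(f (a, Q)) /f /= -catA in Em.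
  rewrite -flatten_cat -map_cat in Em.
  apply: (chain_of (m := m) (S := flatten [seq p.1 :: p.2 | p <- p2 ++ p1])) => //.
  case Ep : (p2 ++ p1) Em => [|[b R] p'] /= Em.
    by rewrite cats0 in Em; rewrite (next_last Lc Em).
  rewrite (@next_segment m [::] a Q [::] b (R ++ flatten [seq p.1 :: p.2 | p <- p'])) //=.
  have [] // := hps (b, R).
  rewrite mem_cat inE orbCA; apply/orP; right; rewrite orbC -mem_cat Ep mem_head //.
have [l [El okl]] : exists l, map chain_seq l = map f ps /\ {in l, forall e, good e}.
  elim: (ps) hp => [|p ps' IH] h; first by exists [::].
  have [|l [El okl]] := IH; first by move=> p' p's; apply: h; rewrite inE p's orbT.
  have [e [oe Ee]] := h p (mem_head _ _).
  exists (e :: l); split=> [|e']; first by rewrite /= Ee El.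
  by rewrite inE => /predU1P[->|/okl].
by exists l; split=> //; exists n; rewrite Es /chains_seq El.
Qed.

Theorem chains_absurd : False.
Proof.
have [l dl] := decomposition_exists.
have sz : size l = k.-1 by rewrite (size_decomposition dl) card_A.
have [e [e' [el e'l ne h]]] := jump_exists dl sz.
exact: jump_absurd dl sz el e'l ne h.
Qed.

End Chains.

(** * Components outside a longest cycle *)

Section Component.

Variables (G : sgraph) (k : nat) (c : seq G) (x0 : G).
Hypothesis hk : 4 <= k.
Hypothesis htough : one_tough G.
Hypothesis hconn : k_connected k.-1 G.
Hypothesis hfree : free_of (P2_kP1 k) G.
Hypothesis hdeg : k <= min_deg G.
Hypothesis Lc : longest c.
Hypothesis x0c : x0 \notin c.
Hypothesis noiso : forall v, v \notin c -> exists2 w, w \notin c & adj v w.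

Let Uc : uniq c. Proof. by case: Lc. Qed.
Let c2 : 2 < size c. Proof. by case: Lc. Qed.
Let cc : cycle (@adj G) c. Proof. by case: Lc. Qed.

Let C := [set x in c].
Let H := [set y | connect (adj_del C) x0 y].
Let A := [set a | (a \in c) && [exists y in H, adj a y]].
Let D := [set next c a | a in A].

Let Ac a : a \in A -> a \in c. Proof. by rewrite inE => /andP[]. Qed.

Lemma x0H : x0 \in H. Proof. by rewrite inE connect0. Qed.

Lemma H_c y : y \in H -> y \notin c.
Proof.
rewrite inE => /connectP[p pp ->]; have [|_ /(_ (last x0 p))] := path_del pp.
  by rewrite inE.
by rewrite mem_last inE; apply.
Qed.

Lemma H_step y z : y \in H -> adj y z -> z \notin c -> z \in H.
Proof.
move=> yH yz zc; have yc := H_c yH; move: yH; rewrite !inE => con.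
by apply: connect_trans con (connect1 _); rewrite /adj_del /= !inE yc zc.
Qed.

Lemma H_nbr y z : y \in H -> adj y z -> z \in H \/ z \in A.
Proof.
move=> yH yz; have [zc|zc] := boolP (z \in c); last by left; apply: H_step yz zc.
by right; rewrite inE zc; apply/exists_inP; exists y => //; rewrite adj_sym.
Qed.

Lemma H_nadj y z : y \in H -> z \notin H -> z \notin A -> ~~ adj y z.
Proof. by move=> yH zH zA; apply/negP=> /(H_nbr yH)[]; apply/negP. Qed.

Lemma A_H a : a \in A -> exists2 y, y \in H & adj a y.
Proof. by rewrite inE => /andP[_ /exists_inP]. Qed.

Lemma A_nH a : a \in A -> a \notin H.
Proof. by move/Ac=> ac; apply: contraTN ac => /H_c. Qed.

Lemma H_walk x y : x \in H -> y \in H ->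
  exists s, [/\ walk x y s, uniq s & forall z, z \in s -> z \in H].
Proof.
move=> xH yH; have: connect (adj_del C) x y.
  have := xH; have := yH; rewrite !inE => h1 h2; apply: connect_trans h1.
  by rewrite connect_del_sym.
case/connectP=> p0 pp0 E0; case: (shortenP pp0) E0 => p pp U _ E.
have xC : x \notin C by rewrite inE H_c.
have [pp' np] := path_del pp xC.
exists (x :: p); split=> // [|z]; first by rewrite /walk eqxx pp' E eqxx.
move=> zp; have con : connect (adj_del C) x z.
  by case/splitPl: zp pp => p1 p2 lz; rewrite cat_path => /andP[pp1 _]; apply/connectP; exists p1.
by move: xH; rewrite !inE => h; apply: connect_trans h con.
Qed.

Lemma join a a' : a \in A -> a' \in A -> a != a' ->
  exists s x y, [/\ walk x y s, adj a x, adj y a', uniq s & forall z, z \in s -> z \notin c].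
Proof.
move=> /A_H[x xH ax] /A_H[y yH ay] _; have [s [W U sH]] := H_walk xH yH.
exists s, x, y; split=> //; first by rewrite adj_sym.
by move=> z /sH/H_c.
Qed.

Lemma D_A d : d \in D -> d \notin A. Proof. exact: (attach_disjoint Lc Ac join). Qed.
Lemma D_stable : stable D. Proof. exact: (attach_stable Lc Ac join). Qed.
Lemma D_c d : d \in D -> d \in c. Proof. exact: (attach_c Ac). Qed.
Lemma D_nH d : d \in D -> d \notin H.
Proof. by move/D_c=> dc; apply: contraTN dc => /H_c. Qed.
Lemma card_D : #|D| = #|A|. Proof. exact: (card_attach Lc). Qed.

Lemma H_edge : exists2 x1, x1 \in H & adj x0 x1.
Proof. by have [w wc x0w] := noiso x0c; exists w => //; apply: H_step x0H x0w wc. Qed.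

Lemma stable_off J : stable J -> (forall z, z \in J -> z \notin H /\ z \notin A) -> #|J| < k.
Proof.
move=> sJ JH; have [x1 x1H x01] := H_edge; apply: (free_stable hfree x01 sJ) => z /JH[zH zA].
by split; apply: H_nadj; rewrite ?x0H.
Qed.

(** [D] is stable and far from an edge of [H], which gives the upper bound; [A] separates [H] from
    the rest of the cycle, which gives the lower one. *)
Lemma card_A : #|A| = k.-1.
Proof.
apply/eqP; rewrite eqn_leq; apply/andP; split.
  suff: #|D| < k by rewrite card_D; case: (k) hk.
  by apply: stable_off D_stable _ => z zD; rewrite D_nH // D_A.
have [y yc yA] : exists2 y, y \in c & y \notin A.
  have [A0|[a aA]] := set_0Vmem A.
    case: c c2 => // y s _; exists y; first exact: mem_head.
    by rewrite A0 inE.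
  by exists (next c a); [rewrite mem_next Ac|apply: D_A; apply: imset_f].
apply: (@separator_card _ _ A H x0 y hconn) => //.
- by move=> u v uH /(H_nbr uH)[vH|vA]; rewrite inE ?vH ?vA ?orbT.
- exact: x0H.
- by apply: contra x0c => /Ac.
- by apply: contraTN yc => /H_c.
Qed.

(** If all edges from [a] and [a'] to [H] ended at [x], exchanging [a] and [a'] for [x] would turn
    [A] into [k - 2] vertices that separate the rest of [H]. *)
Lemma join2 a a' : a \in A -> a' \in A -> a != a' ->
  exists x x', [/\ x \in H, x' \in H, adj a x, adj a' x' & x != x'].
Proof.
move=> aA a'A aa; have [x xH ax] := A_H aA; have [x' x'H ax'] := A_H a'A.
have [Exx|xx] := eqVneq x x'; last by exists x, x'.
subst x'; have [x1 x1H x01] := H_edge.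
have [y yH yx] : exists2 y, y \in H & y != x.
  have [E|ne] := eqVneq x0 x; last by exists x0; rewrite ?x0H.
  by exists x1; rewrite // -E eq_sym (adj_neq x01).
have [/exists_inP[z zH /andP[zx /orP[az|az]]]|] :=
  boolP [exists z in H, (z != x) && (adj a z || adj a' z)].
- by exists z, x; split=> //.
- by exists x, z; split=> //; rewrite eq_sym.
move=> /exists_inPn nz; exfalso.
have xA : x \notin A by apply: contraTN xH => /A_nH.
have cS : #|x |: (A :\ a :\ a')| = k.-2.
  have := cardsD1 a' (A :\ a); have := cardsD1 a A.
  rewrite in_setD1 eq_sym aa a'A aA card_A cardsU1 !in_setD1 (negPf xA) !andbF /=.
  by move: hk; move: #|_| #|_| => m1 m2; clear; lia.
have [d dD] : exists d, d \in D by exists (next c a); apply: imset_f.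
have: k.-1 <= #|x |: (A :\ a :\ a')|.
  apply: (@separator_card _ _ _ (H :\ x) y d hconn).
  - move=> u v; rewrite in_setD1 => /andP[ux uH] uv; rewrite !in_setU !in_setD1 in_set1.
    have [//|vx] := eqVneq v x; case: (H_nbr uH uv) => [vH|vA]; first by rewrite vH ?orbT.
    rewrite vA; have := nz u uH; rewrite ux /= negb_or => /andP[nau na'u].
    have va : v != a by apply: contraNneq nau => <-; rewrite adj_sym.
    have va' : v != a' by apply: contraNneq na'u => <-; rewrite adj_sym.
    by rewrite va va' orbT.
  - by rewrite in_setD1 yx.
  - rewrite in_setU1 (negPf yx) !in_setD1 /=.
    by apply: contraTN yH => /and3P[_ _ /A_nH].
  - by rewrite in_setD1 (negPf (D_nH dD)) andbF.
  - rewrite in_setU1 !in_setD1 (negPf (D_A dD)) !andbF orbF.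
    by apply: contraTneq dD => ->; apply/negP=> /D_nH; rewrite xH.
by rewrite cS; case: (k) hk => [|[|m]] //=; rewrite ltnn.
Qed.

Lemma join_two a a' : a \in A -> a' \in A -> a != a' -> exists s x y,
  [/\ walk x y s, adj a x, adj y a', uniq s & (forall z, z \in s -> z \notin c) /\ 1 < size s].
Proof.
move=> aA a'A aa; have [x [y [xH yH ax ay xy]]] := join2 aA a'A aa.
have [s [W U sH]] := H_walk xH yH; exists s, x, y; split=> //; first by rewrite adj_sym.
split; first by move=> z /sH/H_c.
case: s W {U sH} => [|u [|v s]] //=.
by rewrite /walk /= => /andP[/eqP-> /eqP E]; rewrite E eqxx in xy.
Qed.

(** A walk with two vertices through [H] pays for skipping the single vertex [d]. *)
Lemma next_D_A d : d \in D -> next c d \notin A.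
Proof.
case/imsetP=> a aA ->; apply/negP=> fA.
have nfa : a != next c (next c a) by rewrite eq_sym (next_next_neq Uc c2) ?Ac.
have [q [x [y [Wq ax yf Uq [qc q1]]]]] := join_two aA fA nfa.
have [n [s En]] := attach_rot Lc Ac aA.
case: s En => [|f s] En.
  have: size (rot n c) = 2 by rewrite En.
  by rewrite size_rot => E; move: c2; rewrite E.
have Ef : f = next c (next c a).
  by apply/esym; apply: (@next_piece _ _ Lc n [::] (next c a) [::] f (s ++ [:: a])); rewrite En.
have := @piece_walk _ _ Lc n [:: next c a] (f :: s ++ [:: a]) [::] a.
rewrite cats0 => /(_ En isT); rewrite /= last_cat /= => W.
rewrite -Ef in yf.
apply: (@longest_exchange _ _ Lc ((f :: s ++ [:: a]) ++ q) q [:: next c a]) => //.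
  exact: (walk_cycle (walk_cat W ax Wq)).
by apply: perm_trans (perm_cat_rot q En); perm_count.
Qed.

(** The rerouting of [attach_stable] started one vertex later: [d] is lost and at least two vertices
    are gained. *)
Lemma next_D_hit d d' : d \in D -> d' \in D -> adj (next c d) d' -> d' = d.
Proof.
move=> dD d'D fd; apply/eqP/negPn/negP; rewrite eq_sym => dd.
have [a [a' [s1 [s2 [n [aA a'A En W1 W2]]]]]] := attach_cut Lc Ac join dD d'D dd.
have [q [x [y [Wq ax ya Uq [qc q1]]]]] := join_two a'A aA (attach_cut_neq Lc En W2).
case: s1 En W1 => [|f s1] En W1.
  have Ef : next c d = a'.
    by apply: (@next_piece _ _ Lc n [::] d [::] a' (d' :: s2)); rewrite En.
  by move: (next_D_A dD); rewrite Ef a'A.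
have Ef : next c d = f.
  by apply: (@next_piece _ _ Lc n [::] d [::] f (s1 ++ [:: a'] ++ d' :: s2)); rewrite En /= -catA.
rewrite Ef in fd.
have [_ _ W3] := @walk_cut _ _ _ [::] _ _ _ W1.
apply: (@longest_exchange _ _ Lc (((f :: s1 ++ [:: a']) ++ q) ++ rev (d' :: s2)) q [:: d]) => //.
  refine (walk_cycle (walk_cat (walk_cat W3 ax Wq) ya (walk_rev W2)) _).
  by rewrite adj_sym.
by apply: perm_trans (perm_cat_rot q En); perm_count.
Qed.

(** Otherwise [v |: D] is a stable set of [k] vertices avoiding [H] and [A]. *)
Lemma D_hit v : v \notin H -> v \notin A -> v \notin D -> exists2 d, d \in D & adj v d.
Proof.
move=> vH vA vD; apply/exists_inP; apply: contraT => /exists_inPn nv.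
have : #|v |: D| < k.
  apply: stable_off => [x y|z].
    move=> /setU1P[->|xD] /setU1P[->|yD]; first by rewrite adj_irr.
    - exact: nv.
    - by rewrite adj_sym; apply: nv.
    - exact: D_stable.
  by case/setU1P=> [->//|zD]; rewrite D_nH // D_A.
by rewrite cardsU1 vD card_D card_A; case: (k) hk => //= m _; rewrite add1n ltnn.
Qed.

Lemma A_ex : exists a, a \in A.
Proof. by apply/card_gt0P; rewrite card_A; case: (k) hk => [|[|m]]. Qed.

Lemma card_D1 d : d \in D -> #|D :\ d| = k.-2.
Proof.
by move=> dD; have := cardsD1 d D; rewrite dD card_D card_A add1n => E; rewrite E.
Qed.

(** Freeness is applied to the edge from [d] to its successor: neither end sees [H], nor [D :\ d] by
    [next_D_hit], and two nonadjacent vertices of [H] bring the [k - 2] vertices of [D :\ d] up to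
    [k]. *)
Lemma H_clique x y : x \in H -> y \in H -> x != y -> adj x y.
Proof.
move=> xH yH xy; apply/negPn/negP=> nxy; have [a aA] := A_ex.
set d := next c a; have dD : d \in D by apply: imset_f.
have ac := Ac aA; have dc : d \in c by rewrite mem_next.
have df := next_cycle cc dc.
have fH : next c d \notin H by apply: contraTN dc => /H_c; rewrite mem_next.
have fA := next_D_A dD.
pose J := [set x; y] :|: (D :\ d).
have JD z : z \in J -> [\/ z = x, z = y | z \in D /\ z != d].
  rewrite in_setU in_set2 in_setD1 => /orP[/orP[]/eqP->|/andP[]]; by [constructor 1|constructor 2|constructor 3].
have xD z : z \in D -> ~~ adj x z by move=> zD; apply: H_nadj; rewrite ?D_nH ?D_A.
have yD z : z \in D -> ~~ adj y z by move=> zD; apply: H_nadj; rewrite ?D_nH ?D_A.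
have : #|J| < k.
  apply: (free_stable hfree df) => [u v|z].
    case/JD=> [->|->|[uD _]]; case/JD=> [->|->|[vD _]];
      by [rewrite adj_irr | exact: nxy | rewrite adj_sym | exact: xD | exact: yD
        | rewrite adj_sym xD | rewrite adj_sym yD | exact: D_stable].
  case/JD=> [->|->|[zD zd]].
  - by rewrite adj_sym xD // adj_sym H_nadj.
  - by rewrite adj_sym yD // adj_sym H_nadj.
  split; first exact: D_stable.
  by apply: contraNN zd => /(next_D_hit dD zD)->.
have -> : J = x |: (y |: (D :\ d)) by rewrite /J setUA.
have nD z : z \in H -> z \notin D :\ d.
  by move=> zH; rewrite in_setD1 negb_and; apply/orP; right; apply: contraTN zH => /D_nH.
rewrite !cardsU1 in_setU1 (negPf xy) !nD //= card_D1 //.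
by move: hk; clear; lia.
Qed.

Lemma H_span a a' : a \in A -> a' \in A -> a != a' ->
  exists s x y, [/\ walk x y s, adj a x, adj y a' & perm_eq s (enum H)].
Proof.
move=> aA a'A aa; have [x [y [xH yH ax ay xy]]] := join2 aA a'A aa.
have clH : clique (enum H) by move=> u v; rewrite !mem_enum; apply: H_clique.
have [||s ps W] := clique_walk clH (enum_uniq _) _ _ xy; rewrite ?mem_enum //.
by exists s, x, y; split=> //; rewrite adj_sym.
Qed.

(** * Private vertices and the vertices off the cycle *)

Definition private d v :=
  [&& v \notin A, v \notin H & [forall d' in D, (v == d') || adj v d' ==> (d' == d)]].

Lemma private_eq d v d' : private d v -> d' \in D -> (v == d') || adj v d' -> d' = d.
Proof. by case/and3P=> _ _ /forall_inP h /h{}h /(implyP h)/eqP. Qed.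

Lemma private_D d : d \in D -> private d d.
Proof.
move=> dD; rewrite /private D_A ?D_nH //=; apply/forall_inP=> d' d'D; apply/implyP.
by rewrite (negPf (D_stable dD d'D)) orbF eq_sym.
Qed.

Lemma private_next d : d \in D -> private d (next c d).
Proof.
move=> dD; have fc : next c d \in c by rewrite mem_next D_c.
rewrite /private next_D_A //=; apply/andP; split; first by apply: contraTN fc => /H_c.
apply/forall_inP=> d' d'D; apply/implyP=> /orP[/eqP E|/(next_D_hit dD d'D)->//].
have := next_cycle cc (D_c dD); rewrite E => ad.
by move: (D_stable dD d'D); rewrite ad.
Qed.

Lemma private_adj d v : d \in D -> private d v -> v != d -> adj v d.
Proof.
move=> dD pv vd; case/and3P: (pv) => vA vH _.
have vD : v \notin D.
  by apply: contra vd => vD; rewrite [v](private_eq pv vD) ?eqxx.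
have [d' d'D ad] := D_hit vH vA vD.
by rewrite -(private_eq pv d'D _) ?ad ?orbT.
Qed.

(** Nonadjacent [u] and [v] could replace [d] in [D], giving a stable set of [k] vertices away from
    [H] and [A]. *)
Lemma private_clique d u v : d \in D -> private d u -> private d v -> u != v -> adj u v.
Proof.
move=> dD pu pv uv.
have [Eu|ud] := eqVneq u d; first by rewrite Eu adj_sym private_adj // -Eu eq_sym.
have [->|vd] := eqVneq v d; first exact: private_adj.
apply/negPn/negP=> nuv; case/and3P: (pu) (pv) => uA uH _ /and3P[vA vH _].
pose J := u |: (v |: (D :\ d)).
have JD z : z \in J -> [\/ z = u, z = v | z \in D /\ z != d].
  rewrite !in_setU1 in_setD1 => /or3P[/eqP->|/eqP->|/andP[]];
    by [constructor 1|constructor 2|constructor 3].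
have nD w z : private d w -> z \in D -> z != d -> ~~ adj w z.
  by move=> pw zD; apply: contraNN => wz; rewrite (private_eq pw zD) ?wz ?orbT.
have nD' w : private d w -> w != d -> w \notin D :\ d.
  move=> pw wd; rewrite in_setD1 wd; apply: contraNN wd => wD.
  by rewrite [w](private_eq pw wD) ?eqxx.
have : #|J| < k.
  apply: stable_off => [y z|z].
    case/JD=> [->|->|[yD yd]]; case/JD=> [->|->|[zD zd]];
      by [rewrite adj_irr | exact: nuv | rewrite adj_sym | exact: nD
        | rewrite adj_sym nD | exact: D_stable].
  by case/JD=> [->|->|[zD _]] //; rewrite D_nH // D_A.
rewrite !cardsU1 in_setU1 (negPf uv) !nD' //= card_D1 //.
by move: hk; clear; lia.
Qed.

(** Outside [H], [v] would have a neighbour [v'] that is also off [c] and outside [H]. By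
    [attach_no_detour] both see the same single vertex [d] of [D]. Being private to [d], [v] also
    sees the successor of [d] and can be inserted between the two. *)
Lemma off_cycle v : v \notin c -> v \in H.
Proof.
move=> vc; apply/negPn/negP=> vH.
have [v' v'c vv] := noiso vc.
have v'H : v' \notin H.
  by apply: contra vH => v'H; apply: H_step v'H _ vc; rewrite adj_sym.
have nA w : w \notin c -> w \notin A by apply: contra => /Ac.
have nD w : w \notin c -> w \notin D by apply: contra => /D_c.
have [d dD vd] := D_hit vH (nA _ vc) (nD _ vc).
have [d' d'D vd'] := D_hit v'H (nA _ v'c) (nD _ v'c).
have same e e' : e \in D -> e' \in D -> adj v e -> adj v' e' -> e = e'.
  move=> eD e'D ve ve'; apply/eqP/negPn/negP=> ee.
  apply: (@attach_no_detour _ _ Lc A Ac join e e' [:: v'; v] v' v) => //.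
  - by rewrite /walk /= !eqxx adj_sym vv.
  - by rewrite adj_sym.
  - by rewrite /= inE eq_sym (adj_neq vv).
  - by move=> z; rewrite !inE => /orP[]/eqP->.
  - move=> a a' /A_H[x xH ax] /A_H[y yH ay] _; have [s [W U sH]] := H_walk xH yH.
    exists s, x, y; split=> //; first by rewrite adj_sym.
    + rewrite cat_uniq U /= inE eq_sym (adj_neq vv) !andbT; apply/hasPn=> z /sH zH.
      by rewrite !inE negb_or; apply/andP; split; apply: contraTneq zH => ->.
    + by move=> z /sH/H_c.
have pv : private d v.
  rewrite /private nA // vH; apply/forall_inP=> e eD; apply/implyP=> /orP[/eqP E|ve].
    by move: (nD _ vc); rewrite E eD.
  by rewrite (same e d' eD d'D ve vd') (same d d' dD d'D vd vd').
have dc := D_c dD.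
have vf : adj v (next c d).
  apply: private_clique dD pv (private_next dD) _.
  by apply: contraNneq vc => ->; rewrite mem_next.
have [|||s cs ps] := @cycle_insert _ c [:: v] d (next c d) v v Uc (ltnW c2) cc dc _ _ (walk1 v) _ vf.
- by rewrite mem_next.
- by rewrite /nb eqxx.
- by rewrite adj_sym.
apply: (@longest_exchange _ _ Lc s [:: v] [::]) => //.
by move=> z; rewrite inE => /eqP->.
Qed.

Lemma component_absurd : False.
Proof.
have nHc v : v \in c -> v \notin H by move=> vc; apply: contraTN vc => /H_c.
apply: (@chains_absurd G k c H A private) => //.
- by move=> v; apply/idP/idP => [/H_c|/off_cycle].
- have [x1 x1H x01] := H_edge; apply/card_gt1P; exists x0, x1; split=> //.
    exact: x0H.
  exact: adj_neq.
- exact: card_A.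
- exact: H_nbr.
- exact: H_span.
- exact: D_A.
- exact: next_D_A.
- move=> v vc vA; have [vD|vD] := boolP (v \in D); first by exists v; rewrite ?eqxx.
  by have [d dD ad] := D_hit (nHc v vc) vA vD; exists d; rewrite // ad orbT.
- move=> d v /and3P[vA vH _]; split=> //; apply: contraR vH; exact: off_cycle.
- exact: private_eq.
- move=> d v vc vA; rewrite /private vA nHc //= => /forall_inPn[d' d'D].
  by rewrite negb_imply andbC => h; exists d'.
- exact: private_D.
- exact: private_next.
- exact: private_clique.
Qed.

End Component.

Theorem theorem1 (k : nat) (G : sgraph)
    (hk : 4 <= k)
    (htough : one_tough G)
    (hconn : k_connected k.-1 G)
    (hfree : free_of (P2_kP1 k) G)
    (hcard : k ^ 2 + k + 1 <= #|G|)
    (hdeg : k <= min_deg G) :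
  hamiltonian G.
Proof.
have k1 : 2 <= k.-1 by move: hk; clear; lia.
have k2 : 2 <= k by move: hk; clear; lia.
have [c0 [s0 cc0 Uc0]] := exists_cycle k1 hconn (leq_trans k2 hdeg).
have [c Lc] := exists_longest s0 cc0 Uc0; have [c3 cc Uc _] := Lc.
have [/forallP all_c|/forallPn[h hc]] := boolP [forall x, x \in c].
  by exists c; split=> //; rewrite /ucycle cc Uc.
exfalso.
have [/exists_inP[v vc /forall_inP iso]|/exists_inPn niso] :=
    boolP [exists v in [set v | v \notin c], [forall w in [set w | w \notin c], ~~ adj v w]].
  rewrite inE in vc; apply: (isolated_vertex_absurd hk htough hfree hcard hdeg Lc vc).
  by move=> y yc; apply: iso; rewrite inE.
apply: (component_absurd hk htough hconn hfree hdeg Lc hc) => v vc.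
have := niso v; rewrite inE => /(_ vc)/forall_inPn[w]; rewrite inE negbK => wc vw.
by exists w.
Qed.
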